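(* There exist sequences $\{z_i\}$ and $\{w_i\}$ in $\mathbb{D}$, both with finite associated measures, such that $\{z_i\}$ is universally interpolating and $\{w_i\}$ is onto interpolating for the Dirichlet space $\mathcal{D}$, and their union $\{z_i\}\cup\{w_i\}$ is weakly separated but is not an onto interpolating sequence for $\mathcal{D}$.
   Context: $\mathbb{D}$ is the open unit disc and $dA=dx\,dy/\pi$. The Dirichlet space $\mathcal{D}$ is the Hilbert space of analytic functions $f$ in $\mathbb{D}$ with $\Vert f\Vert_{\mathcal{D}}^2:=\Vert f\Vert_{H^2}^2+\int_{\mathbb{D}}|f'|^2dA<+\infty$, where $\Vert f\Vert_{H^2}^2=\sup_{0<r<1}\frac1{2\pi}\int_0^{2\pi}|f(re^{i\theta})|^2d\theta$. Its reproducing kernel is $k_z(w)=\frac{1}{w\overline z}\log\frac{1}{1-w\overline z}$, and $d(z):=\Vert k_z\Vert_{\mathcal{D}}^2=\frac{1}{|z|^2}\log\frac{1}{1-|z|^2}$ (with $d(0)=1$). A sequence $\{z_i\}$ has finite associated measure if $\sum_i1/d(z_i)<+\infty$. It is onto interpolating for $\mathcal{D}$ if for every $\{a_i\}\in\ell^2$ there is $f\in\mathcal{D}$ with $f(z_i)/\sqrt{d(z_i)}=a_i$ for all $i$. It is universally interpolating for $\mathcal{D}$ if it is onto interpolating and moreover $f\mapsto\{f(z_i)/\sqrt{d(z_i)}\}$ is a bounded linear operator from $\mathcal{D}$ to $\ell^2$. $d_h$ is the hyperbolic distance in $\mathbb{D}$, invariant under disc automorphisms and normalized by $d_h(r,0)=\log_2\frac{1+r}{1-r}$,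 $0<r<1$. A sequence is weakly separated if there is $\varepsilon>0$ such that any two distinct points $z,w$ of the sequence satisfy $d_h(z,w)\ge\varepsilon(d_h(z,0)+1)$. *)

(* Defs.v *)
From mathcomp Require Import all_boot all_order all_algebra.
From mathcomp Require Import all_classical all_reals all_analysis.
From mathcomp Require Export complex.
Set Implicit Arguments.
Unset Strict Implicit.
Unset Printing Implicit Defensive.
Import Order.TTheory GRing.Theory Num.Theory.
Import numFieldNormedType.Exports.
Local Open Scope classical_set_scope.
Local Open Scope ring_scope.

(* The library norm [`|z|] on R[i] takes values in R[i]; this one is in R. *)
Definition cabs (R : realType) (z : R[i]) : R := Normc.normc z.

Definition unit_disc (R : realType) : set R[i] := [set z | cabs z < 1].

(* [R[i]^o] carries the norm topology of the field R[i], so that [derivable]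
   and [derive1] are complex differentiability and the complex derivative.
   Functions are total; their values outside the disc are irrelevant. *)
Definition analytic_in_disc (R : realType) (f : R[i] -> R[i]) : Prop :=
  forall z, unit_disc z -> derivable (f : R[i]^o -> R[i]^o) z 1.

Definition cderiv (R : realType) (f : R[i] -> R[i]) : R[i] -> R[i] :=
  derive1 (f : R[i]^o -> R[i]^o).

Definition circle_point (R : realType) (r t : R) : R[i] :=
  Complex (r * cos t) (r * sin t).

Definition circle_mean (R : realType) (f : R[i] -> R[i]) (r : R) : \bar R :=
  ((2 * pi)^-1%:E * \int[@lebesgue_measure R]_(t in `[0%R, (2 * pi)%R])
     (cabs (f (circle_point r t)) ^+ 2)%:E)%E.

Definition hardy_sqnorm (R : realType) (f : R[i] -> R[i]) : \bar R :=
  ereal_sup [set circle_mean f r | r in [set r : R | 0 < r < 1]].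

Definition dirichlet_integral (R : realType) (f : R[i] -> R[i]) : \bar R :=
  (pi^-1%:E *
   \int[@lebesgue_measure R \x @lebesgue_measure R]_(p in
       [set p | unit_disc (Complex p.1 p.2)])
     (cabs (cderiv f (Complex p.1 p.2)) ^+ 2)%:E)%E.

Definition dirichlet_sqnorm (R : realType) (f : R[i] -> R[i]) : \bar R :=
  (hardy_sqnorm f + dirichlet_integral f)%E.

Definition dirichlet_space (R : realType) : set (R[i] -> R[i]) :=
  [set f | analytic_in_disc f /\ (dirichlet_sqnorm f < +oo)%E].

(* The squared norm of the reproducing kernel at [z], in closed form. *)
Definition kernel_sqnorm (R : realType) (z : R[i]) : R :=
  if z == 0 then 1 else (cabs z ^+ 2)^-1 * ln ((1 - cabs z ^+ 2)^-1).

Definition l2_sqnorm (R : realType) (a : nat -> R[i]) : \bar R :=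
  (\sum_(0 <= i <oo) (cabs (a i) ^+ 2)%:E)%E.

Definition little_l2 (R : realType) : set (nat -> R[i]) :=
  [set a | (l2_sqnorm a < +oo)%E].

Definition in_disc (R : realType) (z : nat -> R[i]) : Prop :=
  forall i, unit_disc (z i).

Definition finite_associated_measure (R : realType) (z : nat -> R[i]) : Prop :=
  (\sum_(0 <= i <oo) ((kernel_sqnorm (z i))^-1)%:E < +oo)%E.

Definition weighted_restriction (R : realType) (z : nat -> R[i])
    (f : R[i] -> R[i]) : nat -> R[i] :=
  fun i => f (z i) / real_complex R (Num.sqrt (kernel_sqnorm (z i))).

Definition onto_interpolating (R : realType) (z : nat -> R[i]) : Prop :=
  forall a, little_l2 a -> exists2 f, dirichlet_space f &
    forall i, weighted_restriction z f i = a i.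

(* Linearity of [weighted_restriction z] is automatic. *)
Definition bounded_restriction (R : realType) (z : nat -> R[i]) : Prop :=
  exists M : R, forall f, dirichlet_space f ->
    (l2_sqnorm (weighted_restriction z f) <= (M ^+ 2)%:E * dirichlet_sqnorm f)%E.

Definition universally_interpolating (R : realType) (z : nat -> R[i]) : Prop :=
  onto_interpolating z /\ bounded_restriction z.

Definition pseudo_hyperbolic (R : realType) (z w : R[i]) : R :=
  cabs ((z - w) / (1 - conjc w * z)).

(* The distance in base-2 normalization: for [0 < r < 1] the distance from [r]
   to [0] is log_2 ((1 + r) / (1 - r)); it is invariant under automorphisms of
   the disc because the pseudo-hyperbolic distance is. *)
Definition hyperbolic_dist (R : realType) (z w : R[i]) : R :=
  ln ((1 + pseudo_hyperbolic z w) / (1 - pseudo_hyperbolic z w)) / ln 2.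

Definition weakly_separated (R : realType) (z : nat -> R[i]) : Prop :=
  exists2 eps : R, 0 < eps & forall i j, z i <> z j ->
    eps * (hyperbolic_dist (z i) 0 + 1) <= hyperbolic_dist (z i) (z j).

(* [u] lists each point of {z_i} U {w_i} exactly once, so that a point common
   to both sequences imposes a single interpolation condition. *)
Definition enumerates_union (R : realType) (u z w : nat -> R[i]) : Prop :=
  injective u /\ range u = range z `|` range w.

(* Main.v *)
(** Write K(t) = sum_n t^n / (n + 1), so that the kernels at x and y have inner
product K(y conj x); K(t) is within O(1) of log m as soon as m |1 - t| is bounded
above and below.  Take m_0 << m_1 << ... growing fast enough, and in cluster k put
z_k at distance about 1/m_k from 1 together with about 16^k points w_p lying at
height p/m_k and at depth about 1/m_k^2 below the circle.  With A = log m_k, all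
kernels of the cluster have inner products A + o(A), except that the kernel at w_p
has squared norm 2 A + o(A), while distinct clusters are almost orthogonal.  Hence
the normalized kernels at the z_k are almost orthonormal, and so are the normalized
differences k_{w_p} - k_{z_k}; a Neumann series then solves either interpolation
problem.  In the union, however, k_{z_k} minus the average of M = 16^k of the
k_{w_p} has squared norm O(A / M), so that f(w_p) = 0 forces
|f(z_k)|^2 / A = O(1 / M), which rules out f(z_k) = 2^-k sqrt(d(z_k)).

For the definition of the Dirichlet space through area integrals and circular
means, a function complex differentiable in the disc is expanded in a Taylor series
by Goursat's argument in log-polar coordinates.  The area integral of a power
series comes from invariance under rotations, whose averages remove the cross
terms, and under dilations, which give the moments without polar coordinates. *)

Require Import Defs.
From mathcomp Require Import all_boot all_order all_algebra.
From mathcomp Require Import all_classical all_reals all_analysis.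
From mathcomp Require Import ring lra.
From mathcomp Require Import zify measurable_realfun.

Set Implicit Arguments.
Unset Strict Implicit.
Unset Printing Implicit Defensive.
Import Order.TTheory GRing.Theory Num.Theory.
Import numFieldNormedType.Exports.
Local Open Scope classical_set_scope.
Local Open Scope ring_scope.

(** The depth [1 / m_k^2] of the [w_p] is what makes the differences [k_(w_p) - k_(z_k)] work twice.
    Up to o(A), such a difference has squared norm 2 A - 2 A + A = A and inner product A - A - A + A
    = 0 with another difference of its cluster; its value at [w_q] is 2 A - A = A for q = p and A -
    A = 0 otherwise. So these vectors are almost orthogonal and at the same time almost dual to the
    evaluations at the [w_p]. The kernels at the [w_p] themselves keep normalized inner products
    near 1/2, which is why the w-problem is solved with other vectors than its kernels. The number
    of points of a cluster is fixed before [m_k], so [log m_k] can dominate every error they cause;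
    all errors are measured against the summable weights [eta]. The size 16^k is played against the
    data 2^-k: the value 4^-k of |f(z_k)|^2 / d(z_k) would have to be O(16^-k). Estimates live on
    Taylor coefficients, with squared norm sum (n + 1) |a_n|^2. The area of the disc stays an
    unevaluated constant, so this norm is compared with the integral norm only up to a constant
    factor. *)

Section ComplexModulus.
Variable R : realType.
Implicit Types (x y z : R[i]) (a b : R).

Lemma cabsE z : cabs z = `|z : Rcomplex R|.
Proof. by []. Qed.

Lemma cabs_ge0 z : 0 <= cabs z.
Proof. by rewrite cabsE. Qed.

Lemma cabsD x y : cabs (x + y) <= cabs x + cabs y.
Proof. exact: (ler_normD (x : Rcomplex R) y). Qed.

Lemma cabsN z : cabs (- z) = cabs z.
Proof. exact: (normrN (z : Rcomplex R)). Qed.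

Lemma cabsBC x y : cabs (x - y) = cabs (y - x).
Proof. exact: (distrC (x : Rcomplex R) y). Qed.

Lemma cabsB x y : cabs (x - y) <= cabs x + cabs y.
Proof. by rewrite -(cabsN y) cabsD. Qed.

Lemma cabsB_ge x y : cabs x - cabs y <= cabs (x - y).
Proof. exact: (lerB_dist (x : Rcomplex R) y). Qed.

Lemma cabsM x y : cabs (x * y) = cabs x * cabs y.
Proof. exact: Normc.normcM. Qed.

Lemma cabsV x : cabs x^-1 = (cabs x)^-1.
Proof. exact: Normc.normcV. Qed.

Lemma cabs0 : cabs (0 : R[i]) = 0.
Proof. exact: Normc.normc0. Qed.

Lemma cabs1 : cabs (1 : R[i]) = 1.
Proof. exact: Normc.normc1. Qed.

Lemma cabs_eq0 z : (cabs z == 0) = (z == 0).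
Proof. exact: (normr_eq0 (z : Rcomplex R)). Qed.

Lemma cabs_gt0 z : (0 < cabs z) = (z != 0).
Proof. exact: (normr_gt0 (z : Rcomplex R)). Qed.

Lemma cabsX z n : cabs (z ^+ n) = cabs z ^+ n.
Proof.
by elim: n => [|n IHn]; rewrite ?expr0 ?cabs1// !exprS cabsM IHn.
Qed.

Lemma cabs_sqr z : cabs z ^+ 2 = complex.Re z ^+ 2 + complex.Im z ^+ 2.
Proof. by case: z => a b; rewrite /cabs/= sqr_sqrtr// addr_ge0// sqr_ge0. Qed.

Lemma cabsC a : cabs (real_complex R a) = `|a|.
Proof. by rewrite /cabs/= expr0n/= addr0 sqrtr_sqr. Qed.

Lemma cabs_conj z : cabs (conjc z) = cabs z.
Proof. by case: z => a b; rewrite /cabs/= sqrrN. Qed.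

Lemma cabs_nat n : cabs (n%:R : R[i]) = n%:R.
Proof. by rewrite -(rmorph_nat (real_complex R)) cabsC ger0_norm. Qed.

Lemma normRe_le z : `|complex.Re z| <= cabs z.
Proof.
rewrite -(@ler_pXn2r _ 2)// ?nnegrE ?cabs_ge0// cabs_sqr real_normK ?num_real//.
by rewrite lerDl sqr_ge0.
Qed.

Lemma normIm_le z : `|complex.Im z| <= cabs z.
Proof.
rewrite -(@ler_pXn2r _ 2)// ?nnegrE ?cabs_ge0// cabs_sqr real_normK ?num_real//.
by rewrite lerDr sqr_ge0.
Qed.

Lemma Re_le_cabs z : complex.Re z <= cabs z.
Proof. exact: le_trans (ler_norm _) (normRe_le z). Qed.

Lemma cabs_leD z : cabs z <= `|complex.Re z| + `|complex.Im z|.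
Proof.
rewrite -(@ler_pXn2r _ 2)// ?nnegrE ?cabs_ge0 ?addr_ge0// cabs_sqr.
rewrite -(real_normK (num_real (complex.Re z))).
rewrite -(real_normK (num_real (complex.Im z))) sqrrD -addrA lerD2l lerDr.
by rewrite mulrn_wge0// mulr_ge0.
Qed.

Lemma cabs_sum (I : Type) (r : seq I) (P : pred I) (F : I -> R[i]) :
  cabs (\sum_(i <- r | P i) F i) <= \sum_(i <- r | P i) cabs (F i).
Proof. exact: (ler_norm_sum r (F : I -> Rcomplex R)). Qed.

Lemma cReD x y : complex.Re (x + y) = complex.Re x + complex.Re y.
Proof. by case: x y => [? ?] [? ?]. Qed.

Lemma cImD x y : complex.Im (x + y) = complex.Im x + complex.Im y.
Proof. by case: x y => [? ?] [? ?]. Qed.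

Lemma cReN x : complex.Re (- x) = - complex.Re x.
Proof. by case: x. Qed.

Lemma cImN x : complex.Im (- x) = - complex.Im x.
Proof. by case: x. Qed.

Lemma cReM x y : complex.Re (x * y) =
  complex.Re x * complex.Re y - complex.Im x * complex.Im y.
Proof. by case: x y => [? ?] [? ?]. Qed.

Lemma cImM x y : complex.Im (x * y) =
  complex.Re x * complex.Im y + complex.Im x * complex.Re y.
Proof. by case: x y => [? ?] [? ?]. Qed.

Lemma cRe_sum (I : Type) (r : seq I) (P : pred I) (F : I -> R[i]) :
  complex.Re (\sum_(i <- r | P i) F i) = \sum_(i <- r | P i) complex.Re (F i).
Proof. exact: (big_morph _ cReD). Qed.

Lemma cIm_sum (I : Type) (r : seq I) (P : pred I) (F : I -> R[i]) :
  complex.Im (\sum_(i <- r | P i) F i) = \sum_(i <- r | P i) complex.Im (F i).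
Proof. exact: (big_morph _ cImD). Qed.

Lemma mulc_conj z : z * conjc z = real_complex R (cabs z ^+ 2).
Proof.
case: z => a b; rewrite cabs_sqr/=; apply/eqP; rewrite eq_complex/=.
by apply/andP; split; apply/eqP; ring.
Qed.

End ComplexModulus.

(** * Limits and absolutely convergent series of complex numbers *)

Definition ctends (R : realType) (u : nat -> R[i]) (l : R[i]) : Prop :=
  forall e : R, 0 < e -> exists N, forall n, (N <= n)%N -> cabs (u n - l) <= e.

(** A total function: the value is 0 when the partial sums diverge. *)
Definition csum (R : realType) (u : nat -> R[i]) : R[i] :=
  xget 0 [set l | ctends (fun n => \sum_(i < n) u i) l].

Section ComplexLimits.
Variable R : realType.
Implicit Types (u v : nat -> R[i]) (k l c : R[i]) (B C : R).

(** The factor C lets later estimates lose a constant multiple of e without renormalizing it. *)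
Lemma le_of_eps (a b C : R) : 0 <= C -> (forall e : R, 0 < e -> a <= b + C * e) -> a <= b.
Proof.
move=> C0 h; apply/ler_addgt0Pr => e e0.
have C1 : 0 < C + 1 by rewrite ltr_wpDl.
apply: le_trans (h (e / (C + 1)) _) _; first exact: divr_gt0.
rewrite lerD2l mulrCA ger_pMr// ler_pdivrMr// mul1r.
by rewrite lerDl.
Qed.

Lemma ctends_unique u k l : ctends u k -> ctends u l -> k = l.
Proof.
move=> uk ul; apply/eqP; rewrite -subr_eq0 -cabs_eq0 eq_le cabs_ge0 andbT.
apply: (@le_of_eps _ _ 2) => // e e0.
have [N HN] := uk e e0; have [M HM] := ul e e0.
have h1 := HN (maxn N M) (leq_maxl _ _); have h2 := HM (maxn N M) (leq_maxr _ _).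
rewrite add0r mulr_natl mulr2n.
apply: le_trans (lerD h1 h2); rewrite (cabsBC _ k).
by apply: le_trans (cabsD _ _); rewrite addrA subrK.
Qed.

Lemma ctends_ext u v l : u =1 v -> ctends u l -> ctends v l.
Proof. by move=> /funext ->. Qed.

Lemma ctends_cst l : ctends (fun=> l) l.
Proof. by move=> e e0; exists 0%N => n _; rewrite subrr cabs0 ltW. Qed.

Lemma ctendsD u v k l : ctends u k -> ctends v l -> ctends (fun n => u n + v n) (k + l).
Proof.
move=> uk vl e e0; have e2 : 0 < e / 2 by rewrite divr_gt0.
have [N HN] := uk _ e2; have [M HM] := vl _ e2.
exists (maxn N M) => n; rewrite geq_max => /andP[/HN h1 /HM h2].
rewrite opprD addrACA (splitr e).
by apply: le_trans (cabsD _ _) (lerD _ _).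
Qed.

Lemma ctendsM u k c : ctends u k -> ctends (fun n => c * u n) (c * k).
Proof.
move=> uk e e0; have c1 : 0 < cabs c + 1 by rewrite ltr_wpDl ?cabs_ge0.
have [N HN] := uk (e / (cabs c + 1)) (divr_gt0 e0 c1).
exists N => n /HN h; rewrite -mulrBr cabsM.
apply: le_trans (ler_wpM2l (cabs_ge0 _) h) _.
by rewrite mulrCA ger_pMr// ler_pdivrMr// mul1r lerDl.
Qed.

Lemma ctendsN u k : ctends u k -> ctends (fun n => - u n) (- k).
Proof.
move=> /(ctendsM (-1)); rewrite mulN1r; apply: ctends_ext => n.
by rewrite mulN1r.
Qed.

Lemma ctendsB u v k l : ctends u k -> ctends v l -> ctends (fun n => u n - v n) (k - l).
Proof. by move=> uk vl; apply: ctendsD uk (ctendsN vl). Qed.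

Lemma ctends_sum (I : Type) (r : seq I) (P : pred I) (F : I -> nat -> R[i]) (L : I -> R[i]) :
  (forall i, P i -> ctends (F i) (L i)) ->
  ctends (fun n => \sum_(i <- r | P i) F i n) (\sum_(i <- r | P i) L i).
Proof.
move=> h; elim: r => [|x r IHr].
  by rewrite big_nil; apply: ctends_ext (ctends_cst 0) => n; rewrite big_nil.
rewrite big_cons; case: ifPn => Px.
  by apply: ctends_ext (ctendsD (h x Px) IHr) => n; rewrite big_cons Px.
by apply: ctends_ext IHr => n; rewrite big_cons (negbTE Px).
Qed.

Lemma ctends_cabs_le u l B :
  ctends u l -> (exists N, forall n, (N <= n)%N -> cabs (u n) <= B) -> cabs l <= B.
Proof.
move=> ul [M HM]; apply: (@le_of_eps _ _ 1) => // e e0; rewrite mul1r.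
have [N HN] := ul e e0.
have h1 := HN (maxn N M) (leq_maxl _ _); have h2 := HM (maxn N M) (leq_maxr _ _).
rewrite addrC -lerBlDr; apply: le_trans _ h1; rewrite cabsBC.
by apply: le_trans (cabsB_ge _ _); rewrite lerD2l lerN2.
Qed.

Lemma ctends_Re_ge u l B :
  ctends u l -> (exists N, forall n, (N <= n)%N -> B <= complex.Re (u n)) ->
  B <= complex.Re l.
Proof.
move=> ul [M HM]; apply: (@le_of_eps _ _ 1) => // e e0; rewrite mul1r.
have [N HN] := ul e e0.
have h1 := HN (maxn N M) (leq_maxl _ _); have h2 := HM (maxn N M) (leq_maxr _ _).
have := le_trans (Re_le_cabs _) h1; rewrite cReD cReN; lra.
Qed.

Lemma csum_ctends u l : ctends (fun n => \sum_(i < n) u i) l -> csum u = l.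
Proof.
move=> ul; apply: (@ctends_unique (fun n => \sum_(i < n) u i)) => //.
exact: (@xgetPex _ 0 [set l | ctends (fun n => \sum_(i < n) u i) l]) (ex_intro _ l ul).
Qed.

Lemma bounded_series_cauchy (b : nat -> R) (B : R) :
  (forall n, 0 <= b n) -> (forall n, \sum_(i < n) b i <= B) ->
  exists2 l : R, (forall n, \sum_(i < n) b i <= l) &
    forall e : R, 0 < e -> exists N, forall n, (N <= n)%N -> l - \sum_(i < n) b i <= e.
Proof.
move=> b0 bB; pose S := fun n => \sum_(i < n) b i.
have Snd m n : (m <= n)%N -> S m <= S n.
  move=> mn; rewrite /S -(subnK mn) addnC big_split_ord/= lerDl.
  by apply: sumr_ge0.
have hs : has_sup (range S).
  split; first by exists (S 0%N); exists 0%N.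
  by exists B => _ [n _ <-]; exact: bB.
exists (sup (range S)).
  by move=> n; apply: sup_upper_bound => //; exists n.
move=> e e0.
have /(sup_adherent e0)[_ [N _ <-] hN] := hs.
exists N => n /Snd; move: hN; rewrite -/(S n); lra.
Qed.

(** Both [b] and [a + b] have nonnegative terms and bounded partial sums, and [a] is their
    difference. *)
Lemma real_series_tends (a b : nat -> R) (B : R) :
  (forall n, `|a n| <= b n) -> (forall n, \sum_(i < n) b i <= B) ->
  exists l : R, forall e : R, 0 < e ->
    exists N, forall n, (N <= n)%N -> `|\sum_(i < n) a i - l| <= e.
Proof.
move=> ab bB.
have b0 n : 0 <= b n by apply: le_trans (ab n).
have [l1 h1 H1] := bounded_series_cauchy b0 bB.
have ab0 n : 0 <= a n + b n by have := ab n; rewrite ler_norml; lra.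
have abB n : \sum_(i < n) (a i + b i) <= B + B.
  rewrite big_split/=; apply: lerD (bB n).
  apply: le_trans (bB n); apply: ler_sum => i _.
  by apply: le_trans (ler_norm _) (ab i).
have [l2 h2 H2] := bounded_series_cauchy ab0 abB.
exists (l2 - l1) => e e0.
have [N HN] := H1 _ e0; have [M HM] := H2 _ e0.
exists (maxn N M) => n; rewrite geq_max => /andP[/HN k1 /HM k2].
have := h1 n; have := h2 n; move: k2; rewrite big_split/= ler_norml; lra.
Qed.

Lemma asum_ctends u B : (forall n, \sum_(i < n) cabs (u i) <= B) ->
  ctends (fun n => \sum_(i < n) u i) (csum u).
Proof.
move=> uB.
have [l1 H1] := real_series_tends (fun n => normRe_le (u n)) uB.
have [l2 H2] := real_series_tends (fun n => normIm_le (u n)) uB.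
suff h : ctends (fun n => \sum_(i < n) u i) (Complex l1 l2) by rewrite (csum_ctends h).
move=> e e0; have e2 : 0 < e / 2 by rewrite divr_gt0.
have [N HN] := H1 _ e2; have [M HM] := H2 _ e2.
exists (maxn N M) => n; rewrite geq_max => /andP[/HN k1 /HM k2].
apply: le_trans (cabs_leD _) _.
by rewrite cReD cImD cReN cImN cRe_sum cIm_sum/= (splitr e) lerD.
Qed.

Lemma csum_cabs_le u B : (forall n, \sum_(i < n) cabs (u i) <= B) -> cabs (csum u) <= B.
Proof.
move=> uB; apply: (ctends_cabs_le (asum_ctends uB)); exists 0%N => n _.
exact: le_trans (cabs_sum _ _ _) (uB n).
Qed.

Lemma csumM u B c : (forall n, \sum_(i < n) cabs (u i) <= B) ->
  csum (fun n => c * u n) = c * csum u.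
Proof.
move=> uB; apply: csum_ctends.
by apply: ctends_ext (ctendsM c (asum_ctends uB)) => n; rewrite mulr_sumr.
Qed.

Lemma csum_sum (I : Type) (r : seq I) (P : pred I) (F : I -> nat -> R[i]) (B : I -> R) :
  (forall i, P i -> forall n, \sum_(j < n) cabs (F i j) <= B i) ->
  csum (fun n => \sum_(i <- r | P i) F i n) = \sum_(i <- r | P i) csum (F i).
Proof.
move=> FB; apply: csum_ctends.
apply: ctends_ext (ctends_sum _ (fun i Pi => asum_ctends (FB i Pi))) => n.
by rewrite exchange_big.
Qed.

Lemma csum_recl u B : (forall n, \sum_(i < n) cabs (u i) <= B) ->
  csum u = u 0%N + csum (fun n => u n.+1).
Proof.
move=> uB; apply: csum_ctends.
have uB' n : \sum_(i < n) cabs (u i.+1) <= B.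
  by apply: le_trans (uB n.+1); rewrite big_ord_recl lerDr cabs_ge0.
move=> e e0; have [N HN] := @asum_ctends (fun i => u i.+1) B uB' e e0; exists N.+1 => -[//|n] Nn.
by rewrite big_ord_recl/= opprD addrACA subrr add0r; apply: HN.
Qed.

End ComplexLimits.
(** * Cauchy's theorem in log-polar coordinates *)

Section SegmentIntegral.
Variable R : realType.
Implicit Types (f g : R -> R) (a b x y e : R).

Definition seg_int f a b : R := \int[@lebesgue_measure R]_(t in `[a, b]) f t.

(** Continuity is two-sided at the end points as well, so it passes to subsegments at once. *)
Definition seg_cont f a b := forall x, a <= x <= b -> {for x, continuous f}.

Lemma seg_contS f a b c d : a <= c -> d <= b -> seg_cont f a b -> seg_cont f c d.
Proof.
move=> ac db h x /andP[cx xd]; apply: h.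
by rewrite (le_trans ac cx) (le_trans xd db).
Qed.

Lemma seg_contB f g a b : seg_cont f a b -> seg_cont g a b ->
  seg_cont (fun x => f x - g x) a b.
Proof. by move=> hf hg x xab; apply: cvgB; [exact: hf|exact: hg]. Qed.

Lemma seg_contD f g a b : seg_cont f a b -> seg_cont g a b ->
  seg_cont (fun x => f x + g x) a b.
Proof. by move=> hf hg x xab; apply: cvgD; [exact: hf|exact: hg]. Qed.

Lemma seg_contZ f k a b : seg_cont f a b -> seg_cont (fun x => k * f x) a b.
Proof. by move=> hf x xab; apply: cvgM; [exact: cvg_cst|exact: hf]. Qed.

Lemma seg_cont_cst k a b : seg_cont (fun=> k) a b.
Proof. by move=> x xab; exact: cvg_cst. Qed.

Lemma seg_integrable f a b : seg_cont f a b ->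
  (@lebesgue_measure R).-integrable `[a, b] (EFin \o f).
Proof.
move=> h; apply: continuous_compact_integrable; first exact: segment_compact.
by apply: continuous_in_subspaceT => x; rewrite inE/= in_itv/= => /h.
Qed.

Lemma seg_int_split f a m b : a <= m -> m <= b -> seg_cont f a b ->
  seg_int f a b = seg_int f a m + seg_int f m b.
Proof.
move=> am mb h; have hi := seg_integrable h.
have := @Rintegral_itvB R f (BLeft a) (BRight b) m hi.
rewrite !bnd_simp => /(_ am mb) /eqP; rewrite subr_eq addrC => /eqP e.
rewrite /seg_int e; congr (_ + _).
apply: Rintegral_itv_obnd_cbnd; apply: integrableS hi => //.
by apply: subset_itv; rewrite bnd_simp.
Qed.

Lemma seg_intD f g a b : seg_cont f a b -> seg_cont g a b ->
  seg_int (fun x => f x + g x) a b = seg_int f a b + seg_int g a b.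
Proof. by move=> hf hg; apply: RintegralD => //; exact: seg_integrable. Qed.

Lemma seg_intB f g a b : seg_cont f a b -> seg_cont g a b ->
  seg_int (fun x => f x - g x) a b = seg_int f a b - seg_int g a b.
Proof. by move=> hf hg; apply: RintegralB => //; exact: seg_integrable. Qed.

Lemma seg_intZ f k a b : seg_cont f a b ->
  seg_int (fun x => k * f x) a b = k * seg_int f a b.
Proof. by move=> hf; apply: RintegralZl => //; exact: seg_integrable. Qed.

Lemma seg_int_cst k a b : a <= b -> seg_int (fun=> k) a b = k * (b - a).
Proof.
move=> ab; rewrite /seg_int Rintegral_cst//= lebesgue_measure_itv/= lte_fin.
by case: ltgtP ab => // -> _; rewrite subrr.
Qed.

Lemma eq_seg_int f g a b : (forall x, a <= x <= b -> f x = g x) ->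
  seg_int f a b = seg_int g a b.
Proof. by move=> fg; apply: eq_Rintegral => x; rewrite inE/= in_itv/= => /fg. Qed.

Lemma seg_int_bound f a b e : a <= b -> seg_cont f a b ->
  (forall x, a <= x <= b -> `|f x| <= e) -> `|seg_int f a b| <= e * (b - a).
Proof.
move=> ab hf fe; have hi := seg_integrable hf.
apply: le_trans (le_normr_Rintegral _ hi) _ => //.
rewrite -seg_int_cst//; apply: le_Rintegral.
- exact: measurable_itv.
- exact: (integrable_norm hi).
- exact: (seg_integrable (@seg_cont_cst e a b)).
- by move=> x; rewrite /= in_itv/= => /fe.
Qed.

Lemma seg_int_near f a b k e : a <= b -> seg_cont f a b ->
  (forall x, a <= x <= b -> `|f x - k| <= e) ->
  `|seg_int f a b - k * (b - a)| <= e * (b - a).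
Proof.
move=> ab hf fk; rewrite -(seg_int_cst k ab) -seg_intB//; last exact: seg_cont_cst.
by apply: seg_int_bound => //; apply: seg_contB => //; exact: seg_cont_cst.
Qed.

End SegmentIntegral.

(** * Goursat's theorem on rectangles *)

Section Goursat.
Variable R : realType.
Implicit Types (P Q : R -> R -> R) (a b c d x y w h e : R).

(* P dx + Q dy is closed at (x0, y0): the coefficient q is both dP/dy and dQ/dx. *)
Definition closed_form_at P Q x0 y0 := exists p q s : R, forall e, 0 < e ->
  exists2 r : R, 0 < r & forall x y, `|x - x0| <= r -> `|y - y0| <= r ->
  `|P x y - P x0 y0 - p * (x - x0) - q * (y - y0)| <= e * (`|x - x0| + `|y - y0|) /\
  `|Q x y - Q x0 y0 - q * (x - x0) - s * (y - y0)| <= e * (`|x - x0| + `|y - y0|).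

(** The integral of P dx + Q dy along the positively oriented boundary of [a, b] x [c, d], with
    opposite sides paired. *)
Definition loop P Q a b c d : R :=
  seg_int (fun x => P x c - P x d) a b + seg_int (fun y => Q b y - Q a y) c d.

Lemma continuous_of_diff (f : R -> R) x0 (p : R) :
  (forall e, 0 < e -> exists2 r : R, 0 < r & forall x, `|x - x0| <= r ->
     `|f x - f x0 - p * (x - x0)| <= e * `|x - x0|) ->
  {for x0, continuous f}.
Proof.
move=> h; apply/cvgrPdist_le => /= e e0.
have [r r0 H] := h 1 ltr01.
have k0 : 0 < 1 + `|p| by rewrite ltr_pwDl.
near=> x; have xr : `|x - x0| <= Num.min r (e / (1 + `|p|)).
  by rewrite distrC; near: x; apply: cvgr_dist_le; rewrite ?lt_min ?r0 ?divr_gt0//; exact: cvg_id.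
move: xr; rewrite le_min => /andP[xr xe]; have := H x xr; rewrite mul1r => Hx.
rewrite distrC -(subrK (p * (x - x0)) (f x - f x0)).
apply: le_trans (ler_normD _ _) _; rewrite normrM.
apply: le_trans (lerD Hx (lexx _)) _; rewrite -[X in X + _]mul1r -mulrDl.
by rewrite mulrC -ler_pdivlMr.
Unshelve. all: by end_near.
Qed.

Lemma closed_form_contl P Q x0 y0 : closed_form_at P Q x0 y0 ->
  {for x0, continuous (P^~ y0)}.
Proof.
move=> [p [q [s H]]]; apply: (@continuous_of_diff _ _ p) => e e0.
have [r r0 Hr] := H e e0; exists r => // x xr.
have [|+ _] := Hr x y0 xr; first by rewrite subrr normr0 ltW.
by rewrite subrr normr0 mulr0 addr0 subr0.
Qed.

Lemma closed_form_contr P Q x0 y0 : closed_form_at P Q x0 y0 ->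
  {for y0, continuous (Q x0)}.
Proof.
move=> [p [q [s H]]]; apply: (@continuous_of_diff _ _ s) => e e0.
have [r r0 Hr] := H e e0; exists r => // y yr.
have [|//|_] := Hr x0 y; first by rewrite subrr normr0 ltW.
by rewrite subrr normr0 mulr0 add0r subr0.
Qed.

Lemma loop_splitx P Q a m b c d : a <= m -> m <= b -> c <= d ->
  seg_cont (P^~ c) a b -> seg_cont (P^~ d) a b ->
  seg_cont (Q a) c d -> seg_cont (Q m) c d -> seg_cont (Q b) c d ->
  loop P Q a b c d = loop P Q a m c d + loop P Q m b c d.
Proof.
move=> am mb cd Pc Pd Qa Qm Qb; rewrite /loop.
rewrite (seg_int_split am mb)//; last exact: seg_contB.
rewrite !(seg_intB Qb, seg_intB Qm)//; ring.
Qed.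

Lemma loop_splity P Q a b c m d : a <= b -> c <= m -> m <= d ->
  seg_cont (P^~ c) a b -> seg_cont (P^~ m) a b -> seg_cont (P^~ d) a b ->
  seg_cont (Q a) c d -> seg_cont (Q b) c d ->
  loop P Q a b c d = loop P Q a b c m + loop P Q a b m d.
Proof.
move=> ab cm md Pc Pm Pd Qa Qb; rewrite /loop.
rewrite (seg_int_split cm md); last exact: seg_contB.
rewrite !(seg_intB Pc, seg_intB Pm)//; ring.
Qed.

(** To first order the horizontal sides give q (c - d) (b - a) and the vertical ones q (b - a) (d -
    c); they cancel because the same q occurs in both expansions, and only the error terms
    remain. *)
Lemma loop_small P Q x0 y0 : closed_form_at P Q x0 y0 -> forall e, 0 < e ->
  exists2 r : R, 0 < r & forall a b c d, a <= x0 <= b -> c <= y0 <= d ->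
   b - a <= r -> d - c <= r ->
   seg_cont (P^~ c) a b -> seg_cont (P^~ d) a b ->
   seg_cont (Q a) c d -> seg_cont (Q b) c d ->
   `|loop P Q a b c d| <= e * ((b - a) + (d - c)) ^+ 2.
Proof.
move=> [p [q [s H]]] e e0.
have e2 : 0 < e / 2 by rewrite divr_gt0.
have [r r0 Hr] := H _ e2; exists r => // a b c d /andP[ax xb] /andP[cy yd] abr cdr Pc Pd Qa Qb.
have ab : a <= b := le_trans ax xb; have cd : c <= d := le_trans cy yd.
have xd x : a <= x <= b -> `|x - x0| <= b - a by move=> /andP[? ?]; rewrite ler_norml; lra.
have yd' y : c <= y <= d -> `|y - y0| <= d - c by move=> /andP[? ?]; rewrite ler_norml; lra.
pose L := (b - a) + (d - c).
have cc : c <= c <= d by rewrite lexx.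
have dd : c <= d <= d by rewrite lexx andbT.
have aa : a <= a <= b by rewrite lexx.
have bb : a <= b <= b by rewrite lexx andbT.
have bnd x y : a <= x <= b -> c <= y <= d -> e / 2 * (`|x - x0| + `|y - y0|) <= e / 2 * L.
  by move=> hx hy; rewrite ler_pM2l// lerD ?xd ?yd'.
have h1 : `|seg_int (fun x => P x c - P x d) a b - (q * (c - d)) * (b - a)| <= (e * L) * (b - a).
  apply: seg_int_near => //; first exact: seg_contB.
  move=> x hx.
  have [k1 _] := Hr x c (le_trans (xd _ hx) abr) (le_trans (yd' _ cc) cdr).
  have [k2 _] := Hr x d (le_trans (xd _ hx) abr) (le_trans (yd' _ dd) cdr).
  have := le_trans k1 (bnd _ _ hx cc); have := le_trans k2 (bnd _ _ hx dd).
  move: (P x0 y0) (P x c) (P x d) => A B C; rewrite !ler_norml; nra.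
have h2 : `|seg_int (fun y => Q b y - Q a y) c d - (q * (b - a)) * (d - c)| <= (e * L) * (d - c).
  apply: seg_int_near => //; first exact: seg_contB.
  move=> y hy.
  have [_ k1] := Hr a y (le_trans (xd _ aa) abr) (le_trans (yd' _ hy) cdr).
  have [_ k2] := Hr b y (le_trans (xd _ bb) abr) (le_trans (yd' _ hy) cdr).
  have := le_trans k1 (bnd _ _ aa hy); have := le_trans k2 (bnd _ _ bb hy).
  move: (Q x0 y0) (Q a y) (Q b y) => A B C; rewrite !ler_norml; nra.
have -> : loop P Q a b c d = (seg_int (fun x => P x c - P x d) a b - (q * (c - d)) * (b - a))
  + (seg_int (fun y => Q b y - Q a y) c d - (q * (b - a)) * (d - c)).
  by rewrite /loop; ring.
apply: le_trans (ler_normD _ _) _; apply: le_trans (lerD h1 h2) _.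
by rewrite -mulrDr -/L expr2 mulrA.
Qed.

End Goursat.
Section GoursatRectangle.
Variable R : realType.
Implicit Types (P Q : R -> R -> R) (a b c d x y w h e B : R).

Definition closed_form_on P Q a b c d :=
  forall x y, a <= x <= b -> c <= y <= d -> closed_form_at P Q x y.

Lemma closed_form_segx P Q a b c d y : closed_form_on P Q a b c d ->
  c <= y <= d -> seg_cont (P^~ y) a b.
Proof. by move=> H hy x hx; apply: (closed_form_contl (Q := Q)); exact: H. Qed.

Lemma closed_form_segy P Q a b c d x : closed_form_on P Q a b c d ->
  a <= x <= b -> seg_cont (Q x) c d.
Proof. by move=> H hx y hy; apply: (closed_form_contr (P := P)); exact: H. Qed.

Lemma closed_form_onS P Q a b c d a' b' c' d' : a <= a' -> b' <= b -> c <= c' -> d' <= d ->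
  closed_form_on P Q a b c d -> closed_form_on P Q a' b' c' d'.
Proof.
move=> ha hb hc hd H x y /andP[? ?] /andP[? ?].
by apply: H; apply/andP; split; [apply: le_trans ha _|apply: le_trans _ hb|
  apply: le_trans hc _|apply: le_trans _ hd].
Qed.

(** The four quarters add up to the whole loop, so one of them carries at least a quarter of it. *)
Lemma loop_quarter P Q a c w h : 0 <= w -> 0 <= h ->
  closed_form_on P Q a (a + w) c (c + h) ->
  exists p : R * R, [/\ a <= p.1 <= a + w / 2, c <= p.2 <= c + h / 2 &
    `|loop P Q a (a + w) c (c + h)| <=
    4 * `|loop P Q p.1 (p.1 + w / 2) p.2 (p.2 + h / 2)|].
Proof.
move=> w0 h0 H.
have w2 : 0 <= w / 2 by rewrite divr_ge0.
have h2 : 0 <= h / 2 by rewrite divr_ge0.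
have ew : a + w = a + w / 2 + w / 2 by rewrite -addrA -splitr.
have eh : c + h = c + h / 2 + h / 2 by rewrite -addrA -splitr.
have Hx x : a <= x <= a + w -> seg_cont (Q x) c (c + h).
  exact: closed_form_segy H.
have Hy y : c <= y <= c + h -> seg_cont (P^~ y) a (a + w).
  exact: closed_form_segx H.
have aw : a <= a + w / 2 <= a + w by lra.
have ch : c <= c + h / 2 <= c + h by lra.
have e1 : loop P Q a (a + w) c (c + h) =
  loop P Q a (a + w / 2) c (c + h) + loop P Q (a + w / 2) (a + w) c (c + h).
  apply: loop_splitx; rewrite ?(andP aw)//; try lra.
  - by apply: Hy; lra.
  - by apply: Hy; lra.
  - by apply: Hx; lra.
  - by apply: Hx; lra.
  - by apply: Hx; lra.
have e2 a1 b1 : a <= a1 -> a1 <= b1 -> b1 <= a + w ->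
   loop P Q a1 b1 c (c + h) =
   loop P Q a1 b1 c (c + h / 2) + loop P Q a1 b1 (c + h / 2) (c + h).
  move=> aa1 ab1 b1a; apply: loop_splity; try lra.
  - by apply: seg_contS aa1 b1a _; apply: Hy; lra.
  - by apply: seg_contS aa1 b1a _; apply: Hy; lra.
  - by apply: seg_contS aa1 b1a _; apply: Hy; lra.
  - by apply: Hx; lra.
  - by apply: Hx; lra.
pose G p := loop P Q p.1 (p.1 + w / 2) p.2 (p.2 + h / 2).
pose p1 := (a, c); pose p2 := (a, c + h / 2).
pose p3 := (a + w / 2, c); pose p4 := (a + w / 2, c + h / 2).
have e3 : loop P Q a (a + w) c (c + h) = G p1 + G p2 + (G p3 + G p4).
  by rewrite e1 !e2 /G/= -?ew -?eh//; lra.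
have [|n1] := leP `|loop P Q a (a + w) c (c + h)| (4 * `|G p1|).
  by exists p1; split => //=; lra.
have [|n2] := leP `|loop P Q a (a + w) c (c + h)| (4 * `|G p2|).
  by exists p2; split => //=; lra.
have [|n3] := leP `|loop P Q a (a + w) c (c + h)| (4 * `|G p3|).
  by exists p3; split => //=; lra.
have [|n4] := leP `|loop P Q a (a + w) c (c + h)| (4 * `|G p4|).
  by exists p4; split => //=; lra.
exfalso; move: n1 n2 n3 n4; rewrite e3.
have := ler_normD (G p1 + G p2) (G p3 + G p4).
have := ler_normD (G p1) (G p2); have := ler_normD (G p3) (G p4); lra.
Qed.

(** Repeated quartering closes in on a point, where [loop_small] bounds the loop by e times the
    squared size; this beats the factor 4^n lost in n steps. *)
Theorem goursat P Q a b c d : a <= b -> c <= d ->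
  closed_form_on P Q a b c d -> loop P Q a b c d = 0.
Proof.
move=> ab cd H.
pose w := b - a; pose h := d - c.
have w0 : 0 <= w by rewrite subr_ge0.
have h0 : 0 <= h by rewrite subr_ge0.
have eb : b = a + w by rewrite /w addrC subrK.
have ed : d = c + h by rewrite /h addrC subrK.
pose wn n := w / 2 ^+ n; pose hn n := h / 2 ^+ n.
have wn0 n : 0 <= wn n by rewrite divr_ge0// exprn_ge0.
have hn0 n : 0 <= hn n by rewrite divr_ge0// exprn_ge0.
have wS n : wn n.+1 = wn n / 2 by rewrite /wn exprSr invfM mulrA.
have hS n : hn n.+1 = hn n / 2 by rewrite /hn exprSr invfM mulrA.
pose good n (p q : R * R) := [/\ p.1 <= q.1 <= p.1 + wn n / 2, p.2 <= q.2 <= p.2 + hn n / 2 &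
    `|loop P Q p.1 (p.1 + wn n) p.2 (p.2 + hn n)| <=
    4 * `|loop P Q q.1 (q.1 + wn n / 2) q.2 (q.2 + hn n / 2)|].
(* Corners of the successive quarters. [xget] would fall back on (a, c) if no quarter were good;
   [inv] shows that one always is. *)
have [s s0 sS] : exists2 s : nat -> R * R, s 0%N = (a, c) &
    forall m, s m.+1 = xget (a, c) [set q | good m (s m) q].
  by exists (fix s n := if n is m.+1 then xget (a, c) [set q | good m (s m) q] else (a, c)).
have inv n : [/\ a <= (s n).1, (s n).1 + wn n <= b, c <= (s n).2 & (s n).2 + hn n <= d]
    /\ good n (s n) (s n.+1).
  have step m : [/\ a <= (s m).1, (s m).1 + wn m <= b, c <= (s m).2 & (s m).2 + hn m <= d] ->
     good m (s m) (s m.+1).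
    move=> [i1 i2 i3 i4]; rewrite sS; apply: (@xgetPex _ (a, c) [set q | good m (s m) q]).
    apply: loop_quarter; [exact: wn0|exact: hn0|].
    exact: closed_form_onS H.
  elim: n => [|n [[i1 i2 i3 i4] g]].
    have i0 : [/\ a <= (s 0%N).1, (s 0%N).1 + wn 0%N <= b, c <= (s 0%N).2 & (s 0%N).2 + hn 0%N <= d].
      by rewrite s0 /= /wn /hn expr0 !divr1 -eb -ed.
    exact: (conj i0 (step _ i0)).
  have i' : [/\ a <= (s n.+1).1, (s n.+1).1 + wn n.+1 <= b, c <= (s n.+1).2 & (s n.+1).2 + hn n.+1 <= d].
    case: g => /andP[g1 g2] /andP[g3 g4] _; rewrite wS hS.
    by split; move: (wn n) (hn n) (s n.+1) g1 g2 g3 g4 i1 i2 i3 i4 => W HH q; lra.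
  exact: (conj i' (step _ i')).
have big n : `|loop P Q a b c d| <=
    4 ^+ n * `|loop P Q (s n).1 ((s n).1 + wn n) (s n).2 ((s n).2 + hn n)|.
  elim: n => [|n IHn].
    by rewrite expr0 mul1r s0 /= /wn /hn expr0 !divr1 -eb -ed.
  have [_ [_ _ g]] := inv n; apply: le_trans IHn _.
  by rewrite exprSr -mulrA wS hS ler_pM2l// exprn_gt0.
have mono n k : [/\ (s n).1 <= (s (n + k)%N).1, (s (n + k)%N).1 + wn (n + k)%N <= (s n).1 + wn n,
   (s n).2 <= (s (n + k)%N).2 & (s (n + k)%N).2 + hn (n + k)%N <= (s n).2 + hn n].
  elim: k => [|k [i1 i2 i3 i4]]; first by rewrite addn0.
  rewrite addnS; have [_ [/andP[g1 g2] /andP[g3 g4] _]] := inv (n + k)%N.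
  rewrite wS hS.
  by split; move: (wn (n + k)%N) (hn (n + k)%N) (s (n + k)%N.+1) g1 g2 g3 g4 i1 i2 i3 i4 => W HH q; lra.
(* The left ends increase and stay below every right end by [mono], so their supremum lies in all
   the intervals. *)
have lim1 : exists x, forall n, (s n).1 <= x <= (s n).1 + wn n.
  exists (sup (range (fun n => (s n).1))) => n; apply/andP; split.
    apply: sup_upper_bound; last by exists n.
    split; first by exists (s 0%N).1; exists 0%N.
    by exists b => _ [m _ <-]; have [[_ + _ _] _] := inv m; apply: le_trans; rewrite lerDl.
  apply: ge_sup; first by exists (s 0%N).1; exists 0%N.
  move=> _ [m _ <-].
  have [nm|/ltnW mn] := leqP n m.
    have [_ + _ _] := mono n (m - n)%N; rewrite subnKC//; apply: le_trans.
    by rewrite lerDl.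
  by have [+ _ _ _] := mono m (n - m)%N; rewrite subnKC// => /le_trans; apply; rewrite lerDl.
have lim2 : exists y, forall n, (s n).2 <= y <= (s n).2 + hn n.
  exists (sup (range (fun n => (s n).2))) => n; apply/andP; split.
    apply: sup_upper_bound; last by exists n.
    split; first by exists (s 0%N).2; exists 0%N.
    by exists d => _ [m _ <-]; have [[_ _ _ +] _] := inv m; apply: le_trans; rewrite lerDl.
  apply: ge_sup; first by exists (s 0%N).2; exists 0%N.
  move=> _ [m _ <-].
  have [nm|/ltnW mn] := leqP n m.
    have [_ _ _ +] := mono n (m - n)%N; rewrite subnKC//; apply: le_trans.
    by rewrite lerDl.
  by have [_ _ + _] := mono m (n - m)%N; rewrite subnKC// => /le_trans; apply; rewrite lerDl.
case: lim1 => x0 Hx0; case: lim2 => y0 Hy0.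
have hx0 : a <= x0 <= b by have := Hx0 0%N; rewrite s0 /= /wn expr0 divr1 -eb.
have hy0 : c <= y0 <= d by have := Hy0 0%N; rewrite s0 /= /hn expr0 divr1 -ed.
apply/eqP; rewrite -normr_eq0 eq_le normr_ge0 andbT.
apply: (@le_of_eps _ _ _ ((w + h) ^+ 2)); first exact: sqr_ge0.
move=> e e0; rewrite add0r.
have [r r0 Hr] := loop_small (H _ _ hx0 hy0) e0.
have [n [nw nh]] : exists n, wn n <= r /\ hn n <= r.
  have [n hn'] : exists n, (w + h) / r < 2 ^+ n.
    exists (Num.truncn ((w + h) / r)).+1.
    have : (w + h) / r < (Num.truncn ((w + h) / r)).+1%:R.
      by rewrite truncnS_gt.
    move=> /lt_le_trans; apply; rewrite -natrX ler_nat; exact/ltnW/ltn_expl.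
  exists n; rewrite /wn /hn !ler_pdivrMr ?exprn_gt0//.
  move: hn'; rewrite ltr_pdivrMr// [2 ^+ n * r]mulrC; lra.
have [[i1 i2 i3 i4] _] := inv n.
apply: le_trans (big n) _.
have k : `|loop P Q (s n).1 ((s n).1 + wn n) (s n).2 ((s n).2 + hn n)| <= e * (wn n + hn n) ^+ 2.
  have := Hr (s n).1 ((s n).1 + wn n) (s n).2 ((s n).2 + hn n) (Hx0 n) (Hy0 n).
  rewrite ![_ + wn n - _]addrC ![_ + hn n - _]addrC !addKr; apply => //.
  - by apply: seg_contS i1 i2 _; apply: closed_form_segx H _; have := hn0 n; lra.
  - by apply: seg_contS i1 i2 _; apply: closed_form_segx H _; have := hn0 n; lra.
  - by apply: seg_contS i3 i4 _; apply: closed_form_segy H _; have := wn0 n; lra.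
  - by apply: seg_contS i3 i4 _; apply: closed_form_segy H _; have := wn0 n; lra.
apply: le_trans (ler_wpM2l _ k) _; first by rewrite exprn_ge0.
rewrite /wn /hn -mulrDl expr_div_n -exprM mulnC exprM.
have -> : (2 : R) ^+ 2 = 4 by rewrite -natrX.
have : (4 : R) ^+ n != 0 by rewrite expf_neq0.
by move: (4 ^+ n) => F F0; rewrite le_eqVlt; apply/orP; left; apply/eqP; field.
Qed.

(* A rectangle around an isolated singularity reduces to an arbitrarily small
   square, whose contribution vanishes when the form is bounded. *)
Theorem goursat_bounded P Q a b c d x0 y0 B (r : R) : a < x0 < b -> c < y0 < d ->
  (forall x y, a <= x <= b -> c <= y <= d -> x != x0 \/ y != y0 -> closed_form_at P Q x y) ->
  0 <= B -> 0 < r ->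
  (forall x y, `|x - x0| <= r -> `|y - y0| <= r -> x != x0 \/ y != y0 ->
     `|P x y| <= B /\ `|Q x y| <= B) ->
  loop P Q a b c d = 0.
Proof.
move=> /andP[ax xb] /andP[cy yd] H B0 r0 Hb.
have ab := lt_trans ax xb; have cd := lt_trans cy yd.
apply/eqP; rewrite -normr_eq0 eq_le normr_ge0 andbT.
(* Around a square of half-side e each of the two integrands is at most 2 B over a length 2 e, in
   total 8 B e. *)
apply: (@le_of_eps _ _ _ (8 * B)); first by rewrite mulr_ge0.
move=> e0 e00; rewrite add0r.
pose m := Num.min (Num.min (x0 - a) (b - x0)) (Num.min (y0 - c) (d - y0)).
have [e [e_gt0 ee0 e1 e2 e3] e4] : exists2 e, [/\ 0 < e, e <= Num.min e0 r, e <= x0 - a, e <= b - x0 & e <= y0 - c] & e <= d - y0.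
  have mm : m <= m by []; move: mm; rewrite {2}/m !le_min => /andP[/andP[m1 m2] /andP[m3 m4]].
  exists (Num.min (Num.min e0 r) m); last by rewrite ge_min m4 orbT.
  split; [|by rewrite ge_min lexx|by rewrite ge_min m1 orbT|by rewrite ge_min m2 orbT|by rewrite ge_min m3 orbT].
  by rewrite !lt_min e00 r0 !subr_gt0 ax xb cy yd.
move: ee0; rewrite le_min => /andP[ee0 er].
pose x1 := x0 - e; pose x2 := x0 + e; pose y1 := y0 - e; pose y2 := y0 + e.
have x10 : x1 < x0 by rewrite gtrBl.
have x20 : x0 < x2 by rewrite ltrDl.
have y10 : y1 < y0 by rewrite gtrBl.
have y20 : y0 < y2 by rewrite ltrDl.
have ax1 : a <= x1 by rewrite /x1 lerBrDr addrC -lerBrDr.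
have x2b : x2 <= b by rewrite /x2 addrC -lerBrDr.
have cy1 : c <= y1 by rewrite /y1 lerBrDr addrC -lerBrDr.
have y2d : y2 <= d by rewrite /y2 addrC -lerBrDr.
have x12 := ltW (lt_trans x10 x20); have y12 := ltW (lt_trans y10 y20).
have x1b := le_trans x12 x2b; have ax2 := le_trans ax1 x12.
have y1d := le_trans y12 y2d; have cy2 := le_trans cy1 y12.
have sy y a' b' : c <= y <= d -> y != y0 -> a <= a' -> b' <= b -> seg_cont (P^~ y) a' b'.
  move=> hy yy0 aa' bb'; apply: (seg_contS aa' bb') => x hx.
  by apply: (closed_form_contl (Q := Q)); exact: (H x y hx hy (or_intror yy0)).
have sx x c' d' : a <= x <= b -> x != x0 -> c <= c' -> d' <= d -> seg_cont (Q x) c' d'.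
  move=> hx xx0 cc' dd'; apply: (seg_contS cc' dd') => y hy.
  by apply: (closed_form_contr (P := P)); exact: (H x y hx hy (or_introl xx0)).
have hxa : a <= a <= b by rewrite lexx ltW.
have hxb : a <= b <= b by rewrite lexx ltW.
have hyc : c <= c <= d by rewrite lexx ltW.
have hyd : c <= d <= d by rewrite lexx ltW.
have hx1 : a <= x1 <= b by rewrite ax1.
have hx2 : a <= x2 <= b by rewrite ax2.
have hy1 : c <= y1 <= d by rewrite cy1.
have hy2 : c <= y2 <= d by rewrite cy2.
have na : a != x0 by rewrite lt_eqF.
have nb : b != x0 by rewrite gt_eqF.
have nc : c != y0 by rewrite lt_eqF.
have nd : d != y0 by rewrite gt_eqF.
have n1 : x1 != x0 by rewrite lt_eqF.
have n2 : x2 != x0 by rewrite gt_eqF.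
have n3 : y1 != y0 by rewrite lt_eqF.
have n4 : y2 != y0 by rewrite gt_eqF.
have z a' b' c' d' : a <= a' -> b' <= b -> c <= c' -> d' <= d -> a' <= b' -> c' <= d' ->
   (forall x y, a' <= x <= b' -> c' <= y <= d' -> x != x0 \/ y != y0) ->
   loop P Q a' b' c' d' = 0.
  move=> k1 k2 k3 k4 k5 k6 k; apply: goursat => // x y hx hy.
  apply: H; last exact: k.
    by case/andP: hx => u v; rewrite (le_trans k1 u) (le_trans v k2).
  by case/andP: hy => u v; rewrite (le_trans k3 u) (le_trans v k4).
(* The strips to the left, to the right, below and above the small square miss the singular point
   and contribute nothing by [goursat]. *)
rewrite (loop_splitx ax1 x1b (ltW cd)); [|exact: sy|exact: sy|exact: sx|exact: sx|exact: sx].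
rewrite (loop_splitx x12 x2b (ltW cd)); [|exact: sy|exact: sy|exact: sx|exact: sx|exact: sx].
rewrite (loop_splity x12 cy1 y1d); [|exact: sy|exact: sy|exact: sy|exact: sx|exact: sx].
rewrite (loop_splity x12 y12 y2d); [|exact: sy|exact: sy|exact: sy|exact: sx|exact: sx].
rewrite (z a x1)//; [|exact: ltW|by move=> x y /andP[_ h] _; left; rewrite lt_eqF// (le_lt_trans h)].
rewrite (z x2 b)//; [|exact: ltW|by move=> x y /andP[h _] _; left; rewrite gt_eqF// (lt_le_trans _ h)].
rewrite (z x1 x2 c y1)//; [|by move=> x y _ /andP[_ h]; right; rewrite lt_eqF// (le_lt_trans h)].
rewrite (z x1 x2 y2 d)//; [|by move=> x y _ /andP[h _]; right; rewrite gt_eqF// (lt_le_trans _ h)].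
rewrite !(add0r, addr0) /loop.
have xe : x2 - x1 = 2 * e by rewrite /x2 /x1; ring.
have ye : y2 - y1 = 2 * e by rewrite /y2 /y1; ring.
have nx x : x1 <= x -> x <= x2 -> `|x - x0| <= r.
  by rewrite /x1 /x2 => H0 H1; rewrite ler_norml; apply/andP; split; clear -er e_gt0 H0 H1; lra.
have ny y : y1 <= y -> y <= y2 -> `|y - y0| <= r.
  by rewrite /y1 /y2 => H0 H1; rewrite ler_norml; apply/andP; split; clear -er e_gt0 H0 H1; lra.
have nx1 := nx x1 (lexx _) x12; have nx2 := nx x2 x12 (lexx _).
have ny1 := ny y1 (lexx _) y12; have ny2 := ny y2 y12 (lexx _).
have b1 : `|seg_int (fun x => P x y1 - P x y2) x1 x2| <= (2 * B) * (x2 - x1).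
  apply: seg_int_bound => //; first by apply: seg_contB; exact: sy.
  move=> x /andP[h1 h2].
  have [k1 _] := Hb x y1 (nx x h1 h2) ny1 (or_intror n3).
  have [k2 _] := Hb x y2 (nx x h1 h2) ny2 (or_intror n4).
  by apply: le_trans (ler_normB _ _) _; rewrite mulr_natl mulr2n lerD.
have b2 : `|seg_int (fun y => Q x2 y - Q x1 y) y1 y2| <= (2 * B) * (y2 - y1).
  apply: seg_int_bound => //; first by apply: seg_contB; exact: sx.
  move=> y /andP[h1 h2].
  have [_ k1] := Hb x1 y nx1 (ny y h1 h2) (or_introl n1).
  have [_ k2] := Hb x2 y nx2 (ny y h1 h2) (or_introl n2).
  by apply: le_trans (ler_normB _ _) _; rewrite mulr_natl mulr2n lerD.
apply: le_trans (ler_normD _ _) _; apply: le_trans (lerD b1 b2) _.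
have -> : 2 * B * (x2 - x1) + 2 * B * (y2 - y1) = 8 * (B * e) by rewrite xe ye; ring.
by rewrite -mulrA ler_pM2l// ler_wpM2l.
Qed.

End GoursatRectangle.

(** * Complex differentiability and log-polar coordinates *)

Lemma diff_quotient_cvgP (K : numFieldType) (f : K -> K) (a l : K) :
  ((fun h : K^o => h^-1 *: ((f : K^o -> K^o) (h + a) - f a)) @ (0 : K^o)^' --> (l : K^o)) <->
  forall e, 0 < e -> exists2 r, 0 < r & forall y, `|y - a| < r ->
    `|f y - f a - l * (y - a)| <= e * `|y - a|.
Proof.
split=> [/cvgrPdist_le h e e0|h].
  have /nbhs_ballP[r /= r0 H] := h _ e0.
  exists r => // y ya; have [->|yna] := eqVneq y a.
    by rewrite !subrr mulr0 subr0 !normr0 mulr0.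
  have yn0 : y - a != 0 by rewrite subr_eq0.
  have := H (y - a); rewrite -ball_normE /= sub0r normrN => /(_ ya yn0).
  rewrite subrK distrC => k.
  have -> : f y - f a - l * (y - a) = ((y - a)^-1 *: ((f : K^o -> K^o) y - f a) - l) * (y - a).
    by rewrite mulrBl -[_^-1 *: _]/(_^-1 * _) mulrAC mulVf// mul1r.
  by rewrite normrM ler_wpM2r.
apply/cvgrPdist_le => /= e e0; have [r r0 H] := h e e0.
apply/nbhs_ballP; exists r => //= x; rewrite -ball_normE /= sub0r normrN => xr xn0.
have := H (x + a); rewrite addrK => /(_ xr) k.
rewrite distrC -(ler_pM2r (_ : 0 < `|x|)) ?normr_gt0// -normrM.
suff -> : (x^-1 *: ((f : K^o -> K^o) (x + a) - f a) - l) * x = f (x + a) - f a - l * x by [].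
by rewrite mulrBl -[_^-1 *: _]/(_^-1 * _) mulrAC mulVf// mul1r.
Qed.

Lemma real_derive_eps (R : realType) (f : R -> R) (a df : R) : is_derive a 1 f df ->
  forall e, 0 < e -> exists2 r, 0 < r & forall y, `|y - a| < r ->
    `|f y - f a - df * (y - a)| <= e * `|y - a|.
Proof.
move=> [fa <-]; rewrite -derive1E; apply/diff_quotient_cvgP.
have := fa; rewrite derive1E /derive /derivable.
set g1 := fun h => h^-1 *: _; set g2 := fun h => h^-1 *: _.
suff -> : g1 = g2 by [].
by apply/funext => x; rewrite /g1 /g2 /= [_%:A]mulr1.
Qed.

Section FieldDerivative.
Variable K : numFieldType.
Implicit Types (f g : K -> K) (z : K).

Lemma field_derivableB f g z : derivable (f : K^o -> K^o) z 1 ->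
  derivable (g : K^o -> K^o) z 1 -> derivable ((fun w => f w - g w) : K^o -> K^o) z 1.
Proof. exact: derivableB. Qed.

Lemma field_derivableM f g z : derivable (f : K^o -> K^o) z 1 ->
  derivable (g : K^o -> K^o) z 1 -> derivable ((fun w => f w * g w) : K^o -> K^o) z 1.
Proof. exact: (@derivableM K K^o f g). Qed.

Lemma field_derivableV f z : f z != 0 -> derivable (f : K^o -> K^o) z 1 ->
  derivable ((fun w => (f w)^-1) : K^o -> K^o) z 1.
Proof. exact: (@derivableV K K^o f). Qed.

End FieldDerivative.

Section ComplexDerivative.
Variable R : realType.
Implicit Types (f g : R[i] -> R[i]) (z w A B : R[i]).

(** Complex differentiability with real errors and radii, so that all later estimates take place in
    R. *)
Definition cdiff f z A := forall e : R, 0 < e -> exists2 r : R, 0 < r &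
  forall w, cabs (w - z) <= r -> cabs (f w - f z - A * (w - z)) <= e * cabs (w - z).

Lemma normcE z : `|z| = real_complex R (cabs z).
Proof. by []. Qed.

Lemma cdiffP f z A : cdiff f z A <->
  ((fun h : R[i]^o => h^-1 *: ((f : R[i]^o -> R[i]^o) (h + z) - f z)) @ (0 : R[i]^o)^'
     --> (A : R[i]^o)).
Proof.
split => [h|/diff_quotient_cvgP h e e0].
  (* A positive element of [R[i]] is real, so real errors lose nothing. *)
  apply/diff_quotient_cvgP => -[e i] /=; rewrite ltcE /= => /andP[/eqP -> e0].
  have [r r0 H] := h e e0; exists (real_complex R r); first by rewrite ltcR.
  by move=> w; rewrite !normcE ltcR => /ltW /H; rewrite -lecR rmorphM.
have [|[r i]] := h (real_complex R e); first by rewrite ltcR.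
rewrite ltcE /= => /andP[/eqP -> r0] H; exists (r / 2); first by rewrite divr_gt0.
move=> w hw; have := H w; rewrite !normcE ltcR (le_lt_trans hw)//; last first.
  by rewrite ltr_pdivrMr// ltr_pMr// ltr1n.
by move=> /(_ isT); rewrite -rmorphM lecR.
Qed.

Lemma cdiff_cderiv f z A : cdiff f z A -> cderiv f z = A.
Proof. by move=> /cdiffP h; apply: cvg_lim h. Qed.

Lemma derivable_cdiff f z : derivable (f : R[i]^o -> R[i]^o) z 1 -> exists A, cdiff f z A.
Proof.
move=> /cvg_ex[A h]; exists A; apply/cdiffP; move: h.
set g1 := fun h => h^-1 *: _; set g2 := fun h => h^-1 *: _.
suff -> : g1 = g2 by [].
by apply/funext => x; rewrite /g1 /g2 /= [_%:A]mulr1.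
Qed.

Lemma cdiff_derivable f z A : cdiff f z A -> derivable (f : R[i]^o -> R[i]^o) z 1.
Proof.
move=> /cdiffP h; apply/cvg_ex; exists A; move: h.
set g1 := fun h => h^-1 *: _; set g2 := fun h => h^-1 *: _.
suff -> : g1 = g2 by [].
by apply/funext => x; rewrite /g1 /g2 /= [_%:A]mulr1.
Qed.

Definition cdiffable f z := exists A, cdiff f z A.

Lemma cdiffableP f z : cdiffable f z <-> derivable (f : R[i]^o -> R[i]^o) z 1.
Proof. by split => [[A /cdiff_derivable]|/derivable_cdiff]. Qed.

Lemma cdiffable_cst k z : cdiffable (fun=> k) z.
Proof. by apply/cdiffableP; exact: derivable_cst. Qed.

Lemma cdiffable_id z : cdiffable id z.
Proof. by apply/cdiffableP; exact: derivable_id. Qed.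

Lemma cdiffableB f g z : cdiffable f z -> cdiffable g z -> cdiffable (fun w => f w - g w) z.
Proof. by move=> /cdiffableP hf /cdiffableP hg; apply/cdiffableP; exact (@field_derivableB R[i] f g z hf hg). Qed.

Lemma cdiffableM f g z : cdiffable f z -> cdiffable g z -> cdiffable (fun w => f w * g w) z.
Proof. by move=> /cdiffableP hf /cdiffableP hg; apply/cdiffableP; exact (@field_derivableM R[i] f g z hf hg). Qed.

Lemma cdiffableV f z : f z != 0 -> cdiffable f z -> cdiffable (fun w => (f w)^-1) z.
Proof. by move=> f0 /cdiffableP hf; apply/cdiffableP; exact (@field_derivableV R[i] f z f0 hf). Qed.

Lemma cdiffableX f n z : cdiffable f z -> cdiffable (fun w => f w ^+ n) z.
Proof.
move=> hf; elim: n => [|n IHn].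
  by under [X in cdiffable X]funext do rewrite expr0; exact: cdiffable_cst.
by under [X in cdiffable X]funext do rewrite exprS; exact: cdiffableM.
Qed.

Lemma cdiff_bounded f z : cdiffable f z -> exists2 r : R, 0 < r &
  exists2 B : R, 0 <= B & forall w, cabs (w - z) <= r -> cabs (f w - f z) <= B * cabs (w - z).
Proof.
move=> [A h]; have [r r0 H] := h 1 ltr01; exists r => //; exists (1 + cabs A).
  by rewrite addr_ge0// cabs_ge0.
move=> w /H; rewrite mulrDl -cabsM => k; rewrite -lerBlDr; apply: le_trans k.
exact: cabsB_ge.
Qed.

Lemma cdiff_continuous f z (e : R) : cdiffable f z -> 0 < e -> exists2 r : R, 0 < r &
  forall w, cabs (w - z) <= r -> cabs (f w - f z) <= e.
Proof.
move=> /cdiff_bounded[r r0 [B B0 H]] e0; have B1 : 0 < B + 1 by rewrite ltr_wpDl.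
exists (Num.min r (e / (B + 1))); first by rewrite lt_min r0 divr_gt0.
move=> w; rewrite le_min => /andP[/H h1 h2]; apply: le_trans h1 _.
apply: le_trans (ler_wpM2l B0 h2) _; rewrite mulrCA ger_pMr// ler_pdivrMr// mul1r.
by rewrite lerDl.
Qed.

End ComplexDerivative.

Section PolarCoordinates.
Variable R : realType.
Implicit Types (x y s t e : R) (G : R[i] -> R[i]) (z w : R[i]).

(** The complex exponential of x + i y; circles about 0 become vertical segments. *)
Definition polar x y : R[i] := circle_point (expR x) y.

Lemma polarD x y s t : polar (x + s) (y + t) = polar x y * polar s t.
Proof.
rewrite /polar /circle_point expRD cosD sinD; apply/eqP; rewrite eq_complex/=.
by apply/andP; split; apply/eqP; ring.
Qed.

Lemma cabs_circle_point (r : R) y : 0 <= r -> cabs (circle_point r y) = r.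
Proof.
move=> r0; apply/eqP; rewrite -(@eqrXn2 _ 2)// ?cabs_ge0// cabs_sqr/=.
by rewrite !exprMn -mulrDr cos2Dsin2 mulr1.
Qed.

Lemma cabs_polar x y : cabs (polar x y) = expR x.
Proof. by rewrite cabs_circle_point// expR_ge0. Qed.

Lemma polar_neq0 x y : polar x y != 0.
Proof. by rewrite -cabs_gt0 cabs_polar expR_gt0. Qed.

Lemma polar_diff0 e : 0 < e -> exists2 r, 0 < r & forall s t, `|s| <= r -> `|t| <= r ->
  cabs (polar s t - 1 - Complex s t) <= e * (`|s| + `|t|).
Proof.
(* [d] is a common precision for exp, cos and sin; 20 d <= e leaves room for the products of their
   errors. *)
move=> e0; have [d [d0 d1 de]] : exists d, [/\ 0 < d, d <= 1 & 20 * d <= e].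
  exists (Num.min (e / 20) 1); split; first by rewrite lt_min ltr01 divr_gt0.
    by rewrite ge_min lexx orbT.
  by rewrite mulrC -ler_pdivlMr// ge_min lexx.
have hexp : is_derive (0 : R) 1 expR (expR 0) by exact: is_derive_expR.
have hcos : is_derive (0 : R) 1 cos (- sin 0) by exact: is_derive_cos.
have hsin : is_derive (0 : R) 1 sin (cos 0) by exact: is_derive_sin.
have [r1 r10 H1] := real_derive_eps hexp d0.
have [r2 r20 H2] := real_derive_eps hcos d0.
have [r3 r30 H3] := real_derive_eps hsin d0.
exists (Num.min (Num.min r1 r2) (Num.min r3 d) / 2).
  by rewrite divr_gt0// !lt_min r10 r20 r30 d0.
move=> s t hs ht.
have lt2 (u : R) : 0 < u -> u / 2 < u by move=> u0; rewrite ltr_pdivrMr// ltr_pMr// ltr1n.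
have m0 : 0 < Num.min (Num.min r1 r2) (Num.min r3 d) by rewrite !lt_min r10 r20 r30 d0.
have := le_lt_trans hs (lt2 _ m0); rewrite !lt_min => /andP[/andP[s1 s2] /andP[s3 s4]].
have := le_lt_trans ht (lt2 _ m0); rewrite !lt_min => /andP[/andP[t1 t2] /andP[t3 t4]].
have := H1 s; rewrite !(subr0, expR0, mul1r) => /(_ s1).
have := H2 t; rewrite !(subr0, sin0, oppr0, mul0r, cos0) => /(_ t2).
have := H3 t; rewrite !(subr0, sin0, mul1r, cos0) => /(_ t3).
set ga := sin t - t; set be := cos t - 1; set al := expR s - 1 - s.
move=> hga hbe hal.
apply: le_trans (cabs_leD _) _; rewrite !(cReD, cImD, cReN, cImN)/= oppr0 addr0.
have -> : expR s * cos t - 1 - s = al + be * (1 + s + al) by rewrite /al /be; ring.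
have -> : expR s * sin t - t = ga + (s + al) * (t + ga) by rewrite /al /ga; ring.
have als : `|al| <= `|s| by apply: le_trans hal _; exact: ler_piMl.
have gat : `|ga| <= `|t| by apply: le_trans hga _; exact: ler_piMl.
have k1 : `|al + be * (1 + s + al)| <= d * `|s| + d * `|t| * 3.
  apply: le_trans (ler_normD _ _) _; apply: lerD => //; rewrite normrM.
  apply: ler_pM => //; apply: le_trans (ler_normD _ _) _.
  apply: le_trans (lerD (ler_normD _ _) als) _; rewrite normr1.
  have := le_trans (ltW s4) d1; clear; lra.
have k2 : `|ga + (s + al) * (t + ga)| <= d * `|t| + (2 * d) * (2 * `|t|).
  apply: le_trans (ler_normD _ _) _; apply: lerD => //; rewrite normrM.
  apply: ler_pM => //.
    apply: le_trans (ler_normD _ _) _; apply: le_trans (lerD (lexx _) als) _.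
    by rewrite mulr_natl mulr2n lerD// ltW.
  apply: le_trans (ler_normD _ _) _; apply: le_trans (lerD (lexx _) gat) _.
  by rewrite mulr_natl mulr2n.
apply: le_trans (lerD k1 k2) _.
have e1 : 20 * d * `|s| <= e * `|s| by rewrite ler_wpM2r.
have e2 : 20 * d * `|t| <= e * `|t| by rewrite ler_wpM2r.
have e3 : 0 <= d * `|s| by rewrite mulr_ge0// ltW.
have e4 : 0 <= d * `|t| by rewrite mulr_ge0// ltW.
clear -e1 e2 e3 e4; lra.
Qed.

(* In log-polar coordinates G(exp(x + iy)) is again complex differentiable, so
   Im G dx + Re G dy is closed by the Cauchy-Riemann equations. *)
Lemma polar_closed_form G x0 y0 : cdiffable G (polar x0 y0) ->
  closed_form_at (fun x y => complex.Im (G (polar x y)))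
                 (fun x y => complex.Re (G (polar x y))) x0 y0.
Proof.
move=> [A hA]; pose z0 := polar x0 y0; have [D eD] : exists D, D = A * z0 by exists (A * z0).
have z00 : 0 < cabs z0 by rewrite cabs_gt0 polar_neq0.
suff main e : 0 < e -> exists2 r : R, 0 < r & forall x y, `|x - x0| <= r -> `|y - y0| <= r ->
    cabs (G (polar x y) - G z0 - D * Complex (x - x0) (y - y0)) <= e * (`|x - x0| + `|y - y0|).
  (* Multiplication by D has slopes (Im D, Re D) on imaginary parts and (Re D, - Im D) on real
     parts; the common slope Re D is the closedness. *)
  exists (complex.Im D), (complex.Re D), (- complex.Im D) => e e0.
  have [r r0 H] := main e e0; exists r => // x y hx hy.
  have h := H x y hx hy; split.
    apply: le_trans h; apply: le_trans (normIm_le _).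
    rewrite !(cImD, cImN, cImM)/= le_eqVlt; apply/orP; left; apply/eqP; congr `|_|; rewrite /z0; ring.
  apply: le_trans h; apply: le_trans (normRe_le _).
  rewrite !(cReD, cReN, cReM)/= le_eqVlt; apply/orP; left; apply/eqP; congr `|_|; rewrite /z0; ring.
(* Half of e pays for the error of G ([e2], increments being at most 2 |z0| (|s| + |t|)), the other
   half for that of the exponential ([e1]). *)
move=> e0; pose e1 := Num.min 1 (e / (2 * (1 + cabs A) * cabs z0)).
have A1 : 0 < 1 + cabs A by rewrite ltr_pwDl// cabs_ge0.
have den : 0 < 2 * (1 + cabs A) * cabs z0 by rewrite !mulr_gt0.
have e10 : 0 < e1 by rewrite lt_min ltr01 divr_gt0.
have e11 : e1 <= 1 by rewrite ge_min lexx.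
have e1e : e1 * (2 * (1 + cabs A) * cabs z0) <= e by rewrite -ler_pdivlMr// ge_min lexx orbT.
pose e2 := e / (4 * cabs z0).
have e20 : 0 < e2 by rewrite divr_gt0// mulr_gt0.
have [r1 r10 H1] := hA _ e20.
have [r2 r20 H2] := polar_diff0 e10.
exists (Num.min r2 (r1 / (4 * cabs z0))).
  by rewrite lt_min r20 divr_gt0// mulr_gt0.
move=> x y; rewrite !le_min => /andP[x1 x2] /andP[y1 y2].
have := H2 _ _ x1 y1; set s := x - x0; set t := y - y0 => h2.
have pe : polar x y = z0 * polar s t.
  by rewrite /z0 -polarD /s /t !(addrC _ (_ - _)) !subrK.
set E := polar s t - 1 - Complex s t in h2.
have pz : polar x y - z0 = z0 * (Complex s t + E) by rewrite pe /E; ring.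
have st : cabs (Complex s t) <= `|s| + `|t| by exact: cabs_leD.
have b1 : cabs (polar x y - z0) <= 2 * cabs z0 * (`|s| + `|t|).
  rewrite pz cabsM; have -> : 2 * cabs z0 * (`|s| + `|t|) = cabs z0 * (2 * (`|s| + `|t|)) by ring.
  rewrite ler_wpM2l ?cabs_ge0//.
  apply: le_trans (cabsD _ _) _; rewrite mulr_natl mulr2n lerD//.
  by apply: le_trans h2 _; rewrite ler_piMl// addr_ge0.
have b2 : cabs (polar x y - z0) <= r1.
  apply: le_trans b1 _; rewrite mulrC.
  have : `|s| + `|t| <= r1 / (4 * cabs z0) + r1 / (4 * cabs z0) by exact: lerD.
  move=> k; apply: le_trans (ler_wpM2r _ k) _; first by rewrite mulr_ge0// ltW.
  by rewrite le_eqVlt; apply/orP; left; apply/eqP; field; rewrite gt_eqF.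
have -> : G (polar x y) - G z0 - D * Complex s t =
   (G (polar x y) - G z0 - A * (polar x y - z0)) + D * E.
  by rewrite pz eD; ring.
apply: le_trans (cabsD _ _) _.
have k1 := le_trans (H1 _ b2) (ler_wpM2l (ltW e20) b1).
have k2 : cabs (D * E) <= cabs A * cabs z0 * (e1 * (`|s| + `|t|)).
  by rewrite cabsM eD cabsM ler_wpM2l// mulr_ge0// cabs_ge0.
apply: le_trans (lerD k1 k2) _; rewrite -/s -/t.
have -> : e2 * (2 * cabs z0 * (`|s| + `|t|)) = (e / 2) * (`|s| + `|t|).
  by rewrite /e2; field; rewrite gt_eqF.
rewrite mulrA -mulrDl ler_wpM2r ?addr_ge0//.
have : cabs A * cabs z0 * e1 <= e1 * ((1 + cabs A) * cabs z0).
  by rewrite [leRHS]mulrC ler_wpM2r ?(ltW e10)// ler_wpM2r ?(ltW z00)// lerDr.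
move: e1e; rewrite -!mulrA [e1 * (2 * _)]mulrCA; set q := e1 * _ => e1e k.
by rewrite {2}(splitr e) lerD2l; apply: le_trans k _; rewrite ler_pdivlMr// mulrC.
Qed.

End PolarCoordinates.
(** * Power series and Taylor expansion *)

Section PowerSeries.
Variable R : realType.
Implicit Types (a : nat -> R[i]) (z w h : R[i]) (q r : R).

(** Summation by parts, the boundary term being dropped by its sign. Applied to 1, n + 1 and (n +
    1)^2 it lowers the degree by one each time. *)
Lemma abel_bound (u : nat -> R) q N : 0 <= q <= 1 -> (forall n, 0 <= u n) ->
  (1 - q) * \sum_(i < N) u i * q ^+ i <= u 0%N + \sum_(i < N) (u i.+1 - u i) * q ^+ i.+1.
Proof.
move=> /andP[q0 q1] u0.
suff -> : (1 - q) * \sum_(i < N) u i * q ^+ i =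
   u 0%N + \sum_(i < N) (u i.+1 - u i) * q ^+ i.+1 - u N * q ^+ N.
  by rewrite lerBlDr lerDl mulr_ge0// exprn_ge0.
elim: N => [|N IHN]; first by rewrite !big_ord0 expr0; ring.
by rewrite !big_ord_recr/= mulrDr IHN !exprS; ring.
Qed.

Lemma geometric_partial_le q N : 0 <= q < 1 -> \sum_(i < N) q ^+ i <= (1 - q)^-1.
Proof.
move=> /andP[q0 q1]; have q1' : 0 < 1 - q by rewrite subr_gt0.
rewrite -[leRHS]mulr1 mulrC ler_pdivlMr// mulrC.
have := @abel_bound (fun=> 1) q N; rewrite q0 (ltW q1) => /(_ isT (fun=> ler01)).
under eq_bigr do rewrite mul1r.
by move=> /le_trans; apply; rewrite big1 ?addr0// => i _; rewrite subrr mul0r.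
Qed.

Lemma quadratic_geometric_bounded q : 0 <= q < 1 ->
  exists B : R, forall N, \sum_(i < N) i.+1%:R ^+ 2 * q ^+ i <= B.
Proof.
move=> /andP[q0 q1]; have q1' : 0 < 1 - q by rewrite subr_gt0.
have q01 : 0 <= q <= 1 by rewrite q0 ltW.
pose B1 := (1 - q)^-1.
have h1 N : \sum_(i < N) i.+1%:R * q ^+ i <= B1 * (1 + B1).
  rewrite mulrC ler_pdivlMr// mulrC.
  apply: le_trans (@abel_bound (fun n => n.+1%:R) q N q01 (fun n => ler0n _ _)) _.
  rewrite lerD2l; apply: le_trans (_ : \sum_(i < N) q ^+ i <= _); last first.
    by apply: geometric_partial_le; rewrite q0.
  apply: ler_sum => i _; rewrite [i.+2%:R]mulrSr addrAC subrr add0r mul1r exprS.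
  by rewrite ler_piMl ?exprn_ge0// ltW.
exists (B1 * (1 + 4 * (B1 * (1 + B1)))) => N.
rewrite mulrC ler_pdivlMr// mulrC.
apply: le_trans (@abel_bound (fun n => n.+1%:R ^+ 2) q N q01 (fun n => sqr_ge0 _)) _.
rewrite expr1n lerD2l; apply: le_trans (_ : \sum_(i < N) 4 * (i.+1%:R * q ^+ i) <= _); last first.
  by rewrite -mulr_sumr ler_pM2l.
apply: ler_sum => i _; rewrite mulrA [q ^+ _.+1]exprS mulrA ler_wpM2r ?exprn_ge0//.
apply: (@le_trans _ _ ((i.+2%:R ^+ 2 - i.+1%:R ^+ 2) * 1)).
  rewrite ler_wpM2l ?(ltW q1)// subr_ge0 ler_pXn2r ?nnegrE//.
  by rewrite ler_nat.
rewrite mulr1 [i.+2%:R]mulrSr [i.+1%:R]mulrSr; have : 0 <= i%:R :> R by [].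
by move: (i%:R) => t; clear; nra.
Qed.

(** Equivalently, the power series has radius of convergence at least 1. *)
Definition subexponential a := forall r, 0 <= r < 1 ->
  exists C : R, forall n, cabs (a n) * r ^+ n <= C.

(** Comparison with a radius between q and 1. The weight (n + 1)^2 serves the series, its derivative
    and the second-order remainder at once. *)
Lemma subexponential_sum a q : subexponential a -> 0 <= q < 1 ->
  exists B : R, forall N, \sum_(n < N) n.+1%:R ^+ 2 * (cabs (a n) * q ^+ n) <= B.
Proof.
move=> ha /andP[q0 q1].
have [r [qr r1]] : exists r, q < r /\ r < 1 by exists ((q + 1) / 2); rewrite !midf_lt.
have r0 : 0 < r by exact: le_lt_trans qr.
have [C HC] : exists C : R, forall n, cabs (a n) * r ^+ n <= C.
  by apply: ha; rewrite (ltW r0).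
have qr01 : 0 <= q / r < 1 by rewrite divr_ge0 ?(ltW r0)//= ltr_pdivrMr// mul1r.
have [B HB] := quadratic_geometric_bounded qr01.
have C0 : 0 <= C by apply: le_trans (HC 0%N); rewrite mulr_ge0// cabs_ge0.
exists (C * B) => N.
apply: le_trans (_ : C * \sum_(i < N) i.+1%:R ^+ 2 * (q / r) ^+ i <= _); last first.
  by rewrite ler_wpM2l.
rewrite mulr_sumr; apply: ler_sum => n _; rewrite [leRHS]mulrCA ler_wpM2l ?sqr_ge0//.
have -> : cabs (a n) * q ^+ n = (cabs (a n) * r ^+ n) * (q / r) ^+ n.
  by rewrite exprMn exprVn -mulrA [r ^+ n * _]mulrCA divff ?mulr1// expf_neq0// gt_eqF.
by apply: ler_wpM2r (HC n); rewrite exprn_ge0// divr_ge0// ltW.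
Qed.

Definition cpseries a z := csum (fun n => a n * z ^+ n).

Lemma cpseries_abs a z : subexponential a -> cabs z < 1 ->
  exists B : R, forall N, \sum_(n < N) cabs (a n * z ^+ n) <= B.
Proof.
move=> ha z1; have [|B HB] := subexponential_sum ha (q := cabs z); first by rewrite cabs_ge0.
exists B => N; apply: le_trans (HB N); apply: ler_sum => n _.
rewrite cabsM cabsX ler_peMl ?mulr_ge0 ?exprn_ge0 ?cabs_ge0//.
by rewrite -natrX ler1n.
Qed.

Lemma cpseries_ctends a z : subexponential a -> cabs z < 1 ->
  ctends (fun N => \sum_(n < N) a n * z ^+ n) (cpseries a z).
Proof. by move=> ha /(cpseries_abs ha)[B HB]; exact: asum_ctends HB. Qed.

(** The factor r^2 on the left replaces r^(n-2) on the right, which avoids both a division and a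
    truncated exponent. *)
Lemma pow_taylor z h r n : cabs z <= r -> cabs (z + h) <= r ->
  r ^+ 2 * cabs ((z + h) ^+ n - z ^+ n - n%:R * z ^+ n.-1 * h) <=
  n%:R ^+ 2 * r ^+ n * cabs h ^+ 2.
Proof.
move=> zr whr; have r0 : 0 <= r by exact: le_trans (cabs_ge0 _) zr.
elim: n => [|n IHn].
  by rewrite !expr0 subrr mul0r sub0r mul0r oppr0 cabs0 mulr0 expr0n/= !mul0r.
have -> : (z + h) ^+ n.+1 - z ^+ n.+1 - n.+1%:R * z ^+ n.+1.-1 * h =
  (z + h) * ((z + h) ^+ n - z ^+ n - n%:R * z ^+ n.-1 * h) + n%:R * z ^+ n.-1 * h ^+ 2.
  case: n {IHn} => [|n]; first by rewrite !expr0 !expr1 /=; ring.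
  by rewrite /= [n.+2%:R]mulrSr [n.+1%:R]mulrSr !exprS; ring.
have k1 : r ^+ 2 * cabs ((z + h) * ((z + h) ^+ n - z ^+ n - n%:R * z ^+ n.-1 * h)) <=
    r * (n%:R ^+ 2 * r ^+ n * cabs h ^+ 2).
  rewrite cabsM mulrCA; apply: ler_pM => //; first exact: cabs_ge0.
  by rewrite mulr_ge0 ?sqr_ge0 ?cabs_ge0.
have k2 : r ^+ 2 * cabs (n%:R * z ^+ n.-1 * h ^+ 2) <= n%:R * r ^+ n.+1 * cabs h ^+ 2.
  rewrite !cabsM !cabsX cabs_nat.
  case: n {IHn k1} => [|n]; first by rewrite !mul0r mulr0.
  rewrite [n.+1.-1]/= mulrA ler_wpM2r ?sqr_ge0// mulrCA ler_wpM2l//.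
  rewrite (exprD r 2 n) ler_wpM2l ?sqr_ge0// lerXn2r ?nnegrE ?cabs_ge0//.
apply: le_trans (ler_wpM2l (sqr_ge0 _) (cabsD _ _)) _; rewrite mulrDr.
apply: le_trans (lerD k1 k2) _.
rewrite [r ^+ n.+1]exprS.
move: (cabs h ^+ 2) (sqr_ge0 (cabs h)) (r ^+ n) (exprn_ge0 n r0) => H H0 rn rn0.
have -> : r * (n%:R ^+ 2 * rn * H) + n%:R * (r * rn) * H = (n%:R ^+ 2 + n%:R) * (r * rn * H) by ring.
rewrite -[leRHS]mulrA ler_wpM2r ?mulr_ge0// [n.+1%:R]mulrSr.
have : 0 <= n%:R :> R by [].
by move: (n%:R) => t; clear; nra.
Qed.

(** Summing [pow_taylor] over n leaves a remainder O(|h|^2), since n^2 |a_n| r^n is summable for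
    some r between |z| and 1. *)
Lemma cpseries_cdiff a z : subexponential a -> cabs z < 1 ->
  cdiff (cpseries a) z (cpseries (fun n => n.+1%:R * a n.+1) z).
Proof.
move=> ha z1.
have [r [zr r1]] : exists r, cabs z < r /\ r < 1.
  by exists ((cabs z + 1) / 2); rewrite !midf_lt.
have r0 : 0 < r := le_lt_trans (cabs_ge0 _) zr.
have [|B HB] := subexponential_sum ha (q := r); first by rewrite (ltW r0).
have B0 : 0 <= B by have := HB 0%N; rewrite big_ord0.
have dB N : \sum_(n < N) cabs (n%:R * a n * z ^+ n.-1) <= B / r.
  rewrite ler_pdivlMr// mulr_suml; apply: le_trans (HB N); apply: ler_sum => n _.
  rewrite !cabsM cabsX cabs_nat.
  case: (nat_of_ord n) => [|m]; first by rewrite !mul0r mulr_ge0 ?sqr_ge0// mulr_ge0 ?cabs_ge0// exprn_ge0// ltW.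
  rewrite [m.+1.-1]/=.
  have -> : m.+1%:R * cabs (a m.+1) * cabs z ^+ m * r = m.+1%:R * (cabs (a m.+1) * (cabs z ^+ m * r)) by ring.
  apply: ler_pM => //; first by rewrite mulr_ge0 ?cabs_ge0// mulr_ge0 ?exprn_ge0 ?cabs_ge0// ltW.
    rewrite expr2; apply: le_trans (_ : m.+2%:R * (1 : R) <= _); first by rewrite mulr1 ler_nat.
    by rewrite ler_wpM2l// ler1n.
  rewrite ler_wpM2l ?cabs_ge0// exprSr ler_wpM2r ?(ltW r0)//.
  by rewrite lerXn2r ?nnegrE ?cabs_ge0 ?ltW.
have eA : cpseries (fun n => n.+1%:R * a n.+1) z = csum (fun n => n%:R * a n * z ^+ n.-1).
  by rewrite (csum_recl dB) !mul0r add0r.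
move=> e e0.
exists (Num.min (r - cabs z) (e * r ^+ 2 / (B + 1))).
  by rewrite lt_min subr_gt0 zr/= divr_gt0// ?mulr_gt0 ?exprn_gt0// ltr_wpDl.
move=> w; rewrite le_min => /andP[h1 h2]; pose h := w - z.
have ew : w = z + h by rewrite /h addrC subrK.
have wr : cabs w <= r.
  by rewrite ew; apply: le_trans (cabsD _ _) _; rewrite addrC -lerBrDr.
have w1 : cabs w < 1 := le_lt_trans wr r1.
pose u n := a n * (w ^+ n - z ^+ n - n%:R * z ^+ n.-1 * h).
have uB N : \sum_(n < N) cabs (u n) <= B / r ^+ 2 * cabs h ^+ 2.
  rewrite mulrAC ler_pdivlMr ?exprn_gt0// mulr_suml.
  apply: le_trans (_ : \sum_(n < N) n.+1%:R ^+ 2 * (cabs (a n) * r ^+ n) * cabs h ^+ 2 <= _); last first.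
    by rewrite -mulr_suml ler_wpM2r ?sqr_ge0.
  apply: ler_sum => n _; rewrite /u cabsM.
  have := @pow_taylor z h r n (ltW zr); rewrite -ew => /(_ wr) k.
  move: k; set X := cabs (_ - _ - _) => k.
  have -> : cabs (a n) * X * r ^+ 2 = cabs (a n) * (r ^+ 2 * X) by ring.
  apply: le_trans (ler_wpM2l (cabs_ge0 _) k) _.
  have -> : cabs (a n) * (n%:R ^+ 2 * r ^+ n * cabs h ^+ 2) =
     n%:R ^+ 2 * (cabs (a n) * r ^+ n * cabs h ^+ 2) by ring.
  rewrite -[leRHS]mulrA; apply: ler_wpM2r; last by rewrite lerXn2r ?nnegrE ?ler_nat.
  by rewrite mulr_ge0 ?sqr_ge0// mulr_ge0 ?cabs_ge0// exprn_ge0// ltW.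
have -> : cpseries a w - cpseries a z - cpseries (fun n => n.+1%:R * a n.+1) z * (w - z) = csum u.
  apply/esym/csum_ctends; rewrite eA -/h [csum _ * h]mulrC.
  have t1 := cpseries_ctends ha w1; have t2 := cpseries_ctends ha z1.
  have t3 := @asum_ctends _ (fun n => n%:R * a n * z ^+ n.-1) _ dB.
  apply: ctends_ext (ctendsB (ctendsB t1 t2) (ctendsM h t3)) => n.
  by rewrite mulr_sumr -!sumrB; apply: eq_bigr => i _; rewrite /u; ring.
apply: le_trans (csum_cabs_le uB) _; rewrite -/h in h2 *; rewrite [cabs h ^+ 2]expr2 mulrA ler_wpM2r ?cabs_ge0//.
apply: le_trans (ler_wpM2l _ h2) _; first by rewrite divr_ge0// exprn_ge0// ltW.
have B1 : 0 < B + 1 by rewrite ltr_wpDl.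
have -> : B / r ^+ 2 * (e * r ^+ 2 / (B + 1)) = e * (B / (B + 1)).
  by field; rewrite !gt_eqF.
by rewrite ger_pMr// ler_pdivrMr// mul1r lerDl.
Qed.

End PowerSeries.

(** * Circular means and Cauchy's theorem for annuli *)

Section CircleMeans.
Variable R : realType.
Implicit Types (x y t e B : R) (g : R -> R[i]) (G : R[i] -> R[i]) (z w c : R[i]).

Definition cint g : R[i] :=
  Complex (seg_int (fun y => complex.Re (g y)) 0 (2 * pi))
          (seg_int (fun y => complex.Im (g y)) 0 (2 * pi)).

Definition ccont g := seg_cont (fun y => complex.Re (g y)) 0 (2 * pi) /\
  seg_cont (fun y => complex.Im (g y)) 0 (2 * pi).

(** The contour integral of G(z) / (i z) dz over the circle of radius exp x. *)
Definition circ G x : R[i] := cint (fun y => G (polar x y)).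

Lemma twopi_gt0 : 0 < 2 * pi :> R.
Proof. by rewrite mulr_gt0// pi_gt0. Qed.

Lemma polar_periodic x : polar x (2 * pi) = polar x 0.
Proof.
by rewrite /polar /circle_point mulr_natl cos2pi sin2pi cos0 sin0.
Qed.

Lemma ccontM c g : ccont g -> ccont (fun y => c * g y).
Proof.
move=> [h1 h2]; split.
  under [X in seg_cont X]funext do rewrite cReM.
  by apply: seg_contB; exact: seg_contZ.
under [X in seg_cont X]funext do rewrite cImM.
by apply: seg_contD; exact: seg_contZ.
Qed.

Lemma ccontD g1 g2 : ccont g1 -> ccont g2 -> ccont (fun y => g1 y + g2 y).
Proof.
move=> [h1 h2] [h3 h4]; split.
  under [X in seg_cont X]funext do rewrite cReD; exact: seg_contD.
under [X in seg_cont X]funext do rewrite cImD; exact: seg_contD.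
Qed.

Lemma cintM c g : ccont g -> cint (fun y => c * g y) = c * cint g.
Proof.
move=> [h1 h2]; apply/eqP; rewrite eq_complex cReM cImM /=; apply/andP; split; apply/eqP.
  rewrite -!seg_intZ// -seg_intB; [|exact: seg_contZ|exact: seg_contZ].
  by apply: eq_seg_int => y _; rewrite cReM.
rewrite -!seg_intZ// -seg_intD; [|exact: seg_contZ|exact: seg_contZ].
by apply: eq_seg_int => y _; rewrite cImM.
Qed.

Lemma cintD g1 g2 : ccont g1 -> ccont g2 ->
  cint (fun y => g1 y + g2 y) = cint g1 + cint g2.
Proof.
move=> [h1 h2] [h3 h4]; apply/eqP; rewrite eq_complex cReD cImD /=; apply/andP; split; apply/eqP.
  by rewrite -seg_intD//; apply: eq_seg_int => y _; rewrite cReD.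
by rewrite -seg_intD//; apply: eq_seg_int => y _; rewrite cImD.
Qed.

Lemma ccont_cst c : ccont (fun=> c).
Proof. by split; exact: seg_cont_cst. Qed.

Lemma cint_cst c : cint (fun=> c) = c * real_complex R (2 * pi).
Proof.
apply/eqP; rewrite eq_complex cReM cImM /= !seg_int_cst ?(ltW twopi_gt0)//.
by apply/andP; split; apply/eqP; ring.
Qed.

Lemma ccont_sum (I : Type) (r : seq I) (F : I -> R -> R[i]) :
  (forall i, ccont (F i)) -> ccont (fun y => \sum_(i <- r) F i y).
Proof.
move=> h; elim: r => [|i r IHr].
  by under [X in ccont X]funext do rewrite big_nil; exact: ccont_cst.
by under [X in ccont X]funext do rewrite big_cons; exact: ccontD.
Qed.

Lemma cint_sum (I : Type) (r : seq I) (F : I -> R -> R[i]) :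
  (forall i, ccont (F i)) ->
  cint (fun y => \sum_(i <- r) F i y) = \sum_(i <- r) cint (F i).
Proof.
move=> h; elim: r => [|i r IHr].
  rewrite big_nil; under [X in cint X]funext do rewrite big_nil.
  by rewrite cint_cst mul0r.
rewrite big_cons -IHr -cintD//; last exact: ccont_sum.
by congr cint; apply/funext => y; rewrite big_cons.
Qed.

(** Real and imaginary parts are bounded separately, whence 4 pi instead of 2 pi. *)
Lemma cint_bound g B : ccont g -> (forall y, 0 <= y <= 2 * pi -> cabs (g y) <= B) ->
  cabs (cint g) <= 4 * pi * B.
Proof.
move=> [h1 h2] gB; apply: le_trans (cabs_leD _) _ => /=.
have -> : 4 * pi * B = B * (2 * pi - 0) + B * (2 * pi - 0) by ring.
apply: lerD; apply: seg_int_bound => //; rewrite ?(ltW twopi_gt0)// => y hy.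
  exact: le_trans (normRe_le _) (gB _ hy).
exact: le_trans (normIm_le _) (gB _ hy).
Qed.

Lemma ccont_bounded g : ccont g ->
  exists B, forall y, 0 <= y <= 2 * pi -> cabs (g y) <= B.
Proof.
have aux (f : R -> R) : seg_cont f 0 (2 * pi) ->
    exists B, forall y, 0 <= y <= 2 * pi -> `|f y| <= B.
  move=> hf.
  have hc : {within `[0, 2 * pi], continuous f}.
    by apply: continuous_in_subspaceT => y; rewrite inE/= in_itv/= => /hf.
  have [u _ hu] := EVT_max (ltW twopi_gt0) hc.
  have [v _ hv] := EVT_min (ltW twopi_gt0) hc.
  exists (`|f u| + `|f v|) => y hy.
  have hy' : y \in `[0, 2 * pi] by rewrite in_itv.
  have := hu _ hy'; have := hv _ hy'.
  have := ler_norm (f u); have := ler_norm (- f v); rewrite normrN.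
  have := normr_ge0 (f u); have := normr_ge0 (f v).
  rewrite ler_norml; move: (f y) (f u) (f v) `|_| `|_| => a b c d k; clear; lra.
move=> [/aux[B1 h1] /aux[B2 h2]]; exists (B1 + B2) => y hy.
by apply: le_trans (cabs_leD _) _; rewrite lerD ?h1 ?h2.
Qed.

(** Multiplication by -i carries imaginary parts to real parts, so results on real parts of means
    transfer. *)
Lemma Re_mulNi c : complex.Re (Complex 0 (-1) * c) = complex.Im c.
Proof. by rewrite cReM /=; ring. Qed.

Lemma polar_cdiff_cont G x : (forall y, 0 <= y <= 2 * pi -> cdiffable G (polar x y)) ->
  ccont (fun y => G (polar x y)).
Proof.
move=> h; split => y hy.
  exact: closed_form_contr (polar_closed_form (h y hy)).
have h' := cdiffableM (cdiffable_cst (Complex 0 (-1)) (polar x y)) (h y hy).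
have := closed_form_contr (polar_closed_form h').
by under [X in {for _, continuous X} -> _]funext do rewrite Re_mulNi.
Qed.

(** On [x1, x2] x [0, 2 pi] the horizontal sides cancel by periodicity, and the vertical ones are
    the two means. *)
Lemma Re_circ_loop G x1 x2 :
  ccont (fun y => G (polar x1 y)) -> ccont (fun y => G (polar x2 y)) ->
  loop (fun x y => complex.Im (G (polar x y))) (fun x y => complex.Re (G (polar x y)))
    x1 x2 0 (2 * pi) = 0 ->
  complex.Re (circ G x1) = complex.Re (circ G x2).
Proof.
move=> [h1 _] [h2 _]; rewrite /loop.
have -> : seg_int (fun x => complex.Im (G (polar x 0)) - complex.Im (G (polar x (2 * pi)))) x1 x2 = 0.
  rewrite (@eq_seg_int _ _ (fun=> 0)); last by move=> x _; rewrite polar_periodic subrr.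
  by rewrite /seg_int Rintegral_cst ?mul0r.
by rewrite add0r seg_intB// => /eqP; rewrite subr_eq0 => /eqP.
Qed.

Lemma circ_mulNi G x : ccont (fun y => G (polar x y)) ->
  complex.Im (circ G x) = complex.Re (circ (fun z => Complex 0 (-1) * G z) x).
Proof. by move=> h; rewrite /circ cintM// Re_mulNi. Qed.

Lemma circ_const G x1 x2 : x1 <= x2 ->
  (forall x y, x1 <= x <= x2 -> cdiffable G (polar x y)) -> circ G x1 = circ G x2.
Proof.
move=> x12 h.
have hx1 : x1 <= x1 <= x2 by rewrite lexx.
have hx2 : x1 <= x2 <= x2 by rewrite lexx andbT.
have re G' : (forall x y, x1 <= x <= x2 -> cdiffable G' (polar x y)) ->
    complex.Re (circ G' x1) = complex.Re (circ G' x2).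
  move=> h'; apply: Re_circ_loop.
  - by apply: polar_cdiff_cont => y _; exact: h'.
  - by apply: polar_cdiff_cont => y _; exact: h'.
  - apply: goursat => //; first exact: ltW twopi_gt0.
    by move=> x y hx _; apply: polar_closed_form; exact: h'.
apply/eqP; rewrite eq_complex; apply/andP; split; apply/eqP; first exact: re.
rewrite !circ_mulNi; [|by apply: polar_cdiff_cont => y _; exact: h..].
by apply: re => x y hx; apply: cdiffableM (h _ _ hx); exact: cdiffable_cst.
Qed.

(* The circular mean does not jump across a circle carrying one bounded
   singularity. *)
Lemma circ_const_bounded G x1 x0 x2 y0 B (r : R) : x1 < x0 < x2 -> 0 < y0 < 2 * pi ->
  (forall x y, x1 <= x <= x2 -> 0 <= y <= 2 * pi -> x != x0 \/ y != y0 ->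
     cdiffable G (polar x y)) ->
  0 <= B -> 0 < r ->
  (forall x y, `|x - x0| <= r -> `|y - y0| <= r -> x != x0 \/ y != y0 ->
     cabs (G (polar x y)) <= B) ->
  circ G x1 = circ G x2.
Proof.
move=> x102 y02 h B0 r0 hb; have /andP[x10 x02] := x102.
have hx1 : x1 <= x1 <= x2 by rewrite lexx (ltW (lt_trans x10 x02)).
have hx2 : x1 <= x2 <= x2 by rewrite lexx (ltW (lt_trans x10 x02)).
have n1 : x1 != x0 by rewrite lt_eqF.
have n2 : x2 != x0 by rewrite gt_eqF.
have re G' : (forall x y, x1 <= x <= x2 -> 0 <= y <= 2 * pi -> x != x0 \/ y != y0 ->
     cdiffable G' (polar x y)) ->
    (forall x y, `|x - x0| <= r -> `|y - y0| <= r -> x != x0 \/ y != y0 ->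
     cabs (G' (polar x y)) <= B) ->
    complex.Re (circ G' x1) = complex.Re (circ G' x2).
  move=> h' hb'; apply: Re_circ_loop.
  - by apply: polar_cdiff_cont => y hy; apply: h' => //; left.
  - by apply: polar_cdiff_cont => y hy; apply: h' => //; left.
  - apply: (@goursat_bounded _ _ _ _ _ _ _ x0 y0 B r) => //.
      by move=> x y hx hy n; apply: polar_closed_form; exact: h'.
    move=> x y hx hy n; have k := hb' x y hx hy n.
    by split; apply: le_trans k; [exact: normIm_le|exact: normRe_le].
apply/eqP; rewrite eq_complex; apply/andP; split; apply/eqP; first exact: re.
rewrite !circ_mulNi; [|by apply: polar_cdiff_cont => y hy; apply: h => //; left..].
apply: re => x y hx hy n.
  by apply: cdiffableM (h _ _ hx hy n); exact: cdiffable_cst.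
rewrite cabsM -[leRHS]mul1r ler_pM ?cabs_ge0//; last exact: hb.
by rewrite /cabs /= sqrrN expr0n/= add0r expr1n sqrtr1.
Qed.

(** The angle is acos of the normalized real part, reflected to 2 pi - acos in the lower
    half-plane. *)
Lemma polar_arg w : w != 0 ->
  exists y, 0 <= y < 2 * pi /\ w = polar (ln (cabs w)) y.
Proof.
move=> w0; have c0 : 0 < cabs w by rewrite cabs_gt0.
pose u := complex.Re w / cabs w; pose v := complex.Im w / cabs w.
have uv : u ^+ 2 + v ^+ 2 = 1.
  by rewrite /u /v !expr_div_n -mulrDl -cabs_sqr divff// expf_eq0/= gt_eqF.
have u1 : -1 <= u <= 1.
  by rewrite -ler_norml /u normrM normfV (gtr0_norm c0) ler_pdivrMr// mul1r normRe_le.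
have pu : w = circle_point (cabs w) 0 * Complex u v.
  rewrite /circle_point cos0 sin0 mulr0 mulr1 /u /v; apply/eqP; rewrite eq_complex /=.
  by apply/andP; split; apply/eqP; field; rewrite gt_eqF.
have acu : 0 <= acos u <= pi by rewrite acos_ge0// acos_lepi.
have cu : cos (acos u) = u by rewrite acosK// in_itv.
have su : sin (acos u) = `|v|.
  by rewrite sin_acos// -uv addrAC subrr add0r sqrtr_sqr.
have pi0 := pi_gt0 R.
have fin y : cos y = u -> sin y = v -> w = polar (ln (cabs w)) y.
  move=> cy sy; rewrite /polar lnK ?posrE// /circle_point cy sy.
  by rewrite {1}pu /circle_point cos0 sin0; apply/eqP; rewrite eq_complex /=; apply/andP; split; apply/eqP; ring.
have [v0|v0] := leP 0 v.
  exists (acos u); split; last by apply: fin; rewrite ?su ?ger0_norm.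
  by case/andP: acu => -> /=; move: (acos u) => t; lra.
exists (2 * pi - acos u); split.
  have : acos u != 0.
    apply/eqP => a0; move: su; rewrite a0 sin0 => /esym/eqP.
    by rewrite normr_eq0 lt_eqF.
  by case/andP: acu => a1 a2 a3; have : 0 < acos u by [rewrite lt_neqAle eq_sym a3]; move: (acos u) a2 => t; lra.
have e : 2 * pi - acos u = - acos u + pi *+ 2 by rewrite mulr_natl addrC.
apply: fin; rewrite e ?cosD2pi ?sinD2pi ?cosN ?sinN ?cu// su.
by rewrite ltr0_norm ?opprK.
Qed.

(** The half-angle formula gives sin (t / 2) = 0, and |t / 2| < pi. *)
Lemma cos_eq1_small t : `|t| < 2 * pi -> cos t = 1 -> t = 0.
Proof.
move=> t2 ct.
have s0 : sin (t / 2) = 0.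
  have := cosD (t / 2) (t / 2); rewrite -splitr ct => e.
  have := cos2Dsin2 (t / 2); rewrite -!expr2 in e; move=> e'.
  have : sin (t / 2) ^+ 2 = 0 by move: e e'; set a := _ ^+ 2; set b := _ ^+ 2; lra.
  by move/eqP; rewrite sqrf_eq0 => /eqP.
have [tp|tn|//] := ltgtP 0 t.
  have : 0 < sin (t / 2).
    apply: sin_gt0_pi; rewrite divr_gt0//= ltr_pdivrMr// mulrC.
    by move: t2; rewrite gtr0_norm.
  by rewrite s0 ltxx.
have : 0 < sin (- (t / 2)).
  apply: sin_gt0_pi; rewrite -mulNr divr_gt0 ?oppr_gt0//= ltr_pdivrMr// mulrC.
  by move: t2; rewrite ltr0_norm.
by rewrite sinN s0 oppr0 ltxx.
Qed.

(** The ranges are asymmetric because y runs over a closed rectangle whose sides 0 and 2 pi are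
    identified, while the singular point is interior. *)
Lemma polar_inj x y x0 y0 : 0 <= y <= 2 * pi -> 0 < y0 < 2 * pi ->
  polar x y = polar x0 y0 -> x = x0 /\ y = y0.
Proof.
move=> hy hy0 e.
have ex : x = x0 by apply: expR_inj; rewrite -(cabs_polar x y) e cabs_polar.
split => //; subst x0; apply/eqP; rewrite -subr_eq0; apply/eqP; apply: cos_eq1_small.
  by case/andP: hy hy0 => ? ? /andP[? ?]; rewrite ltr_norml; apply/andP; split; lra.
have := congr1 (@complex.Re R) e; have := congr1 (@complex.Im R) e.
rewrite /= => /(mulfI (lt0r_neq0 (expR_gt0 x))) es /(mulfI (lt0r_neq0 (expR_gt0 x))) ec.
by rewrite cosB es ec -!expr2 cos2Dsin2.
Qed.

End CircleMeans.

(** * Cauchy's formula and the Taylor expansion *)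

Section TaylorExpansion.
Variable R : realType.
Implicit Types (x y t e B : R) (G : R[i] -> R[i]) (z w c : R[i]).

Lemma pow_small (q : R) e : 0 <= q < 1 -> 0 < e ->
  exists N, forall n, (N <= n)%N -> q ^+ n <= e.
Proof.
move=> /andP[q0 q1] e0; have d0 : 0 < (1 - q) * e by rewrite mulr_gt0// subr_gt0.
exists (Num.truncn ((1 - q) * e)^-1).+1 => n hn.
have n1 : ((1 - q) * e)^-1 < n%:R.
  by apply: lt_le_trans (truncnS_gt _) _; rewrite ler_nat.
have n0 : 0 < n%:R :> R by apply: lt_trans n1; rewrite invr_gt0.
have : n%:R * q ^+ n <= (1 - q)^-1.
  have := @geometric_partial_le _ q n; rewrite q0 q1 => /(_ isT); apply: le_trans.
  rewrite mulr_natl -[X in _ *+ X]card_ord -sumr_const; apply: ler_sum => i _.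
  by apply: ler_wiXn2l => //; [exact: ltW|exact: ltnW].
move=> h; rewrite -(ler_pM2l n0); apply: le_trans h _.
by move: n1; rewrite invfM ltr_pdivrMr// => /ltW.
Qed.

Lemma expR_le_small e : 0 < e -> expR (- e^-1) <= e.
Proof.
move=> e0; rewrite expRN -[leRHS]invrK lef_pV2 ?posrE ?expR_gt0 ?invr_gt0//.
by apply: le_trans (expR_ge1Dx _); rewrite lerDr.
Qed.

Lemma cabs_inv_polar x y n : cabs ((polar x y)^-1 ^+ n) = expR (- x) ^+ n.
Proof. by rewrite cabsX cabsV cabs_polar expRN. Qed.

Lemma cdiffable_inv_pow x y n : cdiffable (fun z => z^-1 ^+ n) (polar x y).
Proof.
apply: (@cdiffableX _ (fun z => z^-1)); apply: (@cdiffableV _ id) (polar_neq0 _ _) _.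
exact: cdiffable_id.
Qed.

(** The mean does not depend on the radius and tends to 0 as the radius grows. *)
Lemma circ_inv_pow x n : (0 < n)%N -> circ (fun z : R[i] => z^-1 ^+ n) x = 0.
Proof.
move=> n0; apply/eqP; rewrite -cabs_eq0 eq_le cabs_ge0 andbT.
apply: (@le_of_eps _ _ _ (4 * pi)); first by rewrite mulr_ge0 ?pi_ge0//.
move=> e e0; rewrite add0r.
pose e1 := Num.min e 1.
have e10 : 0 < e1 by rewrite lt_min e0 ltr01.
pose x' := Num.max x e1^-1.
have -> : circ (fun z : R[i] => z^-1 ^+ n) x = circ (fun z => z^-1 ^+ n) x'.
  apply: circ_const; first by rewrite le_max lexx.
  by move=> *; exact: cdiffable_inv_pow.
apply: cint_bound; first by apply: (@polar_cdiff_cont _ (fun z => z^-1 ^+ n)) => *; exact: cdiffable_inv_pow.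
move=> y _; rewrite cabs_inv_polar.
have h : expR (- x') <= e1.
  by apply: le_trans (expR_le_small e10); rewrite ler_expR lerN2 le_max lexx orbT.
have h1 : expR (- x') <= 1 by apply: le_trans h _; rewrite ge_min lexx orbT.
apply: le_trans (_ : e1 <= e); last by rewrite ge_min lexx.
apply: le_trans h; case: n n0 => // n _; rewrite exprS ler_piMr ?expR_ge0//.
by rewrite exprn_ile1// expR_ge0.
Qed.

Section CauchyKernel.
Variables (x0 y0 x2 : R).
Hypothesis x02 : x0 < x2.
Let w := polar x0 y0.
(** The factor z compensates dy = dz / (i z), so that [circ] of g K is the Cauchy integral of g. *)
Let K z := z * (z - w)^-1.

Lemma polar_off_circle x y : x != x0 -> polar x y - w != 0.
Proof.
move=> xx0; rewrite subr_eq0; apply/eqP => e; move/eqP: xx0; apply.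
by apply: expR_inj; rewrite -(cabs_polar x y) e cabs_polar.
Qed.

Lemma cauchy_kernel_cdiffable z : z - w != 0 -> cdiffable K z.
Proof.
move=> zw; apply: cdiffableM; first exact: cdiffable_id.
apply: (@cdiffableV _ (fun z => z - w)) zw _.
by apply: cdiffableB; [exact: cdiffable_id|exact: cdiffable_cst].
Qed.

Lemma cauchy_kernel_circ x : x != x0 -> ccont (fun y => K (polar x y)).
Proof.
move=> xx0; apply: (@polar_cdiff_cont _ K) => y _; apply: cauchy_kernel_cdiffable.
exact: polar_off_circle.
Qed.

Lemma cauchy_kernel_bound y : cabs (K (polar x2 y)) <= expR x2 / (expR x2 - expR x0).
Proof.
rewrite /K cabsM cabsV cabs_polar ler_wpM2l ?expR_ge0// lef_pV2 ?posrE.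
- by rewrite -(cabs_polar x2 y) -(cabs_polar x0 y0); exact: cabsB_ge.
- by rewrite cabs_gt0; apply: polar_off_circle; rewrite gt_eqF.
- by rewrite subr_gt0 ltr_expR.
Qed.

Lemma cauchy_kernel_expand N z : z != 0 -> z - w != 0 ->
  K z = \sum_(n < N) w ^+ n * z^-1 ^+ n + w ^+ N * z^-1 ^+ N * K z.
Proof.
move=> z0 zw; have -> : \sum_(n < N) w ^+ n * z^-1 ^+ n = (1 - (w * z^-1) ^+ N) * K z.
  under eq_bigr do rewrite -exprMn.
  have := subrX1 (w * z^-1) N; set S := \sum_(i < N) _ => e.
  have -> : 1 - (w * z^-1) ^+ N = (1 - w * z^-1) * S by rewrite -(opprB _ 1) e; ring.
  by rewrite /K; field; rewrite z0 zw.
by rewrite exprMn; ring.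
Qed.

(** Geometric expansion of the kernel in w / z; the remainder after N terms is O(q^N) with q = |w| /
    |z| < 1. *)
Lemma cauchy_kernel_series (g : R[i] -> R[i]) :
  (forall y, 0 <= y <= 2 * pi -> cdiffable g (polar x2 y)) ->
  ctends (fun N => \sum_(n < N) w ^+ n * circ (fun z => g z * z^-1 ^+ n) x2)
         (circ (fun z => g z * K z) x2).
Proof.
move=> hg.
have gc n : ccont (fun y => g (polar x2 y) * (polar x2 y)^-1 ^+ n).
  apply: (@polar_cdiff_cont _ (fun z => g z * z^-1 ^+ n)) => y hy.
  by apply: cdiffableM (hg y hy) _; exact: cdiffable_inv_pow.
have gK n : ccont (fun y => g (polar x2 y) * (polar x2 y)^-1 ^+ n * K (polar x2 y)).
  apply: (@polar_cdiff_cont _ (fun z => g z * z^-1 ^+ n * K z)) => y hy.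
  apply: cdiffableM; first by apply: cdiffableM (hg y hy) _; exact: cdiffable_inv_pow.
  by apply: cauchy_kernel_cdiffable; apply: polar_off_circle; rewrite gt_eqF.
have [B hB] := ccont_bounded (polar_cdiff_cont hg).
have B0 : 0 <= B.
  by apply: le_trans (hB 0 _); rewrite ?cabs_ge0// lexx (ltW (twopi_gt0 R)).
pose k := expR x2 / (expR x2 - expR x0).
have k0 : 0 <= k by rewrite divr_ge0 ?expR_ge0// subr_ge0 ler_expR ltW.
pose q := expR x0 / expR x2.
have q01 : 0 <= q < 1.
  by rewrite divr_ge0 ?expR_ge0//= ltr_pdivrMr ?expR_gt0// mul1r ltr_expR.
have rem N : circ (fun z => g z * K z) x2 =
   \sum_(n < N) w ^+ n * circ (fun z => g z * z^-1 ^+ n) x2 +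
   w ^+ N * cint (fun y => g (polar x2 y) * (polar x2 y)^-1 ^+ N * K (polar x2 y)).
  rewrite -cintM//; under eq_bigr do rewrite -cintM//.
  rewrite -cint_sum; last by move=> n; exact: ccontM.
  rewrite -cintD; [|by apply: ccont_sum => n; exact: ccontM|exact: ccontM].
  congr cint; apply/funext => y; rewrite {1}(@cauchy_kernel_expand N) ?polar_neq0//; last first.
    by apply: polar_off_circle; rewrite gt_eqF.
  by rewrite mulrDr mulr_sumr; congr (_ + _); [apply: eq_bigr => i _; ring|ring].
move=> e e0.
have D0 : 0 < 4 * pi * (B * k) + 1.
  by apply: ltr_wpDl => //; apply: mulr_ge0; apply: mulr_ge0 => //; exact: pi_ge0.
have [N HN] := pow_small q01 (divr_gt0 e0 D0).
exists N => n /HN hn; rewrite (rem n) cabsBC addrC addKr cabsM cabsX cabs_polar.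
have b : cabs (cint (fun y => g (polar x2 y) * (polar x2 y)^-1 ^+ n * K (polar x2 y))) <=
    4 * pi * (B * expR (- x2) ^+ n * k).
  apply: cint_bound => // y hy; rewrite cabsM [cabs (g _ * _)]cabsM cabs_inv_polar -mulrA.
  rewrite -[leRHS]mulrA ler_pM ?cabs_ge0 ?mulr_ge0 ?cabs_ge0 ?exprn_ge0 ?expR_ge0//.
    exact: hB.
  by rewrite ler_wpM2l ?exprn_ge0 ?expR_ge0//; exact: cauchy_kernel_bound.
apply: le_trans (ler_wpM2l (exprn_ge0 _ (expR_ge0 _)) b) _.
have -> : expR x0 ^+ n * (4 * pi * (B * expR (- x2) ^+ n * k)) = (4 * pi * (B * k)) * q ^+ n.
  by rewrite /q -expRN exprMn; ring.
apply: le_trans (ler_wpM2l _ hn) _.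
  by apply: mulr_ge0; apply: mulr_ge0 => //; exact: pi_ge0.
by rewrite mulrCA ger_pMr// ler_pdivrMr// mul1r lerDl.
Qed.

(** In the expansion for g = 1 every term but the one at n = 0 vanishes by [circ_inv_pow]. *)
Lemma circ_cauchy_kernel : circ K x2 = real_complex R (2 * pi).
Proof.
have h := @cauchy_kernel_series (fun=> 1) (fun y _ => cdiffable_cst 1 _).
have -> : circ K x2 = circ (fun z => 1 * K z) x2.
  by rewrite /circ; congr cint; apply/funext => y; rewrite mul1r.
apply: ctends_unique h _ => e e0; exists 1%N => -[//|n] _.
rewrite big_ord_recl big1 => [|i _].
  rewrite expr0 mul1r addr0; under [X in circ X]funext do rewrite expr0 mulr1.
  by rewrite /circ cint_cst mul1r subrr cabs0 ltW.
under [X in circ X]funext do rewrite mul1r.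
by rewrite circ_inv_pow ?mulr0// lift0.
Qed.

End CauchyKernel.

Section Analytic.
Variable f : R[i] -> R[i].
Hypothesis hf : forall z, cabs z < 1 -> cdiffable f z.

Let polar_in_disc x y : x < 0 -> cabs (polar x y) < 1.
Proof. by move=> x0; rewrite cabs_polar expR_lt1. Qed.

(** G = (f - f(w)) K is bounded near w, so its mean does not jump across the circle through w; on
    circles shrinking to 0 it tends to 0 because of the factor z in K. The condition on y0 keeps w
    off the horizontal sides of the rectangle. *)
Lemma cauchy_formula x0 y0 x2 : x0 < x2 -> x2 < 0 -> 0 < y0 < 2 * pi ->
  let w := polar x0 y0 in
  circ (fun z => f z * (z * (z - w)^-1)) x2 = f w * real_complex R (2 * pi).
Proof.
move=> x02 x20 hy0 w; have x00 := lt_trans x02 x20.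
pose K z := z * (z - w)^-1.
pose G z := (f z - f w) * K z.
have w1 : cabs w < 1 by exact: polar_in_disc.
have Gd x y : x < 0 -> polar x y - w != 0 -> cdiffable G (polar x y).
  move=> x_0 pw; apply: cdiffableM; last exact: cauchy_kernel_cdiffable.
  by apply: cdiffableB; [apply: hf; exact: polar_in_disc|exact: cdiffable_cst].
suff G0 : circ G x2 = 0.
  have c1 : ccont (fun y => f (polar x2 y) * K (polar x2 y)).
    apply: (@polar_cdiff_cont _ (fun z => f z * K z)) => y _.
    apply: cdiffableM; first by apply: hf; exact: polar_in_disc.
    by apply: cauchy_kernel_cdiffable; apply: polar_off_circle; rewrite gt_eqF.
  have c2 : ccont (fun y => K (polar x2 y)).
    by apply: cauchy_kernel_circ; rewrite gt_eqF.
  have : circ G x2 = circ (fun z => f z * K z) x2 + (- f w) * circ K x2.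
    rewrite /circ -cintM// -cintD//; last exact: ccontM.
    by congr cint; apply/funext => y; rewrite /G; ring.
  by rewrite G0 circ_cauchy_kernel// mulNr => /esym/eqP; rewrite subr_eq0 => /eqP.
have f0 : cdiffable f 0 by apply: hf; rewrite cabs0.
have [r r0 hr] := cdiff_continuous f0 ltr01.
have [rw rw0 [Bw Bw0 hBw]] := cdiff_bounded (hf w1).
have cw0 : 0 < cabs w by rewrite cabs_gt0 polar_neq0.
pose B := 1 + cabs (f 0) + cabs (f w).
pose C := B * (2 / cabs w).
have C0 : 0 <= C by rewrite mulr_ge0 ?divr_ge0 ?cabs_ge0// !addr_ge0 ?cabs_ge0.
apply/eqP; rewrite -cabs_eq0 eq_le cabs_ge0 andbT.
apply: (@le_of_eps _ _ _ (4 * pi * C)).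
  by apply: mulr_ge0 => //; apply: mulr_ge0 => //; exact: pi_ge0.
move=> e e0; rewrite add0r.
pose rr := Num.min r (cabs w / 2).
have rr0 : 0 < rr by rewrite lt_min r0 divr_gt0.
(* A circle inside the one through w, so small that f is within 1 of f(0), that |z| <= |w| / 2, and
   that its radius is at most e. *)
pose x1 := Num.min (x0 - 1) (Num.min (ln rr) (- e^-1)).
have x10 : x1 < x0.
  by apply: le_lt_trans (_ : x0 - 1 < x0); [rewrite ge_min lexx|rewrite gtrBl].
have xr : expR x1 <= rr.
  by rewrite -[leRHS](lnK (x := rr)) ?posrE// ler_expR ge_min ge_min lexx /= orbT.
have xe : expR x1 <= e.
  by apply: le_trans (expR_le_small e0); rewrite ler_expR ge_min ge_min lexx !orbT.
have -> : circ G x2 = circ G x1.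
  apply/esym.
  have e20 : 0 < 1 :> R by [].
  have [r3 r30 h3] := polar_diff0 e20.
  pose r4 := Num.min r3 (rw / (4 * cabs w)).
  have r40 : 0 < r4 by rewrite lt_min r30 divr_gt0// mulr_gt0.
  (* [r4] keeps the points within [rw] of w, where f - f(w) is Lipschitz; [- x0] keeps them in the
     closed unit disc, where the factor z of K is at most 1. *)
  pose rx := Num.min r4 (- x0).
  have rx0 : 0 < rx by rewrite lt_min r40 oppr_gt0.
  have near x y : `|x - x0| <= rx -> `|y - y0| <= rx ->
      cabs (polar x y - w) <= rw.
    move=> hx hy.
    have rx3 : rx <= r3 by rewrite ge_min ge_min lexx.
    have rxw : rx <= rw / (4 * cabs w) by rewrite ge_min ge_min lexx orbT.
    have := h3 (x - x0) (y - y0) (le_trans hx rx3) (le_trans hy rx3).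
    set s := x - x0; set t := y - y0; rewrite mul1r => h.
    have -> : polar x y - w = w * (polar s t - 1).
      have -> : polar x y = w * polar s t.
        by rewrite /w -polarD /s /t !(addrC _ (_ - _)) !subrK.
      by ring.
    have st : cabs (polar s t - 1) <= 2 * (`|s| + `|t|).
      rewrite -(subrK (Complex s t) (polar s t - 1)).
      apply: le_trans (cabsD _ _) _; rewrite mulr_natl mulr2n lerD//.
      exact: cabs_leD.
    rewrite cabsM; apply: le_trans (ler_wpM2l (cabs_ge0 _) st) _.
    have : `|s| + `|t| <= rw / (4 * cabs w) + rw / (4 * cabs w).
      by rewrite lerD// ?(le_trans hx)// (le_trans hy).
    move=> k; rewrite mulrA; apply: le_trans (ler_wpM2l _ k) _.
      by rewrite mulr_ge0// cabs_ge0.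
    by rewrite le_eqVlt; apply/orP; left; apply/eqP; field; rewrite gt_eqF.
  apply: (@circ_const_bounded _ G x1 x0 x2 y0 (Bw * 1) rx) => //; first by rewrite x10.
  - move=> x y /andP[_ xx2] hy n; apply: Gd; first exact: le_lt_trans xx2 x20.
    rewrite subr_eq0; apply/eqP => /(polar_inj hy hy0)[ex ey].
    by case: n; rewrite ?ex ?ey eqxx.
  - by rewrite mulr1.
  - move=> x y hx hy _; rewrite /G cabsM /K cabsM.
    have [->|pw] := eqVneq (polar x y) w.
      by rewrite subrr cabs0 mul0r mulr1.
    have pw0 : 0 < cabs (polar x y - w) by rewrite cabs_gt0 subr_eq0.
    have k := hBw _ (near _ _ hx hy).
    rewrite mulrCA cabsV [leRHS]mulrC; apply: ler_pM; rewrite ?cabs_ge0//.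
    + by rewrite divr_ge0// cabs_ge0.
    + rewrite cabs_polar expR_le1.
      have : x - x0 <= - x0.
        apply: le_trans (ler_norm _) _; apply: le_trans hx _.
        by rewrite ge_min lexx orbT.
      by rewrite lerBlDr addrC subrr.
    + by rewrite ler_pdivrMr.
apply: le_trans (_ : 4 * pi * (C * e) <= _); last by rewrite mulrA.
apply: cint_bound.
  apply: (@polar_cdiff_cont _ G) => y _; apply: Gd; first exact: lt_trans x10 x00.
  by apply: polar_off_circle; rewrite lt_eqF.
move=> y _; set z := polar x1 y.
have cz : cabs z = expR x1 by exact: cabs_polar.
rewrite /G /K cabsM cabsM cabsV cz.
have zr : cabs (z - 0) <= r by rewrite subr0 cz; apply: le_trans xr _; rewrite ge_min lexx.
have h1 : cabs (f z - f w) <= B.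
  have -> : f z - f w = (f z - f 0) + f 0 - f w by ring.
  apply: le_trans (cabsB _ _) _; rewrite lerD2r.
  by apply: le_trans (cabsD _ _) _; rewrite lerD2r hr.
have h2 : (cabs (z - w))^-1 <= 2 / cabs w.
  rewrite -[2 / _]invf_div lef_pV2 ?posrE ?divr_gt0//; last first.
    by rewrite cabs_gt0; apply: polar_off_circle; rewrite lt_eqF.
  rewrite cabsBC; apply: le_trans (cabsB_ge _ _).
  have : cabs z <= cabs w / 2 by rewrite cz; apply: le_trans xr _; rewrite ge_min lexx orbT.
  by move: (cabs z) (cabs w) => a b; clear; lra.
rewrite mulrCA [leRHS]mulrC; apply: ler_pM; rewrite ?expR_ge0//.
  by rewrite mulr_ge0 ?invr_ge0 ?cabs_ge0.
by apply: ler_pM; rewrite ?invr_ge0 ?cabs_ge0.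
Qed.

Let M n x := circ (fun z => f z * z^-1 ^+ n) x.

Lemma taylor_coef_const n x x' : x < 0 -> x' < 0 -> M n x = M n x'.
Proof.
wlog xx' : x x' / x <= x' => [H x0 x'0|x0 x'0].
  have [xx'|/ltW x'x] := leP x x'; first exact (H x x' xx' x0 x'0).
  exact (esym (H x' x x'x x'0 x0)).
apply: circ_const => // t y /andP[_ tx]; apply: cdiffableM; last exact: cdiffable_inv_pow.
by apply: hf; apply: polar_in_disc; exact: le_lt_trans tx x'0.
Qed.

(** The logarithmic radius -1 is a convention; [taylor_coef_const] allows any negative one. *)
Definition taylor_coef n : R[i] := (real_complex R (2 * pi))^-1 * M n (-1).

(** Cauchy's estimate on a circle of radius between r and 1. *)
Lemma taylor_coef_subexponential : subexponential taylor_coef.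
Proof.
move=> r /andP[r0 r1].
have [r' [rr' r'1]] : exists r', r < r' /\ r' < 1 by exists ((r + 1) / 2); rewrite !midf_lt.
have r'0 : 0 < r' by exact: le_lt_trans rr'.
have lr' : ln r' < 0 by rewrite ln_lt0// r'0.
have hfc y : 0 <= y <= 2 * pi -> cdiffable f (polar (ln r') y).
  by move=> _; apply: hf; exact: polar_in_disc.
have [B hB] := ccont_bounded (polar_cdiff_cont hfc).
exists (cabs (real_complex R (2 * pi))^-1 * (4 * pi * B)) => n.
rewrite /taylor_coef (@taylor_coef_const n (-1) (ln r'))// ?oppr_lt0// cabsM -mulrA.
rewrite ler_wpM2l ?cabs_ge0//.
apply: le_trans (_ : cabs (M n (ln r')) * r' ^+ n <= _).
  by rewrite ler_wpM2l ?cabs_ge0// lerXn2r ?nnegrE// ltW.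
rewrite -ler_pdivlMr ?exprn_gt0// -(mulrA (4 * pi)) /M /circ; apply: cint_bound.
  apply: (@polar_cdiff_cont _ (fun z => f z * z^-1 ^+ n)) => y hy.
  by apply: cdiffableM (hfc y hy) _; exact: cdiffable_inv_pow.
move=> y hy; rewrite cabsM cabs_inv_polar expRN lnK ?posrE// exprVn.
by rewrite ler_wpM2r ?hB// invr_ge0 exprn_ge0// ltW.
Qed.

Lemma taylor_generic x0 y0 : x0 < 0 -> 0 < y0 < 2 * pi ->
  f (polar x0 y0) = cpseries taylor_coef (polar x0 y0).
Proof.
move=> x00 hy0; pose x2 := x0 / 2.
have x02 : x0 < x2 by rewrite /x2; lra.
have x20 : x2 < 0 by rewrite /x2; lra.
apply/esym/csum_ctends; set w := polar x0 y0.
have h : ctends (fun N => \sum_(n < N) w ^+ n * M n x2) (f w * real_complex R (2 * pi)).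
  rewrite -(cauchy_formula x02 x20 hy0); apply: cauchy_kernel_series => // y _.
  by apply: hf; exact: polar_in_disc.
have := ctendsM (real_complex R (2 * pi))^-1 h.
have c2pi : real_complex R (2 * pi) != 0.
  by rewrite -cabs_gt0 cabsC normr_gt0 gt_eqF// twopi_gt0.
rewrite mulrCA mulVf// mulr1; apply: ctends_ext => N.
rewrite mulr_sumr; apply: eq_bigr => n _.
by rewrite /taylor_coef (@taylor_coef_const n (-1) x2) ?oppr_lt0//; ring.
Qed.

(** Cauchy's formula was obtained off the nonnegative real axis, where the plane is cut. On the axis
    f minus its series is continuous and vanishes at z + i t for small t > 0. *)
Theorem taylor_expansion z : cabs z < 1 -> f z = cpseries taylor_coef z.
Proof.
move=> z1; have [[y [/andP[y0 y2] ez]]|hz] := pselect (exists y, 0 < y < 2 * pi /\ z = polar (ln (cabs z)) y).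
  have z0 : 0 < cabs z by rewrite {1}ez cabs_polar expR_gt0.
  by rewrite ez; apply: taylor_generic; rewrite ?y0// ln_lt0// z0.
have Imz : complex.Im z = 0.
  have [->//|zn0] := eqVneq z 0.
  have [y [/andP[y0 y2] ez]] := polar_arg zn0.
  move: y0; rewrite le_eqVlt => /predU1P[y0|y0]; first by rewrite ez -y0 /= sin0 mulr0.
  by exfalso; apply: hz; exists y; rewrite y0.
pose D w := f w - cpseries taylor_coef w.
have hD : cdiffable D z.
  apply: cdiffableB; first exact: hf.
  by eexists; apply: cpseries_cdiff z1; exact: taylor_coef_subexponential.
apply/eqP; rewrite -subr_eq0 -cabs_eq0 eq_le cabs_ge0 andbT.
apply: (@le_of_eps _ _ _ 1) => // e e0; rewrite add0r mul1r.
have [r r0 hr] := cdiff_continuous hD e0.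
pose t := Num.min r ((1 - cabs z) / 2).
have t0 : 0 < t by rewrite lt_min r0 divr_gt0// subr_gt0.
pose w := z + Complex 0 t.
have ct : cabs (Complex 0 t) = t.
  by rewrite /cabs /= expr0n/= add0r sqrtr_sqr gtr0_norm.
have w1 : cabs w < 1.
  apply: le_lt_trans (cabsD _ _) _; rewrite ct.
  have : t <= (1 - cabs z) / 2 by rewrite ge_min lexx orbT.
  have half (a u : R) : a < 1 -> u <= (1 - a) / 2 -> a + u < 1 by lra.
  exact: half.
have wI : complex.Im w = t by rewrite cImD Imz add0r.
have wn0 : w != 0.
  by apply/eqP => w0; move: wI; rewrite w0 => t00; move: t0; rewrite -t00 ltxx.
have Dw : D w = 0.
  have [y [/andP[y0 y2] ew]] := polar_arg wn0.
  apply/eqP; rewrite subr_eq0 {1}ew {2}ew; apply/eqP; apply: taylor_generic.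
    by rewrite ln_lt0// cabs_gt0 wn0.
  rewrite y2 andbT lt_neqAle y0 andbT; apply/eqP => y00.
  by move: wI; rewrite ew -y00 /= sin0 mulr0 => t00; move: t0; rewrite -t00 ltxx.
have := hr w; rewrite Dw sub0r cabsN; apply.
by rewrite /w addrC addKr ct ge_min lexx.
Qed.

End Analytic.

End TaylorExpansion.
(** * Area integrals of power series *)

Section AffineInvariance.
Variable R : realType.
Local Notation mu := (@lebesgue_measure R).
Local Open Scope ereal_scope.

(** The image of Lebesgue measure under x -> a x + b, scaled by a, agrees with it on half-open
    intervals, hence everywhere by uniqueness. *)
Lemma lebesgue_affine (a b : R) (f : R -> \bar R) : (0 < a)%R ->
  measurable_fun setT f -> (forall x, 0 <= f x) ->
  \int[mu]_x f x = a%:E * \int[mu]_x f (a * x + b)%R.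
Proof.
move=> a0 mf f0.
pose phi (x : measurableTypeR R) : measurableTypeR R := (a * x + b)%R.
have mphi : measurable_fun setT phi.
  apply: measurable_funD; last exact: measurable_cst.
  by apply: measurable_funM; [exact: measurable_cst|exact: measurable_id].
pose pm : {measure set (measurableTypeR R) -> \bar R} :=
  measure_function_pushforward__canonical__measure_function_Measure mu mphi.
pose m := mscale (NngNum (ltW a0)) pm.
have eqm A : measurable A -> mu A = m A.
  move=> mA; apply: lebesgue_measure_unique mA => X [[l r] _ <-].
  rewrite [RHS](_ : _ = a%:E * mu (phi @^-1` `]l, r]%classic))//.
  have -> : phi @^-1` `]l, r]%classic = `](l - b) / a, (r - b) / a]%classic%R.
    apply/seteqP; split => x /=; rewrite !in_itv/= /phi => /andP[h1 h2].
      rewrite ltr_pdivrMr// ler_pdivlMr// ltrBlDr lerBrDr.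
      by rewrite ![(x * a)%R]mulrC h1 h2.
    move: h1 h2; rewrite ltr_pdivrMr// ler_pdivlMr// ltrBlDr lerBrDr.
    by rewrite ![(x * a)%R]mulrC => -> ->.
  rewrite !lebesgue_measure_itv/= !lte_fin ltr_pM2r ?invr_gt0// ltrD2r.
  case: ifPn => _; last by rewrite mule0.
  rewrite -!EFinB -EFinM; congr (_%:E).
  by field; rewrite gt_eqF.
rewrite (eq_measure_integral m); last by move=> A mA _; exact: eqm.
rewrite ge0_integral_mscale//.
congr (_ * _).
apply: etrans (ge0_integral_pushforward mphi mu measurableT mf _) _ => //.
Qed.

Lemma lebesgue_translate (b : R) (f : R -> \bar R) :
  measurable_fun setT f -> (forall x, 0 <= f x) ->
  \int[mu]_x f x = \int[mu]_x f (x + b)%R.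
Proof.
move=> mf f0; rewrite (lebesgue_affine b ltr01 mf f0) mul1e.
by apply: eq_integral => x _; rewrite mul1r.
Qed.

Notation plane := (measurableTypeR R * measurableTypeR R)%type.
Local Notation mu2 := (@lebesgue_measure R \x @lebesgue_measure R).

Lemma measurable_plane_lin (a b : R) :
  measurable_fun setT (fun p : plane => (a * p.1 + b * p.2)%R).
Proof.
apply: measurable_funD; apply: measurable_funM; try exact: measurable_cst.
  exact: measurable_fst.
exact: measurable_snd.
Qed.

Lemma measurable_plane_map (a b c d : R) :
  measurable_fun setT (fun p : plane => (a * p.1 + b * p.2, c * p.1 + d * p.2)%R : plane).
Proof.
by apply/measurable_fun_pairP; split; exact: measurable_plane_lin.
Qed.

(** By Tonelli, a shear acts as a translation on each horizontal line. *)
Lemma shear_x (s : R) (f : plane -> \bar R) :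
  measurable_fun setT f -> (forall p, 0 <= f p) ->
  \int[mu2]_p f p = \int[mu2]_p f (p.1 + s * p.2, p.2)%R.
Proof.
move=> mf f0; rewrite fubini_tonelli2// fubini_tonelli2//; last first.
  apply: (measurableT_comp mf).
  have := measurable_plane_map 1 s 0 1.
  by under eq_fun do rewrite !mul1r mul0r add0r.
apply: eq_integral => y _; rewrite /fubini_G /=.
rewrite [RHS](_ : _ = \int[mu]_x (fun x => f (x, y)) (x + s * y)%R)//.
apply: lebesgue_translate => //.
exact: measurableT_comp mf (measurable_pair2 y).
Qed.

Lemma shear_y (s : R) (f : plane -> \bar R) :
  measurable_fun setT f -> (forall p, 0 <= f p) ->
  \int[mu2]_p f p = \int[mu2]_p f (p.1, p.2 + s * p.1)%R.
Proof.
move=> mf f0; rewrite fubini_tonelli1// fubini_tonelli1//; last first.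
  apply: (measurableT_comp mf).
  have := measurable_plane_map 1 0 s 1.
  by under eq_fun do rewrite !mul1r mul0r addr0 addrC.
apply: eq_integral => x _; rewrite /fubini_F /=.
rewrite [RHS](_ : _ = \int[mu]_y (fun y => f (x, y)) (y + s * x)%R)//.
apply: lebesgue_translate => //.
exact: measurableT_comp mf (measurable_pair1 x).
Qed.

Lemma dilation (a : R) (f : plane -> \bar R) : (0 < a)%R ->
  measurable_fun setT f -> (forall p, 0 <= f p) ->
  \int[mu2]_p f p = (a ^+ 2)%:E * \int[mu2]_p f (a * p.1, a * p.2)%R.
Proof.
move=> a0 mf f0.
have mf' : measurable_fun setT (fun p : plane => f (a * p.1, p.2)%R).
  apply: (measurableT_comp mf).
  have := measurable_plane_map a 0 0 1.
  by under eq_fun do rewrite !mul1r !mul0r addr0 add0r.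
have mf'' : measurable_fun setT (fun p : plane => f (a * p.1, a * p.2)%R).
  apply: (measurableT_comp mf).
  have := measurable_plane_map a 0 0 a.
  by under eq_fun do rewrite !mul0r addr0 add0r.
transitivity (a%:E * \int[mu2]_p f (a * p.1, p.2)%R).
  rewrite fubini_tonelli2// fubini_tonelli2// -ge0_integralZl//; first last.
  - exact: ltW.
  - by move=> y _; apply: integral_ge0.
  - exact: (measurable_fun_fubini_tonelli_G _ mf').
  apply: eq_integral => y _; rewrite /fubini_G /=.
  rewrite (@lebesgue_affine a 0 (fun x => f (x, y)))//; last first.
    exact: measurableT_comp mf (measurable_pair2 y).
  by congr (_ * _); apply: eq_integral => x _; rewrite addr0.
rewrite expr2 EFinM -muleA; congr (_ * _).
rewrite fubini_tonelli1// fubini_tonelli1// -ge0_integralZl//; first last.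
- exact: ltW.
- by move=> x _; apply: integral_ge0.
- exact: (measurable_fun_fubini_tonelli_F _ mf'').
apply: eq_integral => x _; rewrite /fubini_F /=.
rewrite (@lebesgue_affine a 0 (fun y => f (a * x, y)%R))//; last first.
  exact: measurableT_comp mf (measurable_pair1 (a * x)%R).
by congr (_ * _); apply: eq_integral => y _; rewrite addr0.
Qed.

(* A rotation by an angle other than pi is a product of three shears. *)
Lemma rotation (c s : R) (f : plane -> \bar R) : (c ^+ 2 + s ^+ 2 = 1)%R -> c != (-1)%R ->
  measurable_fun setT f -> (forall p, 0 <= f p) ->
  \int[mu2]_p f p = \int[mu2]_p f (c * p.1 - s * p.2, s * p.1 + c * p.2)%R.
Proof.
(* For the rotation by theta, t = - tan (theta / 2); the shears by t, s, t compose to it. *)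
move=> cs c1 mf f0; pose t := (- s / (1 + c))%R.
have c10 : (1 + c)%R != 0%R by rewrite addrC addr_eq0.
rewrite (shear_x t)// (shear_y s)//; last first.
  apply: (measurableT_comp mf); have := measurable_plane_map 1 t 0 1.
  by under eq_fun do rewrite !mul1r mul0r add0r.
rewrite (shear_x t)//; last first.
  apply: (measurableT_comp mf).
  have := measurable_plane_map (1 + t * s) t s 1.
  under eq_fun do rewrite !mul1r.
  set g1 := fun _ => _; set g2 := fun _ => _; suff -> : g1 = g2 by [].
  by apply/funext => p; rewrite /g1 /g2 /=; congr pair; ring.
apply: eq_integral => p _ /=; congr (f (_, _)).
- have e : (t * (1 + c) = - s)%R by rewrite /t divfK.
  have e2 : (1 + t * s = c)%R.
    have : ((1 + t * s) * (1 + c) = c * (1 + c))%R.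
      by rewrite mulrDl mulrAC e mul1r; move: cs; rewrite !expr2 => cs; rewrite -[X in (X + _ + _)%R]cs; ring.
    by move/(mulIf c10).
  have -> : (p.1 + t * p.2 + t * (p.2 + s * (p.1 + t * p.2)) = (1 + t * s) * p.1 + (t * (1 + (1 + t * s))) * p.2)%R by ring.
  by rewrite e2 e mulNr.
- have e : (1 + t * s = c)%R.
    have e : (t * (1 + c) = - s)%R by rewrite /t divfK.
    have : ((1 + t * s) * (1 + c) = c * (1 + c))%R.
      by rewrite mulrDl mulrAC e mul1r; move: cs; rewrite !expr2 => cs; rewrite -[X in (X + _ + _)%R]cs; ring.
    by move/(mulIf c10).
  by rewrite -e; ring.
Qed.

End AffineInvariance.

(** * Plane integrals and averages over rotations *)

Section PlaneIntegrals.
Variable R : realType.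
Local Notation plane := (measurableTypeR R * measurableTypeR R)%type.
Local Notation mu2 := (@lebesgue_measure R \x @lebesgue_measure R)%E.
Implicit Types (h : R[i] -> R) (F G : R[i] -> R[i]) (z w : R[i]) (r : R).

Definition cpt (p : plane) : R[i] := Complex p.1 p.2.

Definition plane_measurable h := measurable_fun [set: plane] (fun p => h (cpt p)).

Definition plane_int h : \bar R := (\int[mu2]_p (h (cpt p))%:E)%E.

Definition disc_ind r z : R := (cabs z < r)%R%:R.

Lemma disc_ind_ge0 r z : 0 <= disc_ind r z.
Proof. exact: ler0n. Qed.

Lemma plane_measurable_disc r : plane_measurable (disc_ind r).
Proof.
have [r0|r0] := ltP 0 r; last first.
  rewrite (_ : disc_ind r = fun=> 0); first exact: measurable_cst.
  by apply/funext => z; rewrite /disc_ind ltNge (le_trans r0) ?cabs_ge0.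
have mA : measurable [set p : plane | p.1 ^+ 2 + p.2 ^+ 2 < r ^+ 2].
  have mf : measurable_fun [set: plane] (fun p : plane => p.1 ^+ 2 + p.2 ^+ 2).
    by apply: measurable_funD; apply: measurable_funX; [exact: measurable_fst|exact: measurable_snd].
  have := mf measurableT `]-oo, (r ^+ 2)[%classic (measurable_itv _).
  rewrite setTI; set A := _ @^-1` _; set B := [set _ | _].
  suff -> : B = A by [].
  by apply/seteqP; split => p; rewrite /A /B /= in_itv.
rewrite /plane_measurable.
rewrite (_ : (fun p => _) = \1_[set p : plane | p.1 ^+ 2 + p.2 ^+ 2 < r ^+ 2]).
  exact: measurable_indic.
apply/funext => p; rewrite indicE /disc_ind; congr (nat_of_bool _)%:R.
have -> : (cabs (cpt p) < r) = (cabs (cpt p) ^+ 2 < r ^+ 2).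
  by rewrite ltr_pXn2r// nnegrE ?cabs_ge0// ltW.
by rewrite cabs_sqr; apply/idP/idP => [h|/set_mem//]; exact/mem_set.
Qed.

Definition cmeasurable F := plane_measurable (fun z => complex.Re (F z)) /\
  plane_measurable (fun z => complex.Im (F z)).

Lemma cmeasurable_cst c : cmeasurable (fun=> c).
Proof. by split; exact: measurable_cst. Qed.

Lemma cmeasurable_id : cmeasurable id.
Proof. by split; [exact: measurable_fst|exact: measurable_snd]. Qed.

Lemma cmeasurableD F G : cmeasurable F -> cmeasurable G -> cmeasurable (fun z => F z + G z).
Proof.
move=> [f1 f2] [g1 g2]; split; rewrite /plane_measurable.
  by under eq_fun do rewrite cReD; exact: measurable_funD.
by under eq_fun do rewrite cImD; exact: measurable_funD.
Qed.

Lemma cmeasurableM F G : cmeasurable F -> cmeasurable G -> cmeasurable (fun z => F z * G z).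
Proof.
move=> [f1 f2] [g1 g2]; split; rewrite /plane_measurable.
  by under eq_fun do rewrite cReM; apply: measurable_funB; exact: measurable_funM.
by under eq_fun do rewrite cImM; apply: measurable_funD; exact: measurable_funM.
Qed.

Lemma cmeasurableX F n : cmeasurable F -> cmeasurable (fun z => F z ^+ n).
Proof.
move=> hF; elim: n => [|n IHn].
  by under eq_fun do rewrite expr0; exact: cmeasurable_cst.
by under eq_fun do rewrite exprS; exact: cmeasurableM.
Qed.

Lemma cmeasurable_sum (I : Type) (s : seq I) (F : I -> R[i] -> R[i]) :
  (forall i, cmeasurable (F i)) -> cmeasurable (fun z => \sum_(i <- s) F i z).
Proof.
move=> h; elim: s => [|i s IHs].
  by under eq_fun do rewrite big_nil; exact: cmeasurable_cst.
by under eq_fun do rewrite big_cons; exact: cmeasurableD.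
Qed.

Lemma plane_measurable_sqr F : cmeasurable F -> plane_measurable (fun z => cabs (F z) ^+ 2).
Proof.
move=> [f1 f2]; rewrite /plane_measurable; under eq_fun do rewrite cabs_sqr.
by apply: measurable_funD; apply: measurable_funX.
Qed.

Lemma plane_measurableM h1 h2 : plane_measurable h1 -> plane_measurable h2 ->
  plane_measurable (fun z => h1 z * h2 z).
Proof. by move=> m1 m2; exact: measurable_funM. Qed.

Lemma plane_measurableD h1 h2 : plane_measurable h1 -> plane_measurable h2 ->
  plane_measurable (fun z => h1 z + h2 z).
Proof. by move=> m1 m2; exact: measurable_funD. Qed.

Lemma plane_measurable_cst (k : R) : plane_measurable (fun=> k).
Proof. exact: measurable_cst. Qed.

Lemma plane_measurable_cabsX n : plane_measurable (fun z => cabs z ^+ n.*2).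
Proof.
have := plane_measurable_sqr (cmeasurableX n cmeasurable_id).
by congr plane_measurable; apply/funext => z; rewrite cabsX -exprM muln2.
Qed.

Lemma eq_plane_int h1 h2 : h1 =1 h2 -> plane_int h1 = plane_int h2.
Proof. by move=> /funext ->. Qed.

Lemma plane_int_le h1 h2 : plane_measurable h1 -> plane_measurable h2 ->
  (forall z, 0 <= h1 z <= h2 z) -> (plane_int h1 <= plane_int h2)%E.
Proof.
move=> m1 m2 h; apply: ge0_le_integral => //.
- by move=> p _; rewrite lee_fin; case/andP: (h (cpt p)).
- exact/measurable_EFinP.
- exact/measurable_EFinP.
- by move=> p _; rewrite lee_fin; case/andP: (h (cpt p)).
Qed.

Lemma plane_intD h1 h2 : plane_measurable h1 -> plane_measurable h2 ->
  (forall z, 0 <= h1 z) -> (forall z, 0 <= h2 z) ->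
  (plane_int (fun z => h1 z + h2 z)%R = plane_int h1 + plane_int h2)%E.
Proof.
move=> m1 m2 p1 p2; rewrite /plane_int -ge0_integralD//.
- by move=> p _; rewrite lee_fin.
- exact/measurable_EFinP.
- by move=> p _; rewrite lee_fin.
- exact/measurable_EFinP.
Qed.

Lemma plane_intZ (k : R) h : 0 <= k -> plane_measurable h -> (forall z, 0 <= h z) ->
  (plane_int (fun z => k * h z)%R = k%:E * plane_int h)%E.
Proof.
move=> k0 m p; rewrite /plane_int -ge0_integralZl_EFin//.
- by move=> x _; rewrite lee_fin.
- exact/measurable_EFinP.
Qed.

Lemma plane_int_sum (I : Type) (s : seq I) (h : I -> R[i] -> R) :
  (forall i, plane_measurable (h i)) -> (forall i z, 0 <= h i z) ->
  plane_int (fun z => \sum_(i <- s) h i z)%R = (\sum_(i <- s) plane_int (h i))%E.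
Proof.
move=> m p; rewrite /plane_int -ge0_integral_sum//.
- by congr (integral _ _ _); apply/funext => x; rewrite -sumEFin.
- by move=> i; apply/measurable_EFinP; exact: m.
- by move=> i x _; rewrite lee_fin.
Qed.

Lemma plane_measurable_rot h (w : R[i]) : plane_measurable h ->
  plane_measurable (fun z => h (w * z)).
Proof.
move=> mh; rewrite /plane_measurable.
have := measurableT_comp mh (measurable_plane_map (complex.Re w) (- complex.Im w) (complex.Im w) (complex.Re w)).
congr (measurable_fun _ _); apply/funext => p; congr h; case: w => a b /=.
by apply/eqP; rewrite eq_complex /=; apply/andP; split; apply/eqP; ring.
Qed.

Lemma plane_int_rot h (w : R[i]) : cabs w = 1 -> w != -1 -> plane_measurable h ->
  (forall z, 0 <= h z) -> plane_int h = plane_int (fun z => h (w * z)).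
Proof.
move=> w1 wN1 mh h0; rewrite /plane_int.
have e1 : complex.Re w ^+ 2 + complex.Im w ^+ 2 = 1 by rewrite -cabs_sqr w1 expr1n.
have c1 : complex.Re w != -1.
  apply/eqP => rw; move: e1; rewrite rw sqrrN expr1n => e1.
  have /eqP : complex.Im w ^+ 2 = 0 by lra.
  rewrite sqrf_eq0 => /eqP iw; move/eqP: wN1; apply; apply/eqP.
  by rewrite eq_complex rw iw /= oppr0 !eqxx.
rewrite (rotation e1 c1); last 2 first.
- exact/measurable_EFinP.
- by move=> p; rewrite lee_fin.
apply: eq_integral => p _; congr (h _)%:E; case: w {w1 wN1 e1 c1} => a b.
by apply/eqP; rewrite eq_complex /=; apply/andP; split; apply/eqP; ring.
Qed.

(** Powers are reached by iteration, since w ^+ j may be the excluded rotation -1 even when w is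
    not. *)
Lemma plane_int_rotX h (w : R[i]) j : cabs w = 1 -> w != -1 -> plane_measurable h ->
  (forall z, 0 <= h z) -> plane_int h = plane_int (fun z => h (w ^+ j * z)).
Proof.
move=> w1 wN1 mh h0; elim: j => [|j IHj].
  by apply: eq_plane_int => z; rewrite expr0 mul1r.
rewrite IHj (plane_int_rot w1 wN1)//; last exact: plane_measurable_rot.
by apply: eq_plane_int => z; rewrite exprSr mulrA.
Qed.

Lemma plane_int_dil h r : 0 < r -> plane_measurable h -> (forall z, 0 <= h z) ->
  plane_int h = ((r ^+ 2)%:E * plane_int (fun z => h (real_complex R r * z)%R))%E.
Proof.
move=> r0 mh h0; rewrite /plane_int (dilation r0); last 2 first.
- exact/measurable_EFinP.
- by move=> p; rewrite lee_fin.
congr (_ * _)%E; apply: eq_integral => p _; congr (h _)%:E.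
by apply/eqP; rewrite eq_complex /=; apply/andP; split; apply/eqP; ring.
Qed.

Section RootsOfUnity.
Variable N : nat.
Hypothesis N3 : (3 <= N)%N.
Let om : R[i] := circle_point 1 (2 * pi / N%:R).

Lemma circle_pointX t n : circle_point (1 : R) t ^+ n = circle_point 1 (n%:R * t).
Proof.
elim: n => [|n IHn].
  by rewrite expr0 mul0r /circle_point cos0 sin0 mulr1 mulr0.
have -> : n.+1%:R * t = t + n%:R * t by rewrite mulrS mulrDl mul1r.
rewrite exprS IHn /circle_point cosD sinD.
by apply/eqP; rewrite eq_complex/=; apply/andP; split; apply/eqP; ring.
Qed.

Let N0 : 0 < N%:R :> R.
Proof. by rewrite ltr0n; apply: leq_trans N3. Qed.

Lemma cabs_root : cabs om = 1.
Proof. exact: cabs_circle_point. Qed.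

Lemma root_expN : om ^+ N = 1.
Proof.
rewrite /om circle_pointX mulrC divfK ?gt_eqF// /circle_point mulr_natl cos2pi sin2pi.
by rewrite mulr1 mulr0.
Qed.

Lemma root_exp_neq1 k : (0 < k < N)%N -> om ^+ k != 1.
Proof.
move=> /andP[k0 kN]; apply/eqP; rewrite /om circle_pointX => /(congr1 (@complex.Re R)).
rewrite /= mul1r => /cos_eq1_small h.
have k0' : 0 < k%:R :> R by rewrite ltr0n.
have tp : 0 < k%:R * (2 * pi / N%:R) :> R.
  by apply: mulr_gt0 => //; apply: divr_gt0 => //; exact: twopi_gt0.
have : k%:R * (2 * pi / N%:R) = 0 :> R.
  apply: h; rewrite gtr0_norm// mulrCA -[ltRHS]mulr1 ltr_pM2l ?twopi_gt0//.
  by rewrite ltr_pdivrMr// mul1r ltr_nat.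
by move=> e; rewrite e ltxx in tp.
Qed.

(** The bound 3 <= N enters here: for N = 2 the root is -1. *)
Lemma root_neqN1 : om != -1.
Proof.
apply/eqP => e; have := @root_exp_neq1 2%N N3.
by rewrite e sqrrN expr1n eqxx.
Qed.

Lemma root_conj : conjc om = om^-1.
Proof.
have o0 : om != 0 by rewrite -cabs_gt0 cabs_root.
apply: (mulfI o0); rewrite mulfV// mulc_conj cabs_root expr1n.
by [].
Qed.

(** A full geometric sum over a nontrivial N-th root of unity. *)
Lemma root_sum_diff n m : (n < N)%N -> (m < N)%N -> n != m ->
  \sum_(j < N) (om ^+ n * conjc om ^+ m) ^+ j = 0.
Proof.
move=> nN mN nm; set q := _ * _.
have o0 : om != 0 by rewrite -cabs_gt0 cabs_root.
have q1 : q != 1.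
  rewrite /q root_conj exprVn; apply/eqP => /divr1_eq e.
  wlog lt : n m nN mN nm {q} e / (n < m)%N.
    move=> H; have [] := ltngtP n m; [exact: H|move=> mn; apply: (H m n) => //|].
      by rewrite eq_sym.
    by move=> e'; rewrite e' eqxx in nm.
  have /eqP : om ^+ (m - n) = 1.
    by apply: (mulfI (expf_neq0 n o0)); rewrite -exprD subnKC ?(ltnW lt)// mulr1 e.
  apply/negP; apply: root_exp_neq1; rewrite subn_gt0 lt /=.
  by apply: leq_ltn_trans (leq_subr _ _) mN.
have qN : q ^+ N = 1.
  by rewrite /q exprMn -!exprM ![(_ * N)%N]mulnC !exprM -rmorphXn root_expN rmorph1 !expr1n mulr1.
have := subrX1 q N; rewrite qN subrr => /esym/eqP.
by rewrite mulf_eq0 subr_eq0 (negbTE q1) /= => /eqP.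
Qed.

Lemma discrete_parseval (c : nat -> R[i]) K : (K <= N)%N ->
  \sum_(j < N) cabs (\sum_(n < K) c n * om ^+ (j * n)) ^+ 2 =
  N%:R * \sum_(n < K) cabs (c n) ^+ 2.
Proof.
have conjE (I : finType) (F : I -> R[i]) :
    real_complex R (\sum_i cabs (F i) ^+ 2) = \sum_i F i * conjc (F i).
  by rewrite rmorph_sum; apply: eq_bigr => i _; rewrite mulc_conj.
move=> KN; apply: complexI.
have -> : real_complex R (N%:R * \sum_(n < K) cabs (c n) ^+ 2) =
    \sum_(n < K) N%:R * (c n * conjc (c n)).
  by rewrite -mulr_sumr -conjE -(rmorph_nat (real_complex R)) -rmorphM.
rewrite conjE.
under eq_bigr do rewrite rmorph_sum mulr_suml.
rewrite exchange_big /=; apply: eq_bigr => n _.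
under eq_bigr do rewrite mulr_sumr.
rewrite exchange_big /= (bigD1 n)//= [X in _ + X]big1 ?addr0 => [|m mn].
  transitivity (\sum_(i < N) c n * conjc (c n)).
    apply: eq_bigr => i _; rewrite rmorphM mulrACA; set x := om ^+ _.
    have -> : x * conjc x = 1; last by rewrite mulr1.
    by rewrite mulc_conj /x cabsX cabs_root !expr1n.
  by rewrite sumr_const card_ord mulr_natl.
transitivity (c n * conjc (c m) * \sum_(j < N) (om ^+ n * conjc om ^+ m) ^+ j).
  rewrite mulr_sumr; apply: eq_bigr => j _.
  rewrite rmorphM rmorphXn exprMn -!exprM ![(j * _)%N]mulnC; ring.
rewrite root_sum_diff ?mulr0//; first exact: leq_trans KN.
- exact: leq_trans KN.
- by rewrite eq_sym.
Qed.

(* Averaging over rotations by the N-th roots of unity kills the cross terms. *)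
Lemma plane_int_poly r (b : nat -> R[i]) K : (K <= N)%N ->
  plane_int (fun z => disc_ind r z * cabs (\sum_(n < K) b n * z ^+ n) ^+ 2) =
  (\sum_(n < K) (cabs (b n) ^+ 2)%:E * plane_int (fun z => disc_ind r z * cabs z ^+ n.*2)%R)%E.
Proof.
move=> KN; set h := fun z => _ * _.
have mh : plane_measurable h.
  apply: plane_measurableM; first exact: plane_measurable_disc.
  apply: plane_measurable_sqr; apply: cmeasurable_sum => n.
  by apply: cmeasurableM (cmeasurable_cst _) _; apply: cmeasurableX; exact: cmeasurable_id.
have h0 z : 0 <= h z by rewrite mulr_ge0 ?disc_ind_ge0 ?sqr_ge0.
have avg : plane_int h = plane_int (fun z => N%:R^-1 * \sum_(j < N) h (om ^+ j * z)).
  rewrite plane_intZ ?invr_ge0//; last 2 first.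
  - by apply: measurable_sum => j; exact: plane_measurable_rot.
  - by move=> z; apply: sumr_ge0.
  rewrite plane_int_sum//; last by move=> j; exact: plane_measurable_rot.
  under eq_bigr do rewrite -(plane_int_rotX _ cabs_root root_neqN1 mh h0).
  have sc k (x : \bar R) : (0 <= x)%E -> (\sum_(i < k) x = k%:R%:E * x)%E.
    move=> x0; elim: k => [|k IHk]; first by rewrite big_ord0 mul0e.
    by rewrite big_ord_recr /= IHk -[X in (_ + X)%E]mul1e -ge0_muleDl ?lee_fin// -EFinD -mulrSr.
  rewrite sc; last by apply: integral_ge0 => p _; rewrite lee_fin.
  by rewrite muleA -EFinM mulVf ?mul1e// gt_eqF.
have mI n : plane_measurable (fun z => disc_ind r z * cabs z ^+ n.*2).
  by apply: plane_measurableM; [exact: plane_measurable_disc|exact: plane_measurable_cabsX].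
have I0 n z : 0 <= disc_ind r z * cabs z ^+ n.*2.
  by rewrite mulr_ge0 ?disc_ind_ge0// exprn_ge0// cabs_ge0.
rewrite avg; transitivity (plane_int (fun z => \sum_(n < K) cabs (b n) ^+ 2 * (disc_ind r z * cabs z ^+ n.*2))).
  apply: eq_plane_int => z.
  have -> : \sum_(j < N) h (om ^+ j * z) =
      disc_ind r z * \sum_(j < N) cabs (\sum_(n < K) (b n * z ^+ n) * om ^+ (j * n)) ^+ 2.
    rewrite mulr_sumr; apply: eq_bigr => j _; rewrite /h /disc_ind cabsM cabsX cabs_root.
    rewrite expr1n mul1r; congr (_ * cabs _ ^+ 2); apply: eq_bigr => n _.
    by rewrite exprMn exprM; ring.
  rewrite (discrete_parseval (fun n => b n * z ^+ n) KN) mulrCA (mulrA N%:R^-1) mulVf ?gt_eqF// mul1r mulr_sumr.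
  by apply: eq_bigr => n _; rewrite cabsM cabsX exprMn -exprM muln2; ring.
rewrite plane_int_sum.
- by apply: eq_bigr => n _; rewrite plane_intZ// sqr_ge0.
- by move=> n; apply: plane_measurableM => //; exact: plane_measurable_cst.
- by move=> n z; rewrite mulr_ge0// sqr_ge0.
Qed.

End RootsOfUnity.
End PlaneIntegrals.

(** * Fatou's lemma for uniform bounds, and the moments of the disc *)

Lemma integral_le_of_limit d (T : measurableType d) (R : realType)
    (mu : {measure set T -> \bar R}) (D : set T) (fn : nat -> T -> R) (f : T -> R) (U : \bar R) :
  measurable D -> (forall n, measurable_fun D (fn n)) -> (forall n x, D x -> 0 <= fn n x) ->
  (forall x, D x -> fn ^~ x @ \oo --> f x) ->
  (forall n, \int[mu]_(x in D) (fn n x)%:E <= U)%E ->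
  (\int[mu]_(x in D) (f x)%:E <= U)%E.
Proof.
move=> mD mf f0 fl hU.
have e : (\int[mu]_(x in D) (f x)%:E = \int[mu]_(x in D) limn_einf (fun n => (fn n x)%:E))%E.
  apply: eq_integral => x; rewrite inE => Dx.
  have h : (fun n => (fn n x)%:E) @ \oo --> (f x)%:E by apply/cvg_EFin; [near=> n|exact: fl].
  rewrite is_cvg_limn_einfE; last by apply/cvg_ex; exists (f x)%:E.
  by apply/esym/cvg_lim.
rewrite e; apply: le_trans (fatou mu mD _ _) _.
- by move=> n; apply/measurable_EFinP; exact: mf.
- by move=> n x Dx; rewrite lee_fin; exact: f0.
rewrite limn_einf_lim; apply: lime_le; first exact: is_cvg_einfs.
apply: nearW => n; apply: le_trans _ (hU n).
by apply: ereal_inf_lbound; exists n => /=.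
Unshelve. all: by end_near.
Qed.

Section DiscMoments.
Variable R : realType.
Implicit Types (z w : R[i]) (r x y : R).
Local Notation plane := (measurableTypeR R * measurableTypeR R)%type.
Local Notation mu2 := (@lebesgue_measure R \x @lebesgue_measure R)%E.

(** The limit r -> 1, made explicit by Bernoulli's inequality r^n >= 1 - n (1 - r). *)
Lemma pow_limit (n : nat) x y : 0 <= x -> (forall r, 0 < r < 1 -> x * r ^+ n <= y) -> x <= y.
Proof.
move=> x0 h; have bern r : 0 <= r <= 1 -> 1 - n%:R * (1 - r) <= r ^+ n.
  move=> /andP[r0 r1]; elim: n {h} => [|m IHm]; first by rewrite mul0r subr0 expr0.
  rewrite exprS; apply: le_trans (ler_wpM2l r0 IHm).
  rewrite -subr_ge0 mulrSr; have -> : r * (1 - m%:R * (1 - r)) - (1 - (m%:R + 1) * (1 - r)) =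
    m%:R * (1 - r) ^+ 2 by ring.
  by rewrite mulr_ge0// sqr_ge0.
apply: (@le_of_eps _ _ _ (n%:R * x)); first by rewrite mulr_ge0.
move=> e e0; pose e1 := Num.min e 2^-1.
have e10 : 0 < e1 by rewrite lt_min e0 invr_gt0 ltr0n.
have e12 : e1 <= 2^-1 by rewrite ge_min lexx orbT.
have e11 : e1 < 1 by apply: le_lt_trans e12 _; rewrite invf_lt1 ?ltr1n.
have r01 : 0 < 1 - e1 < 1 by rewrite subr_gt0 e11 gtrBl.
have := h _ r01; have /bern : 0 <= 1 - e1 <= 1 by case/andP: r01 => /ltW -> /ltW ->.
rewrite opprB addrCA subrr addr0 => hb hx.
have := le_trans (ler_wpM2l x0 hb) hx; rewrite mulrBr mulr1 lerBlDr => k.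
apply: le_trans k _; rewrite lerD2l mulrCA [leRHS]mulrAC -mulrA ler_wpM2l//.
by rewrite mulrC ler_wpM2r// ge_min lexx.
Qed.

(** The squares of half-side 1 and 1/2 enclose the disc from outside and from inside, which makes
    its area finite and positive. *)
Definition rect_ind r z : R := ((- r < complex.Re z < r) && (- r < complex.Im z < r))%:R.

Lemma rect_set r : (fun p : plane => (rect_ind r (cpt p))%:E) =
  EFin \o \1_(`]-r, r[%classic `*` `]-r, r[%classic : set plane).
Proof.
apply/funext => p; rewrite /= indicE /rect_ind; congr (_%:R)%:E; congr nat_of_bool.
apply/idP/idP => [/andP[h1 h2]|/set_mem[]].
  by apply/mem_set; split; rewrite /= in_itv.
by rewrite /= !in_itv/= => -> ->.
Qed.

Lemma plane_int_rect r : 0 < r -> plane_int (rect_ind r) = ((2 * r) ^+ 2)%:E.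
Proof.
move=> r0; rewrite /plane_int rect_set integral_indic ?setIT//; last first.
  exact: measurableX.
apply: etrans (@product_measure1E _ _ _ _ R (@lebesgue_measure R) (@lebesgue_measure R) _ _ (measurable_itv _) (measurable_itv _)) _.
rewrite /= !lebesgue_measure_itv/= lte_fin gtrN// -EFinB -EFinM.
by congr (_%:E); ring.
Qed.

Lemma plane_measurable_rect r : plane_measurable (rect_ind r).
Proof.
rewrite /plane_measurable; apply/measurable_EFinP.
rewrite [X in measurable_fun _ X](_ : _ = (fun p : plane => (rect_ind r (cpt p))%:E))//.
rewrite rect_set; apply/measurable_EFinP; apply: measurable_indic; exact: measurableX.
Qed.

Definition moment n r : \bar R := plane_int (fun z => disc_ind r z * cabs z ^+ n.*2).

Lemma plane_measurable_moment n r :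
  plane_measurable (fun z : R[i] => disc_ind r z * cabs z ^+ n.*2).
Proof.
by apply: plane_measurableM; [exact: plane_measurable_disc|exact: plane_measurable_cabsX].
Qed.

Lemma moment_ge0 n r z : 0 <= disc_ind r z * cabs z ^+ n.*2.
Proof. by rewrite mulr_ge0 ?disc_ind_ge0// exprn_ge0// cabs_ge0. Qed.

Lemma moment0 r : moment 0 r = plane_int (disc_ind r).
Proof. by apply: eq_plane_int => z; rewrite expr0 mulr1. Qed.

(** Kept as an unevaluated positive constant; its ratio to pi ends up in [norm_const]. *)
Definition disc_area : R := fine (plane_int (@disc_ind R 1)).

Lemma disc_areaE : plane_int (@disc_ind R 1) = disc_area%:E.
Proof.
rewrite /disc_area fineK// ge0_fin_numE; last by apply: integral_ge0 => p _; rewrite lee_fin.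
apply: le_lt_trans (_ : (plane_int (rect_ind 1) < +oo)%E); last by rewrite plane_int_rect// ltry.
apply: plane_int_le; [exact: plane_measurable_disc|exact: plane_measurable_rect|].
move=> z; rewrite disc_ind_ge0 /disc_ind /rect_ind; case: ltP => z1; last exact: ler0n.
rewrite -!ltr_norml.
by rewrite (le_lt_trans (normRe_le _) z1) (le_lt_trans (normIm_le _) z1) lexx.
Qed.

Lemma disc_area_gt0 : 0 < disc_area.
Proof.
rewrite -lte_fin -disc_areaE; apply: lt_le_trans (_ : (plane_int (rect_ind 2^-1) <= _)%E).
  by rewrite plane_int_rect ?invr_gt0// lte_fin mulfV// expr1n.
apply: plane_int_le; [exact: plane_measurable_rect|exact: plane_measurable_disc|].
move=> z; rewrite /rect_ind /disc_ind ler0n -!ltr_norml.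
have [/andP[h1 h2]|_] := boolP ((`|complex.Re z| < 2^-1) && (`|complex.Im z| < 2^-1)); last exact: ler0n.
suff -> : cabs z < 1 by exact: lexx.
apply: le_lt_trans (cabs_leD _) _; apply: lt_le_trans (ltrD h1 h2) _.
by rewrite [leRHS](splitr 1) mul1r.
Qed.

Lemma moment_dil n r : 0 < r -> moment n r = ((r ^+ n.*2.+2)%:E * moment n 1)%E.
Proof.
move=> r0; rewrite /moment (plane_int_dil r0); last 2 first.
- exact: plane_measurable_moment.
- by move=> z; exact: moment_ge0.
rewrite [X in (_ * X)%E](_ : _ = plane_int (fun z => r ^+ n.*2 * (disc_ind 1 z * cabs z ^+ n.*2))).
  rewrite plane_intZ ?exprn_ge0 ?(ltW r0)//; [|exact: plane_measurable_moment|exact: moment_ge0].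
  by rewrite muleA -EFinM -exprD.
apply: eq_plane_int => z; rewrite cabsM cabsC (gtr0_norm r0) exprMn /disc_ind.
by rewrite cabsM cabsC (gtr0_norm r0) gtr_pMr//; ring.
Qed.

Lemma moment_fin n : exists2 I : R, 0 <= I & moment n 1 = I%:E.
Proof.
have h0 : (0 <= moment n 1)%E by apply: integral_ge0 => p _; rewrite lee_fin moment_ge0.
exists (fine (moment n 1)); first exact: fine_ge0.
rewrite fineK// ge0_fin_numE//; apply: le_lt_trans (ltry disc_area).
rewrite -disc_areaE; apply: plane_int_le; [exact: plane_measurable_moment|exact: plane_measurable_disc|].
move=> z; rewrite moment_ge0 /disc_ind; case: ltP => z1; last by rewrite mul0r lexx.
by rewrite mul1r exprn_ile1 ?cabs_ge0// ltW.
Qed.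

Lemma disc_ind_cases r z : r < 1 -> [\/ disc_ind r z = 1 /\ disc_ind 1 z = 1,
  [/\ disc_ind r z = 0, disc_ind 1 z = 1, r <= cabs z & cabs z < 1] |
  disc_ind r z = 0 /\ disc_ind 1 z = 0].
Proof.
rewrite /disc_ind => r1; case: (ltP (cabs z) r) => h1; case: (ltP (cabs z) 1) => h2.
- by constructor 1.
- by have := lt_trans h1 r1; rewrite ltNge h2.
- by constructor 2.
- by constructor 3.
Qed.

(* Comparing the annulus r <= |z| < 1 with its dilates and letting r -> 1
   replaces polar coordinates. *)
Lemma momentE n : moment n 1 = (disc_area / n.+1%:R)%:E.
Proof.
have [I I0 eI] := moment_fin n; rewrite eI; congr (_%:E).
have A0 := disc_area_gt0.
have n0 : 0 < n.+1%:R :> R by [].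
(* On the annulus r^(2n) <= |z|^(2n) <= 1. By dilation its moment is (1 - r^(2n+2)) I and its area
   (1 - r^2) [disc_area]; the quotient of the two factors is a geometric sum tending to n + 1. *)
have main r : 0 < r < 1 -> I * \sum_(k < n.+1) r ^+ 2 ^+ k <= disc_area /\
    r ^+ n.*2 * disc_area <= I * \sum_(k < n.+1) r ^+ 2 ^+ k.
  move=> /andP[r0 r1].
  have q1 : 0 < 1 - r ^+ 2 by rewrite subr_gt0 exprn_ilt1 ?ltW.
  have geo : 1 - r ^+ n.*2.+2 = (1 - r ^+ 2) * \sum_(k < n.+1) r ^+ 2 ^+ k.
    have -> : r ^+ n.*2.+2 = r ^+ 2 ^+ n.+1 by rewrite -exprM mul2n doubleS.
    by rewrite -opprB subrX1 -mulNr opprB.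
  have mr := plane_measurable_moment n r; have m1 := plane_measurable_moment n 1.
  have dr := @plane_measurable_disc R r; have d1 := @plane_measurable_disc R 1.
  have di s z := @disc_ind_ge0 R s z.
  have er : moment n r = (r ^+ n.*2.+2 * I)%:E by rewrite moment_dil// eI EFinM.
  have ar : plane_int (@disc_ind R r) = (r ^+ 2 * disc_area)%:E.
    by rewrite -moment0 moment_dil// moment0 disc_areaE EFinM.
  have rn0 : 0 <= r ^+ n.*2 by rewrite exprn_ge0// ltW.
  (* Differences over the annulus are moved across the inequality, so that only sums of nonnegative
     integrals are compared. *)
  have U : I + r ^+ 2 * disc_area <= r ^+ n.*2.+2 * I + disc_area.
    rewrite -lee_fin !EFinD -eI -er -disc_areaE -ar -!plane_intD//; first last.
    - by move=> z; exact: moment_ge0.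
    - by move=> z; exact: moment_ge0.
    apply: plane_int_le; [exact: plane_measurableD|exact: plane_measurableD|].
    move=> z; have c0 := exprn_ge0 n.*2 (cabs_ge0 z).
    rewrite addr_ge0//=; last exact: moment_ge0.
    have [[-> ->]|[-> -> _ z1]|[-> ->]] := disc_ind_cases z r1.
    - by [].
    - by rewrite mul1r mul0r addr0 add0r exprn_ile1// ?cabs_ge0// ltW.
    - by rewrite !mul0r.
  have L : r ^+ n.*2 * disc_area + r ^+ n.*2.+2 * I <= I + r ^+ n.*2 * (r ^+ 2 * disc_area).
    have e1 := plane_intZ rn0 d1 (di 1); have e2 := plane_intZ rn0 dr (di r).
    rewrite disc_areaE in e1; rewrite ar in e2.
    have k1 : plane_measurable (fun z => r ^+ n.*2 * disc_ind 1 z).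
      by apply: plane_measurableM d1; exact: plane_measurable_cst.
    have k2 : plane_measurable (fun z => r ^+ n.*2 * disc_ind r z).
      by apply: plane_measurableM dr; exact: plane_measurable_cst.
    have p1 s z : 0 <= r ^+ n.*2 * disc_ind s z by rewrite mulr_ge0.
    rewrite -lee_fin !EFinD !(EFinM (r ^+ n.*2)) -e1 -e2 -er -eI.
    rewrite -!plane_intD//; [|exact: moment_ge0|exact: moment_ge0].
    apply: plane_int_le; [exact: plane_measurableD|exact: plane_measurableD|].
    move=> z; have c0 := exprn_ge0 n.*2 (cabs_ge0 z).
    rewrite addr_ge0//=; last exact: moment_ge0.
    have [[-> ->]|[-> -> rz z1]|[-> ->]] := disc_ind_cases z r1.
    - by rewrite addrC.
    - by rewrite mul1r mulr1 mul0r mulr0 !addr0 lerXn2r// nnegrE ?cabs_ge0// ltW.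
    - by rewrite !mul0r !mulr0.
  split; rewrite -(ler_pM2l q1).
    by rewrite mulrCA -geo; move: U; move: (r ^+ n.*2.+2) (r ^+ 2) => u v; clear; lra.
  rewrite [leRHS]mulrCA -geo; move: L; move: (r ^+ n.*2.+2) (r ^+ 2) (r ^+ n.*2) => u v t.
  by clear; lra.
apply/eqP; rewrite eq_le; apply/andP; split.
  rewrite ler_pdivlMr//; apply: (@pow_limit n.*2); first by rewrite mulr_ge0.
  move=> r r01; have [h _] := main r r01; apply: le_trans h.
  rewrite -mulrA ler_wpM2l// mulr_natl -[X in _ *+ X]card_ord -sumr_const.
  case/andP: r01 => r0 r1; apply: ler_sum => k _; rewrite -exprM -mul2n.
  by apply: ler_wiXn2l; rewrite ?ltW// leq_mul2l /= -ltnS.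
rewrite ler_pdivrMr//; apply: (@pow_limit n.*2); first exact: ltW.
move=> r r01; have [_ h] := main r r01; rewrite mulrC; apply: le_trans h _.
rewrite ler_wpM2l// -[leRHS]mulr1 mulr_natl -[X in _ *+ X]card_ord -sumr_const.
case/andP: r01 => r0 r1; apply: ler_sum => k _.
by rewrite -exprM exprn_ile1// ltW.
Qed.

End DiscMoments.

(** * Area integrals of squared power series *)

Section AreaNorm.
Variable R : realType.
Implicit Types (z w : R[i]) (r : R) (b : nat -> R[i]) (F : R[i] -> R[i]).

Definition poly_sum b N z : R[i] := \sum_(n < N) b n * z ^+ n.

Lemma cmeasurable_poly b N : cmeasurable (poly_sum b N).
Proof.
apply: cmeasurable_sum => n; apply: cmeasurableM; first exact: cmeasurable_cst.
by apply: cmeasurableX; exact: cmeasurable_id.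
Qed.

Lemma cvg_of_eps (u : nat -> R) (l : R) :
  (forall e : R, 0 < e -> exists N, forall n, (N <= n)%N -> `|u n - l| <= e) -> u @ \oo --> l.
Proof.
move=> h; apply/cvgrPdist_le => /= e e0; have [N HN] := h e e0.
by exists N => // n /= Nn; rewrite distrC; exact: HN.
Qed.

Lemma ctends_cabs_sqr (u : nat -> R[i]) l : ctends u l ->
  (fun n => cabs (u n) ^+ 2) @ \oo --> cabs l ^+ 2.
Proof.
move=> ul; have h : (fun n => cabs (u n)) @ \oo --> cabs l.
  apply: cvg_of_eps => e e0; have [N HN] := ul e e0; exists N => n /HN.
  by apply: le_trans; exact: (ler_dist_dist (u n : Rcomplex R) l).
by under eq_fun do rewrite expr2; rewrite expr2; exact: cvgM.
Qed.

Lemma disc_poly_cvg b F z : subexponential b ->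
  (forall z, cabs z < 1 -> F z = cpseries b z) ->
  (fun N => disc_ind 1 z * cabs (poly_sum b N z) ^+ 2) @ \oo --> disc_ind 1 z * cabs (F z) ^+ 2.
Proof.
move=> hb hF; rewrite /disc_ind; case: ltP => z1.
  apply: cvgM; first exact: cvg_cst.
  by rewrite hF//; apply: ctends_cabs_sqr; exact: cpseries_ctends.
by under eq_fun do rewrite mul0r; rewrite mul0r; exact: cvg_cst.
Qed.

Lemma plane_measurable_disc_poly b N r :
  plane_measurable (fun z => disc_ind r z * cabs (poly_sum b N z) ^+ 2).
Proof.
apply: plane_measurableM; first exact: plane_measurable_disc.
by apply: plane_measurable_sqr; exact: cmeasurable_poly.
Qed.

Lemma plane_measurable_disc_series b F : subexponential b ->
  (forall z, cabs z < 1 -> F z = cpseries b z) ->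
  plane_measurable (fun z => disc_ind 1 z * cabs (F z) ^+ 2).
Proof.
move=> hb hF.
apply: (@measurable_fun_cvg _ _ _ _ (fun N p => disc_ind 1 (cpt p) * cabs (poly_sum b N (cpt p)) ^+ 2)).
  by move=> N; exact: plane_measurable_disc_poly.
by move=> p _; exact: disc_poly_cvg.
Qed.

Lemma disc_poly_ge0 b N r z : 0 <= disc_ind r z * cabs (poly_sum b N z) ^+ 2.
Proof. by rewrite mulr_ge0 ?disc_ind_ge0// sqr_ge0. Qed.

Lemma area_poly b N r : 0 < r ->
  plane_int (fun z => disc_ind r z * cabs (poly_sum b N z) ^+ 2) =
  (disc_area R * \sum_(n < N) cabs (b n) ^+ 2 / n.+1%:R * r ^+ n.*2.+2)%:E.
Proof.
(* Enough roots of unity to separate the N exponents, and the three that [plane_int_poly] asks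
   for. *)
move=> r0; pose M := maxn N 3.
have M3 : (3 <= M)%N by rewrite leq_maxr.
have NM : (N <= M)%N by rewrite leq_maxl.
rewrite (plane_int_poly M3 r b NM) mulr_sumr -sumEFin; apply: eq_bigr => n _.
rewrite -[plane_int _]/(moment n r) moment_dil// momentE -!EFinM; congr (_%:E).
by ring.
Qed.

(** Fatou's lemma along the partial sums. *)
Lemma area_upper b F U : subexponential b -> (forall z, cabs z < 1 -> F z = cpseries b z) ->
  (forall N, disc_area R * \sum_(n < N) cabs (b n) ^+ 2 / n.+1%:R <= U) ->
  (plane_int (fun z => disc_ind 1 z * cabs (F z) ^+ 2)%R <= U%:E)%E.
Proof.
move=> hb hF hU.
apply: (@integral_le_of_limit _ _ _ _ _ (fun N p => disc_ind 1 (cpt p) * cabs (poly_sum b N (cpt p)) ^+ 2)).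
- exact: measurableT.
- by move=> N; exact: plane_measurable_disc_poly.
- by move=> N p _; exact: disc_poly_ge0.
- by move=> p _; exact: disc_poly_cvg.
- move=> N; rewrite -[leLHS]/(plane_int (fun z => disc_ind 1 z * cabs (poly_sum b N z) ^+ 2)).
  rewrite area_poly// lee_fin; apply: le_trans (hU N); rewrite ler_wpM2l ?(ltW (disc_area_gt0 R))//.
  by apply: ler_sum => n _; rewrite expr1n mulr1.
Qed.

(** On |z| < r the partial sums P converge uniformly to F and both are bounded by l, so |P|^2 <=
    |F|^2 + 2 l e; the area of P is known exactly, and then e -> 0 and r -> 1. *)
Lemma area_lower b F L : subexponential b -> (forall z, cabs z < 1 -> F z = cpseries b z) ->
  plane_int (fun z => disc_ind 1 z * cabs (F z) ^+ 2) = L%:E ->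
  forall K, disc_area R * \sum_(n < K) cabs (b n) ^+ 2 / n.+1%:R <= L.
Proof.
move=> hb hF hL K; have A0 := disc_area_gt0 R.
have c0 n : 0 <= cabs (b n) ^+ 2 / n.+1%:R by rewrite divr_ge0// sqr_ge0.
(* On the disc of radius r the term of index n carries r^(2n+2), which is at least r^(2K) for n <
   K. *)
apply: (@pow_limit _ K.*2); first by rewrite mulr_ge0 ?(ltW A0)// sumr_ge0.
move=> r /andP[r0 r1].
have [B HB] : exists B : R, forall N, \sum_(n < N) n.+1%:R ^+ 2 * (cabs (b n) * r ^+ n) <= B.
  by apply: subexponential_sum => //; rewrite (ltW r0).
have HB' N : \sum_(n < N) cabs (b n) * r ^+ n <= B.
  apply: le_trans (HB N); apply: ler_sum => n _; rewrite ler_peMl//.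
    by rewrite mulr_ge0 ?cabs_ge0// exprn_ge0// ltW.
  by rewrite -natrX ler1n.
have t0 n : 0 <= cabs (b n) * r ^+ n by rewrite mulr_ge0 ?cabs_ge0// exprn_ge0// ltW.
have [l Sl lS] := bounded_series_cauchy t0 HB'.
have l0 : 0 <= l by have := Sl 0%N; rewrite big_ord0.
apply: (@le_of_eps _ _ _ (2 * l * disc_area R)); first by rewrite !mulr_ge0 ?(ltW A0).
move=> e e0; have [N0 HN0] := lS e e0; pose N := maxn N0 K.
have KN : (K <= N)%N by rewrite leq_maxr.
have tail : l - \sum_(n < N) cabs (b n) * r ^+ n <= e by apply: HN0; rewrite leq_maxl.
have near z : cabs z < r -> cabs (poly_sum b N z) ^+ 2 <= cabs (F z) ^+ 2 + 2 * l * e.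
  move=> zr; have z1 := lt_trans zr r1.
  have dom n : cabs (b n * z ^+ n) <= cabs (b n) * r ^+ n.
    by rewrite cabsM cabsX ler_wpM2l ?cabs_ge0// lerXn2r ?nnegrE ?cabs_ge0 ?(ltW r0)// ltW.
  have hP : cabs (poly_sum b N z) <= l.
    apply: le_trans (cabs_sum _ _ _) _; apply: le_trans (Sl N).
    by apply: ler_sum => n _; exact: dom.
  have hF1 : cabs (F z) <= l.
    rewrite hF//; apply: csum_cabs_le => M; apply: le_trans (Sl M).
    by apply: ler_sum => n _; exact: dom.
  have hd : cabs (poly_sum b N z) - cabs (F z) <= e.
    apply: le_trans (cabsB_ge _ _) _; rewrite cabsBC hF//; apply: le_trans tail.
    apply: (ctends_cabs_le (ctendsB (cpseries_ctends hb z1) (ctends_cst _))).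
    exists N => M NM; have -> : M = (N + (M - N))%N by lia.
    rewrite big_split_ord/= addrAC subrr add0r; apply: le_trans (cabs_sum _ _ _) _.
    apply: le_trans (_ : \sum_(i < M - N) cabs (b (N + i)%N) * r ^+ (N + i) <= _).
      by apply: ler_sum => i _; exact: dom.
    by rewrite lerBrDl; apply: le_trans (Sl (N + (M - N))%N); rewrite big_split_ord.
  rewrite -lerBlDl subr_sqr.
  have s0 : 0 <= cabs (poly_sum b N z) + cabs (F z) by rewrite addr_ge0 ?cabs_ge0.
  apply: le_trans (ler_wpM2r s0 hd) _; rewrite [2 * l * e]mulrC ler_wpM2l ?(ltW e0)//.
  by rewrite mulr_natl mulr2n lerD.
have k0 : 0 <= 2 * l * e by rewrite !mulr_ge0// ltW.
have mF := plane_measurable_disc_series hb hF.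
have md : plane_measurable (fun z => 2 * l * e * disc_ind 1 z).
  by apply: plane_measurableM; [exact: plane_measurable_cst|exact: plane_measurable_disc].
have main : (plane_int (fun z => disc_ind r z * cabs (poly_sum b N z) ^+ 2)%R <=
   plane_int (fun z => disc_ind 1 z * cabs (F z) ^+ 2 + 2 * l * e * disc_ind 1 z)%R)%E.
  apply: plane_int_le; [exact: plane_measurable_disc_poly|exact: plane_measurableD|].
  move=> z; rewrite disc_poly_ge0 /=.
  have [[e1 e2]|[e1 _ _ _]|[e1 _]] := disc_ind_cases z r1.
  - rewrite e1 e2 !mul1r mulr1; apply: near.
    by move: e1; rewrite /disc_ind; case: (ltP (cabs z) r) => // _ /eqP; rewrite eq_sym oner_eq0.
  - by rewrite e1 mul0r; apply: addr_ge0; apply: mulr_ge0; rewrite ?disc_ind_ge0 ?sqr_ge0.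
  - by rewrite e1 mul0r; apply: addr_ge0; apply: mulr_ge0; rewrite ?disc_ind_ge0 ?sqr_ge0.
move: main; rewrite area_poly// plane_intD//; first last.
- by move=> z; rewrite mulr_ge0 ?disc_ind_ge0.
- by move=> z; rewrite mulr_ge0 ?disc_ind_ge0 ?sqr_ge0.
rewrite hL plane_intZ//; last exact: plane_measurable_disc.
rewrite disc_areaE -EFinM -EFinD lee_fin => main.
have -> : 2 * l * disc_area R * e = 2 * l * e * disc_area R by ring.
apply: le_trans main; rewrite -mulrA ler_wpM2l ?(ltW A0)//.
have -> : N = (K + (N - K))%N by lia.
rewrite big_split_ord/=; apply: le_trans (_ : \sum_(n < K) cabs (b n) ^+ 2 / n.+1%:R * r ^+ n.*2.+2 <= _).
  rewrite mulr_suml; apply: ler_sum => n _; rewrite ler_wpM2l//.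
  by apply: ler_wiXn2l; rewrite ?ltW// -doubleS leq_double.
by rewrite lerDl sumr_ge0// => i _; rewrite mulr_ge0// exprn_ge0// ltW.
Qed.

End AreaNorm.
(** * The Dirichlet norm on coefficients *)

Section CircleNorm.
Variable R : realType.
Implicit Types (x r t : R) (z w : R[i]) (a : nat -> R[i]) (f : R[i] -> R[i]).

Lemma cint_conj (g : R -> R[i]) : ccont g ->
  ccont (fun t => conjc (g t)) /\ cint (fun t => conjc (g t)) = conjc (cint g).
Proof.
have cRe (z : R[i]) : complex.Re (conjc z) = complex.Re z by case: z.
have cIm (z : R[i]) : complex.Im (conjc z) = -1 * complex.Im z by case: z => u v /=; ring.
move=> [h1 h2]; split; first split.
- by under [X in seg_cont X]funext do rewrite cRe.
- by under [X in seg_cont X]funext do rewrite cIm; exact: seg_contZ.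
apply/eqP; rewrite eq_complex cRe cIm /=; apply/andP; split; apply/eqP.
  by apply: eq_seg_int => t _; rewrite cRe.
by rewrite -seg_intZ//; apply: eq_seg_int => t _; rewrite cIm.
Qed.

Lemma cconjM z w : conjc (z * w) = conjc z * conjc w.
Proof. exact: rmorphM. Qed.

Lemma cconjX z n : conjc (z ^+ n) = conjc z ^+ n.
Proof. exact: rmorphXn. Qed.

Lemma cconj_sum (I : Type) (s : seq I) (F : I -> R[i]) :
  conjc (\sum_(i <- s) F i) = \sum_(i <- s) conjc (F i).
Proof. exact: rmorph_sum. Qed.

Let g x n m t : R[i] := polar x t ^+ n * conjc (polar x t) ^+ m.

Lemma polar_conj x t : conjc (polar x t) = real_complex R (expR x ^+ 2) * (polar x t)^-1.
Proof.
have p0 := polar_neq0 x t; apply: (mulfI p0); rewrite mulc_conj cabs_polar mulrCA mulfV//.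
by rewrite mulr1.
Qed.

(** For n <= m, conj z = |z|^2 / z turns the monomial into a constant times z^-(m-n), whose mean
    vanishes unless m = n; the other case is its conjugate. *)
Lemma cint_polar_mono x n m : ccont (g x n m) /\
  cint (g x n m) = if n == m then real_complex R (expR x ^+ n.*2 * (2 * pi)) else 0.
Proof.
wlog nm : n m / (n <= m)%N => [H|].
  have [nm|/ltnW mn] := leqP n m; first exact: H.
  have e : g x n m = (fun t => conjc (g x m n t)).
    by apply/funext => t; rewrite /g cconjM !cconjX conjcK mulrC.
  have [h1 h2] := H m n mn; have [k1 k2] := cint_conj h1; rewrite e; split => //.
  rewrite k2 h2 eq_sym; case: eqP => [->|_]; last by rewrite conjc0.
  by rewrite conjc_real.
have e : g x n m = (fun t => real_complex R (expR x ^+ 2 ^+ m) * (polar x t)^-1 ^+ (m - n)).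
  apply/funext => t; rewrite /g polar_conj exprMn -rmorphXn mulrCA; congr (_ * _).
  rewrite -{1}(subnKC nm) exprD mulrA -exprMn mulfV ?polar_neq0// expr1n mul1r.
  by [].
have c1 : ccont (fun t => (polar x t)^-1 ^+ (m - n)).
  by apply: (@polar_cdiff_cont _ (fun z => z^-1 ^+ (m - n))) => y _; exact: cdiffable_inv_pow.
rewrite e; split; first exact: ccontM.
rewrite cintM//; have [->|nm'] := eqVneq n m.
  under [X in cint X]funext do rewrite subnn expr0.
  by rewrite cint_cst mul1r -rmorphM -exprM mul2n.
have d0 : (0 < m - n)%N by rewrite subn_gt0 ltn_neqAle nm'.
by have := @circ_inv_pow R x _ d0; rewrite /circ => ->; rewrite mulr0.
Qed.

Lemma seg_int_fin (h : R -> R) : seg_cont h 0 (2 * pi) ->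
  (\int[@lebesgue_measure R]_(t in `[0%R, (2 * pi)%R]) (h t)%:E = (seg_int h 0 (2 * pi))%:E)%E.
Proof.
move=> hc; rewrite /seg_int /Rintegral fineK//.
by apply: integrable_fin_num => //; exact: seg_integrable.
Qed.

Lemma circle_poly a N x :
  (\int[@lebesgue_measure R]_(t in `[0%R, (2 * pi)%R])
     (cabs (poly_sum a N (polar x t)) ^+ 2)%:E =
   (2 * pi * \sum_(n < N) cabs (a n) ^+ 2 * expR x ^+ n.*2)%:E)%E.
Proof.
pose G t := \sum_(n < N) \sum_(m < N) a n * conjc (a m) * g x n m t.
have eG t : cabs (poly_sum a N (polar x t)) ^+ 2 = complex.Re (G t).
  rewrite -[LHS]/(complex.Re (real_complex R (cabs (poly_sum a N (polar x t)) ^+ 2))).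
  rewrite -mulc_conj; congr complex.Re; rewrite /poly_sum cconj_sum mulr_suml.
  apply: eq_bigr => n _; rewrite mulr_sumr; apply: eq_bigr => m _.
  by rewrite cconjM cconjX /g; ring.
have cg n m : ccont (fun t => a n * conjc (a m) * g x n m t).
  by apply: ccontM; have [] := cint_polar_mono x n m.
have cG : ccont G.
  by apply: ccont_sum => n; apply: ccont_sum => m; exact: cg.
under eq_integral do rewrite eG.
rewrite seg_int_fin; last by case: cG.
congr (_%:E); rewrite -[LHS]/(complex.Re (cint G)).
rewrite cint_sum; last by move=> n; apply: ccont_sum => m; exact: cg.
rewrite cRe_sum mulr_sumr; apply: eq_bigr => n _.
rewrite cint_sum; last by move=> m; exact: cg.
rewrite (bigD1 n)//= big1 ?addr0 => [|m mn].
  rewrite cintM; last by have [] := cint_polar_mono x n n.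
  have [_ ->] := cint_polar_mono x n n; rewrite eqxx mulc_conj -rmorphM /=; ring.
rewrite cintM; last by have [] := cint_polar_mono x n m.
have [_ ->] := cint_polar_mono x n m.
by rewrite eq_sym -val_eqE in mn; rewrite (negbTE mn) mulr0.
Qed.

Lemma circle_mean_upper a f U r : 0 < r < 1 -> subexponential a ->
  (forall z, cabs z < 1 -> f z = cpseries a z) ->
  (forall N, \sum_(n < N) cabs (a n) ^+ 2 <= U) -> (circle_mean f r <= U%:E)%E.
Proof.
move=> /andP[r0 r1] ha hf hU.
have er t : circle_point r t = polar (ln r) t by rewrite /polar lnK// posrE.
have tp := twopi_gt0 R.
suff h : (\int[@lebesgue_measure R]_(t in `[0%R, (2 * pi)%R])
   (cabs (f (circle_point r t)) ^+ 2)%:E <= (2 * pi * U)%:E)%E.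
  rewrite /circle_mean; apply: le_trans (lee_wpmul2l _ h) _.
    by rewrite lee_fin invr_ge0 ltW.
  by rewrite -EFinM lee_fin mulrA mulVf ?mul1r// gt_eqF.
apply: (@integral_le_of_limit _ (measurableTypeR R) R (@lebesgue_measure R) `[0%R, (2 * pi)%R]%classic
  (fun N t => cabs (poly_sum a N (polar (ln r) t)) ^+ 2)
  (fun t => cabs (f (circle_point r t)) ^+ 2)).
- exact: measurable_itv.
- move=> N.
  have hc : ccont (fun t => poly_sum a N (polar (ln r) t)).
    apply: (@polar_cdiff_cont _ (poly_sum a N)) => y _; rewrite /poly_sum.
    elim: N => [|N IHN].
      by under [X in cdiffable X]funext do rewrite big_ord0; exact: cdiffable_cst.
    under [X in cdiffable X]funext do rewrite big_ord_recr /= -[X in _ + X]opprK.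
    apply: cdiffableB => //.
    under [X in cdiffable X]funext do rewrite -mulNr.
    by apply: cdiffableM; [exact: cdiffable_cst|apply: cdiffableX; exact: cdiffable_id].
  have hc2 : seg_cont (fun t => cabs (poly_sum a N (polar (ln r) t)) ^+ 2) 0 (2 * pi).
    under [X in seg_cont X]funext do rewrite cabs_sqr.
    case: hc => h1 h2; apply: seg_contD => y hy; apply: cvgM; by [apply: h1|apply: h2].
  by apply/measurable_EFinP; exact: measurable_int (seg_integrable hc2).
- by move=> N t _; exact: sqr_ge0.
- move=> t _; rewrite er hf; last by rewrite cabs_polar lnK// posrE.
  by apply: ctends_cabs_sqr; apply: cpseries_ctends => //; rewrite cabs_polar lnK// posrE.
- move=> N; rewrite circle_poly lee_fin ler_pM2l//; apply: le_trans (hU N).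
  apply: ler_sum => n _; rewrite ler_piMr ?sqr_ge0// lnK ?posrE// exprn_ile1// ltW//.
Qed.

(** Only the constant coefficient escapes the area integral, so continuity of f at 0 and a small
    circle are all that is asked of the Hardy norm. *)
Lemma circle_mean_lower f (H : R) : (forall z, cabs z < 1 -> cdiffable f z) ->
  (forall r, 0 < r < 1 -> (circle_mean f r <= H%:E)%E) -> cabs (f 0) ^+ 2 <= H.
Proof.
move=> hf hH; have tp := twopi_gt0 R.
apply: (@le_of_eps _ _ _ (2 * cabs (f 0))); first by rewrite mulr_ge0 ?cabs_ge0.
(* [c] is a lower bound for |f|^2 on the small circle, by u^2 - 2 u e <= v^2 for u - v <= e. *)
move=> e e0; rewrite -lerBlDr; set c := _ - _.
have [r r0 hr] := cdiff_continuous (hf 0 ltac:(by rewrite cabs0)) e0.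
pose s := Num.min r 2^-1.
have s01 : 0 < s < 1.
  rewrite lt_min r0 invr_gt0 ltr0n /= gt_min; apply/orP; right.
  by rewrite invf_lt1 ?ltr1n.
have [c0|c0] := ltP c 0.
  have := hH s s01 => h; rewrite -lee_fin; apply: le_trans h.
  apply: le_trans (_ : (0 <= _)%E); first by rewrite lee_fin ltW.
  apply: mule_ge0; first by rewrite lee_fin invr_ge0 ltW.
  by apply: integral_ge0 => t _; rewrite lee_fin sqr_ge0.
rewrite -lee_fin; apply: le_trans (hH s s01).
have er t : circle_point s t = polar (ln s) t.
  by case/andP: s01 => s0 _; rewrite /polar lnK// posrE.
have cs t : cabs (circle_point s t) = s.
  by case/andP: s01 => s0 _; rewrite cabs_circle_point// ltW.
have hc : ccont (fun t => f (polar (ln s) t)).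
  apply: polar_cdiff_cont => y _; apply: hf; rewrite -er cs.
  by case/andP: s01.
have hc2 : seg_cont (fun t => cabs (f (circle_point s t)) ^+ 2) 0 (2 * pi).
  under [X in seg_cont X]funext do rewrite er cabs_sqr.
  case: hc => h1 h2; apply: seg_contD => y hy; apply: cvgM; by [apply: h1|apply: h2].
rewrite /circle_mean; have -> : c%:E = (((2 * pi)^-1)%:E * (c * (2 * pi))%:E)%E.
  by rewrite -EFinM mulrCA mulVf ?mulr1// gt_eqF.
apply: lee_wpmul2l; first by rewrite lee_fin invr_ge0 ltW.
have -> : (c * (2 * pi))%:E = (\int[@lebesgue_measure R]_(t in `[0%R, (2 * pi)%R]) c%:E)%E.
  by rewrite (seg_int_fin (@seg_cont_cst R c _ _)) seg_int_cst ?ltW// subr0.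
apply: ge0_le_integral => //.
- exact: measurable_int (seg_integrable hc2).
- move=> t _; rewrite lee_fin /c lerBlDr.
  have k : cabs (f (circle_point s t) - f 0) <= e.
    by apply: hr; rewrite subr0 cs ge_min lexx.
  have := cabsB_ge (f 0) (f (circle_point s t)); rewrite cabsBC => /le_trans/(_ k).
  have := cabs_ge0 (f 0); have := cabs_ge0 (f (circle_point s t)).
  move: (cabs (f 0)) (cabs (f (circle_point s t))) => u v v0 u0 uv.
  rewrite -subr_ge0; have -> : v ^+ 2 + 2 * u * e - u ^+ 2 = 2 * u * (e - (u - v)) + (u - v) ^+ 2 by ring.
  by rewrite addr_ge0 ?sqr_ge0// mulr_ge0 ?mulr_ge0// subr_ge0.
Qed.

End CircleNorm.

Section DirichletNorm.
Variable R : realType.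
Implicit Types (z w : R[i]) (a : nat -> R[i]) (f : R[i] -> R[i]).

Lemma subexponential_deriv a : subexponential a -> subexponential (fun n => n.+1%:R * a n.+1).
Proof.
move=> ha r /andP[r0 r1].
have [s [rs s1]] : exists s, r < s /\ s < 1 by exists ((r + 1) / 2); rewrite !midf_lt.
have s0 : 0 < s := le_lt_trans r0 rs.
have [|B HB] := subexponential_sum ha (q := s); first by rewrite (ltW s0).
exists (B / s) => n; rewrite ler_pdivlMr//; apply: le_trans (HB n.+2).
rewrite big_ord_recr /=; apply: ler_wpDl.
  by apply: sumr_ge0 => i _; rewrite mulr_ge0 ?sqr_ge0// mulr_ge0 ?cabs_ge0// exprn_ge0// ltW.
rewrite cabsM cabs_nat [s ^+ n.+1]exprS.
apply: le_trans (_ : n.+2%:R ^+ 2 * cabs (a n.+1) * s ^+ n * s <= _); last first.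
  by rewrite le_eqVlt; apply/orP; left; apply/eqP; ring.
rewrite ler_wpM2r ?(ltW s0)// ler_pM ?exprn_ge0 ?mulr_ge0 ?cabs_ge0//.
  rewrite ler_wpM2r ?cabs_ge0//; apply: le_trans (_ : n.+2%:R <= _); first by rewrite ler_nat.
  by rewrite expr2 ler_peMr// ler1n.
by rewrite lerXn2r ?nnegrE ?(ltW s0)// ltW.
Qed.

Lemma cdiff_ext f g z A : cabs z < 1 -> (forall w, cabs w < 1 -> f w = g w) ->
  cdiff g z A -> cdiff f z A.
Proof.
move=> z1 fg h e e0; have [r r0 hr] := h e e0.
exists (Num.min r ((1 - cabs z) / 2)).
  by rewrite lt_min r0 divr_gt0// subr_gt0.
move=> w; rewrite le_min => /andP[h1 h2].
have w1 : cabs w < 1.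
  have := cabsB_ge w z; move: z1 h2; move: (cabs w) (cabs z) (cabs (w - z)) => u v t.
  by clear; lra.
by rewrite !fg//; exact: hr.
Qed.

Lemma dirichlet_integralE f : dirichlet_integral f =
  ((pi^-1)%:E * plane_int (fun z => disc_ind 1 z * cabs (cderiv f z) ^+ 2)%R)%E.
Proof.
rewrite /dirichlet_integral; congr (_ * _)%E; rewrite integral_mkcond; apply: eq_integral => p _.
rewrite /patch /disc_ind /cpt; case: ifPn => [/set_mem h|/negP h].
  by rewrite (_ : (cabs _ < 1) = true)// mul1r.
rewrite (_ : (cabs _ < 1) = false) ?mul0r//; apply/negP => k; apply: h; exact/mem_set.
Qed.

Lemma cderiv_series a f z : subexponential a -> (forall z, cabs z < 1 -> f z = cpseries a z) ->
  cabs z < 1 -> cderiv f z = cpseries (fun n => n.+1%:R * a n.+1) z.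
Proof.
move=> ha hf z1; apply: cdiff_cderiv; apply: (cdiff_ext z1 hf).
exact: cpseries_cdiff.
Qed.

Lemma deriv_coef_sqr a n :
  cabs (n.+1%:R * a n.+1) ^+ 2 / n.+1%:R = n.+1%:R * cabs (a n.+1) ^+ 2 :> R.
Proof. by rewrite cabsM cabs_nat exprMn mulrAC [n.+1%:R ^+ 2]expr2 mulfK ?pnatr_eq0. Qed.

Lemma dirichlet_upper a B : (forall N, \sum_(n < N) n.+1%:R * cabs (a n) ^+ 2 <= B) ->
  subexponential a /\ dirichlet_space (cpseries a).
Proof.
move=> hB.
have t0 n : 0 <= n.+1%:R * cabs (a n) ^+ 2 by rewrite mulr_ge0// sqr_ge0.
have sq n : cabs (a n) ^+ 2 <= n.+1%:R * cabs (a n) ^+ 2.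
  by rewrite ler_peMl ?sqr_ge0// ler1n.
have aB n : cabs (a n) ^+ 2 <= B.
  apply: le_trans (sq n) _; apply: le_trans (hB n.+1).
  by rewrite big_ord_recr /= lerDr sumr_ge0.
have ha : subexponential a.
  move=> r /andP[r0 r1]; exists (B + 1) => n.
  have h : cabs (a n) <= B + 1.
    have := aB n; have := cabs_ge0 (a n); move: (cabs (a n)) => u; clear; nra.
  by apply: le_trans h; rewrite ler_piMr ?cabs_ge0// exprn_ile1// ltW.
split => //; split.
  by move=> z z1; apply: cdiff_derivable (cpseries_cdiff ha z1).
have hb := subexponential_deriv ha.
rewrite /dirichlet_sqnorm; apply: lte_add_pinfty.
  apply: le_lt_trans (ltry B); apply: ge_ereal_sup => _ [r r01 <-].
  apply: (circle_mean_upper r01 ha) => // N; apply: le_trans (hB N).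
  by apply: ler_sum => n _; exact: sq.
rewrite dirichlet_integralE.
have A0 := disc_area_gt0 R.
apply: le_lt_trans (lee_wpmul2l _ (@area_upper _ _ (cderiv (cpseries a)) (disc_area R * B) hb _ _)) _.
- by rewrite lee_fin invr_ge0 ltW// pi_gt0.
- by move=> z z1; apply: cderiv_series.
- move=> N; rewrite ler_pM2l//; apply: le_trans (hB N.+1).
  rewrite big_ord_recl /=; apply: ler_wpDl => //; apply: ler_sum => n _.
  rewrite deriv_coef_sqr /bump /= add1n ler_wpM2r ?sqr_ge0// ler_nat; exact: leqW.
- by rewrite -EFinM ltry.
Qed.

(** The 1 pays for the constant coefficient, the 2 for n + 2 <= 2 (n + 1), and pi / [disc_area] for
    the normalization of the area integral. *)
Definition norm_const : R := 1 + 2 * (pi / disc_area R).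

Lemma dirichlet_lower f : dirichlet_space f -> exists a (D : R),
  [/\ dirichlet_sqnorm f = D%:E, (forall z, cabs z < 1 -> f z = cpseries a z) &
    subexponential a /\ forall N, \sum_(n < N) n.+1%:R * cabs (a n) ^+ 2 <= norm_const * D].
Proof.
move=> [fan ffin].
have hf z : cabs z < 1 -> cdiffable f z by move=> z1; apply: derivable_cdiff; exact: fan.
have [a ha hfa] : exists2 a, subexponential a & forall z, cabs z < 1 -> f z = cpseries a z.
  exists (taylor_coef f); first exact: taylor_coef_subexponential.
  by move=> z; exact: taylor_expansion.
have h01 : (0 < 2^-1 :> R) && (2^-1 < 1 :> R) by rewrite invr_gt0 ltr0n /= invf_lt1 ?ltr1n.
have Hs0 : (0 <= hardy_sqnorm f)%E.
  apply: le_trans (_ : (circle_mean f 2^-1 <= _)%E).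
    apply: mule_ge0; first by rewrite lee_fin invr_ge0 ltW// twopi_gt0.
    by apply: integral_ge0 => t _; rewrite lee_fin sqr_ge0.
  by apply: ereal_sup_ubound; exists 2^-1.
have Di0 : (0 <= dirichlet_integral f)%E.
  apply: mule_ge0; first by rewrite lee_fin invr_ge0 ltW// pi_gt0.
  by apply: integral_ge0 => t _; rewrite lee_fin sqr_ge0.
have [H [I [eH eI]]] : exists H I : R, hardy_sqnorm f = H%:E /\ dirichlet_integral f = I%:E.
  exists (fine (hardy_sqnorm f)), (fine (dirichlet_integral f)).
  rewrite !fineK// ge0_fin_numE//; apply: le_lt_trans ffin.
    by rewrite /dirichlet_sqnorm leeDr.
  by rewrite /dirichlet_sqnorm leeDl.
exists a, (H + I); split => //; first by rewrite /dirichlet_sqnorm eH eI.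
split => // N.
have H0 : 0 <= H by rewrite -lee_fin -eH.
have I0 : 0 <= I by rewrite -lee_fin -eI.
have A0 := disc_area_gt0 R; have p0 := pi_gt0 R.
have a0H : cabs (a 0%N) ^+ 2 <= H.
  have -> : a 0%N = f 0.
    rewrite hfa ?cabs0//; apply/esym/csum_ctends => e e0; exists 1%N => -[//|n] _.
    rewrite big_ord_recl big1 ?addr0 => [|i _]; last by rewrite expr0n /= mulr0.
    by rewrite expr0 mulr1 subrr cabs0 ltW.
  apply: (circle_mean_lower hf) => r r01; rewrite -eH.
  by apply: ereal_sup_ubound; exists r.
have hb := subexponential_deriv ha.
have dI : plane_int (fun z => disc_ind 1 z * cabs (cderiv f z) ^+ 2) = (pi * I)%:E.
  move: eI; rewrite dirichlet_integralE => /(congr1 (fun x => pi%:E * x)%E).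
  by rewrite muleA -EFinM mulfV ?gt_eqF// mul1e EFinM.
have hF z : cabs z < 1 -> cderiv f z = cpseries (fun n => n.+1%:R * a n.+1) z.
  by move=> z1; exact: cderiv_series ha hfa z1.
have low := area_lower hb hF dI.
case: N => [|N].
  by rewrite big_ord0 /norm_const mulr_ge0 ?addr_ge0// mulr_ge0// divr_ge0// ltW.
rewrite big_ord_recl mul1r.
have low' : \sum_(n < N) n.+1%:R * cabs (a n.+1) ^+ 2 <= pi / disc_area R * I.
  rewrite mulrAC ler_pdivlMr// mulrC; apply: le_trans (low N).
  by rewrite ler_wpM2l ?(ltW A0)//; apply: ler_sum => n _; rewrite deriv_coef_sqr.
have : \sum_(i < N) (bump 0 i).+1%:R * cabs (a (bump 0 i)) ^+ 2 <= 2 * (pi / disc_area R * I).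
  apply: le_trans (_ : 2 * \sum_(n < N) n.+1%:R * cabs (a n.+1) ^+ 2 <= _); last by rewrite ler_pM2l.
  rewrite mulr_sumr; apply: ler_sum => n _; rewrite /bump /= add1n mulrA ler_wpM2r ?sqr_ge0//.
  by rewrite -natrM ler_nat mul2n -addnn addSn ltnS addnS ltnS leq_addl.
rewrite /norm_const; have : 0 <= pi / disc_area R by rewrite divr_ge0// ltW.
move: a0H H0 I0; move: (\sum_(i < N) _) (pi / _) (_ ^+ 2) => S k u; clear; nra.
Qed.

Lemma norm_const_gt0 : 0 < norm_const.
Proof.
by rewrite ltr_pwDl// mulr_ge0// divr_ge0 ?ltW ?pi_gt0 ?disc_area_gt0.
Qed.

End DirichletNorm.

(** * Kernels and interpolation *)

Section Kernel.
Variable R : realType.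
Implicit Types (z x y : R[i]).

Definition kernel_series z : R[i] := cpseries (fun n => n.+1%:R^-1) z.

Lemma kernel_coef n : cabs (n.+1%:R^-1 : R[i]) = n.+1%:R^-1.
Proof. by rewrite cabsV cabs_nat. Qed.

Lemma kernel_coef_le1 n : cabs (n.+1%:R^-1 : R[i]) <= 1.
Proof. by rewrite kernel_coef invf_le1 ?ler1n. Qed.

Lemma kernel_abs z N : cabs z < 1 ->
  \sum_(n < N) cabs (n.+1%:R^-1 * z ^+ n) <= (1 - cabs z)^-1.
Proof.
move=> z1; apply: le_trans (geometric_partial_le N (q := cabs z) _); last by rewrite cabs_ge0.
apply: ler_sum => n _; rewrite cabsM cabsX ler_piMl ?exprn_ge0 ?cabs_ge0//.
exact: kernel_coef_le1.
Qed.

Lemma kernel_ctends z : cabs z < 1 ->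
  ctends (fun N => \sum_(n < N) n.+1%:R^-1 * z ^+ n) (kernel_series z).
Proof. by move=> z1; exact: asum_ctends (fun N => kernel_abs N z1). Qed.

Lemma kernel_crude z : cabs z < 1 -> cabs (kernel_series z) <= (1 - cabs z)^-1.
Proof. by move=> z1; apply: (@csum_cabs_le _ (fun n => n.+1%:R^-1 * z ^+ n)) => N; exact: kernel_abs. Qed.

Lemma abel_sum (u : nat -> R[i]) z N :
  (1 - z) * \sum_(i < N) u i * z ^+ i =
  u 0%N + \sum_(i < N) (u i.+1 - u i) * z ^+ i.+1 - u N * z ^+ N.
Proof.
elim: N => [|N IHN]; first by rewrite !big_ord0 expr0; ring.
by rewrite !big_ord_recr /= mulrDr IHN exprS; ring.
Qed.

Lemma cabs_exp_sub1 z n : cabs z <= 1 -> cabs (z ^+ n - 1) <= n%:R * cabs (1 - z).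
Proof.
move=> z1; elim: n => [|n IHn]; first by rewrite expr0 subrr cabs0 mul0r.
have -> : z ^+ n.+1 - 1 = z * (z ^+ n - 1) - (1 - z) by rewrite exprS; ring.
apply: le_trans (cabsB _ _) _; rewrite cabsM -natr1 mulrDl mul1r lerD2r.
by apply: le_trans IHn; rewrite ler_piMl ?cabs_ge0.
Qed.

Lemma ln_step n :
  (n.+2%:R^-1 : R) <= ln (n.+2%:R : R) - ln n.+1%:R <= n.+1%:R^-1.
Proof.
have n1 : (0 : R) < n.+1%:R by rewrite ltr0n.
have n2 : (0 : R) < n.+2%:R by rewrite ltr0n.
have e2 : n.+2%:R = n.+1%:R + 1 :> R by rewrite -natr1.
apply/andP; split.
  rewrite -lerN2 opprB -ln_div ?posrE//.
  have -> : n.+1%:R / n.+2%:R = 1 + - n.+2%:R^-1 :> R by rewrite e2; field; lra.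
  by apply: le_ln1Dx; rewrite ltrN2 invf_lt1// ltr1n.
rewrite -ln_div ?posrE//.
have -> : n.+2%:R / n.+1%:R = 1 + n.+1%:R^-1 :> R by rewrite e2; field; lra.
apply: le_ln1Dx; apply: (@lt_trans _ _ 0); first by rewrite oppr_lt0.
by rewrite invr_gt0.
Qed.

Lemma harmonic_ln n :
  ln (n.+2%:R : R) <= \sum_(i < n.+1) i.+1%:R^-1 <= 1 + ln (n.+1%:R : R).
Proof.
have ln2 : ln 2 <= 1 :> R.
  have := ln_step 0; rewrite ln1 subr0 invr1 => /andP[_]; exact.
elim: n => [|n /andP[IH1 IH2]].
  by rewrite big_ord_recr big_ord0 /= add0r invr1 ln1 addr0 ln2 lexx.
rewrite big_ord_recr /=; have /andP[h1 _] := ln_step n; have /andP[h2 h3] := ln_step n.+1; apply/andP; split.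
  by rewrite -(subrK (ln n.+2%:R) (ln n.+3%:R)) addrC lerD.
by apply: le_trans (lerD IH2 h1) _; rewrite -addrA [ln n.+1%:R + _]addrC subrK.
Qed.

(** Abel summation: the coefficients decrease, so their differences telescope. *)
Lemma kernel_tail z m N : cabs z < 1 ->
  cabs ((1 - z) * \sum_(i < N) (m + i).+1%:R^-1 * z ^+ i) <= 2 / m.+1%:R.
Proof.
move=> z1; rewrite (abel_sum (fun i => (m + i).+1%:R^-1)) addn0.
have zn n : cabs (z ^+ n) <= 1 by rewrite cabsX exprn_ile1 ?cabs_ge0 ?ltW.
have dec (i : nat) : (m + i.+1).+1%:R^-1 <= (m + i).+1%:R^-1 :> R.
  by rewrite lef_pV2 ?posrE ?ltr0n// ler_nat addnS.
apply: le_trans (cabsB _ _) _.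
have h1 : cabs ((m + N).+1%:R^-1 * z ^+ N) <= (m + N).+1%:R^-1.
  by rewrite cabsM kernel_coef ler_piMr// invr_ge0 ler0n.
have h2 : cabs (\sum_(i < N) ((m + i.+1).+1%:R^-1 - (m + i).+1%:R^-1) * z ^+ i.+1) <=
    m.+1%:R^-1 - (m + N).+1%:R^-1.
  apply: le_trans (cabs_sum _ _ _) _.
  apply: le_trans (_ : \sum_(i < N) ((m + i).+1%:R^-1 - (m + i.+1).+1%:R^-1) <= _).
    apply: ler_sum => i _; rewrite cabsM.
    have -> : (m + i.+1).+1%:R^-1 - (m + i).+1%:R^-1 =
        real_complex R ((m + i.+1).+1%:R^-1 - (m + i).+1%:R^-1).
      by rewrite rmorphB /= !fmorphV /= !rmorph_nat.
    rewrite cabsC ler0_norm ?subr_le0// opprB ler_piMr// subr_ge0//.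
  rewrite le_eqVlt; apply/orP; left; apply/eqP.
  by elim: N {h1} => [|N IHN]; rewrite ?big_ord0 ?addn0 ?subrr// big_ord_recr /= IHN; ring.
have h3 : cabs (m.+1%:R^-1 + \sum_(i < N) ((m + i.+1).+1%:R^-1 - (m + i).+1%:R^-1) * z ^+ i.+1)
   <= m.+1%:R^-1 + (m.+1%:R^-1 - (m + N).+1%:R^-1).
  by apply: le_trans (cabsD _ _) _; rewrite kernel_coef lerD2l.
apply: le_trans (lerD h3 h1) _; move: (m.+1%:R^-1) ((m + N).+1%:R^-1) => u v.
by clear; lra.
Qed.

(** The series is cut at m. Replacing z^i by 1 in the first m terms costs m |1 - z| <= B, the
    harmonic sum differs from log m by at most 1, and the tail is at most 4 because m |1 - z| >=
    1/2. *)
Lemma kernel_log z m (B : R) : (0 < m)%N -> cabs z < 1 -> m%:R * cabs (1 - z) <= B ->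
  1 <= 2 * (m%:R * cabs (1 - z)) ->
  cabs (kernel_series z - real_complex R (ln m%:R)) <= B + 5.
Proof.
case: m => // m _ z1 hB hl.
apply: (ctends_cabs_le (ctendsB (kernel_ctends z1) (ctends_cst _))).
exists m.+1 => N Nm; have -> : N = (m.+1 + (N - m.+1))%N by lia.
move: (N - m.+1)%N => {Nm}N.
rewrite big_split_ord /=.
have -> : \sum_(i < m.+1) i.+1%:R^-1 * z ^+ i =
   \sum_(i < m.+1) i.+1%:R^-1 * (z ^+ i - 1) + real_complex R (\sum_(i < m.+1) i.+1%:R^-1).
  rewrite rmorph_sum /= -big_split /=; apply: eq_bigr => i _.
  by rewrite fmorphV /= rmorph_nat; ring.
set S := \sum_(i < _) _; set H := \sum_(i < _) _; set T := \sum_(i < _) _.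
have hS : cabs S <= B.
  apply: le_trans hB; apply: le_trans (cabs_sum _ _ _) _.
  rewrite -[m.+1 in leRHS]card_ord mulr_natl -sumr_const; apply: ler_sum => i _.
  rewrite cabsM kernel_coef mulrC ler_pdivrMr ?ltr0n//.
  apply: le_trans (cabs_exp_sub1 _ (ltW z1)) _.
  by rewrite mulrC ler_wpM2l ?cabs_ge0// ler_nat leqnSn.
have hH : `|H - ln m.+1%:R| <= 1.
  have /andP[h1 h2] := harmonic_ln m; have /andP[h3 h4] := ln_step m; rewrite ler_norml.
  have : (0 : R) < m.+2%:R^-1 by rewrite invr_gt0 ltr0n.
  move: h1 h2 h3; rewrite -/H; move: (ln m.+2%:R) (ln m.+1%:R) (m.+2%:R^-1) H => a b v H.
  by clear => h1 h2 h3 v0; apply/andP; split; lra.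
have hT : cabs T <= 4.
  have c0 : 0 < cabs (1 - z).
    have n1 : (0 : R) < m.+1%:R by rewrite ltr0n.
    move: n1 hl (cabs_ge0 (1 - z)); move: (m.+1%:R) (cabs _) => a b; clear; nra.
  have eT : T = z ^+ m.+1 * \sum_(i < N) (m.+1 + i).+1%:R^-1 * z ^+ i.
    by rewrite mulr_sumr; apply: eq_bigr => i _; rewrite exprD; ring.
  have h : cabs (1 - z) * cabs T <= 2 / m.+1%:R.
    rewrite -cabsM eT mulrCA cabsM cabsX.
    apply: le_trans (_ : _ <= 2 / m.+2%:R) _.
      apply: le_trans (kernel_tail m.+1 N z1).
      by rewrite ler_piMl ?cabs_ge0// exprn_ile1 ?cabs_ge0 ?ltW.
    by rewrite ler_wpM2l// lef_pV2 ?posrE ?ltr0n// ler_nat.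
  rewrite ler_pdivlMr ?ltr0n// in h.
  rewrite -(ler_pM2l c0) -(@ler_pM2r _ m.+1%:R) ?ltr0n//; apply: le_trans h _.
  move: hl; rewrite mulrC; lra.
have -> : S + real_complex R H + T - real_complex R (ln m.+1%:R) =
    S + real_complex R (H - ln m.+1%:R) + T by rewrite rmorphB /=; ring.
apply: le_trans (cabsD _ _) _; have := cabsD S (real_complex R (H - ln m.+1%:R)).
rewrite cabsC; lra.
Qed.

End Kernel.

(** * Gram matrices in the coefficient inner product *)

Section Gram.
Variable R : realType.
Implicit Types (a b u v : nat -> R[i]).

(** The inner product with weights n + 1, as a relation that also records the convergence of the
    series. *)
Definition gram_limit u v (g : R[i]) : Prop :=
  ctends (fun N => \sum_(n < N) n.+1%:R * (u n * conjc (v n))) g.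

Lemma gram_limitBl u u' v g g' : gram_limit u v g -> gram_limit u' v g' ->
  gram_limit (fun n => u n - u' n) v (g - g').
Proof.
move=> h h'; apply: ctends_ext (ctendsB h h') => N.
by rewrite -sumrB; apply: eq_bigr => n _; rewrite mulrBl mulrBr.
Qed.

Lemma gram_limitBr u v v' g g' : gram_limit u v g -> gram_limit u v' g' ->
  gram_limit u (fun n => v n - v' n) (g - g').
Proof.
move=> h h'; apply: ctends_ext (ctendsB h h') => N.
by rewrite -sumrB; apply: eq_bigr => n _; rewrite rmorphB /= mulrBr mulrBr.
Qed.

(* The Taylor coefficients of the reproducing kernel at y. *)
Definition kernel_vec (y : R[i]) (n : nat) : R[i] := n.+1%:R^-1 * conjc y ^+ n.

Lemma conjc_kernel_vec y n : n.+1%:R * conjc (kernel_vec y n) = y ^+ n.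
Proof.
rewrite /kernel_vec rmorphM /= fmorphV /= rmorph_nat rmorphXn /= conjcK mulVKf//.
Qed.

(** The reproducing property: the weight n + 1 cancels the kernel coefficient 1 / (n + 1). *)
Lemma gram_limit_eval a y : subexponential a -> cabs y < 1 ->
  gram_limit a (kernel_vec y) (cpseries a y).
Proof.
move=> ha y1; apply: ctends_ext (cpseries_ctends ha y1) => N.
by apply: eq_bigr => n _; rewrite -(conjc_kernel_vec y n) mulrCA.
Qed.

Lemma cpseries_kernel_vec x y : cpseries (kernel_vec x) y = kernel_series (y * conjc x).
Proof.
rewrite /kernel_series /cpseries; congr csum; apply/funext => n.
by rewrite exprMn /kernel_vec -mulrA [conjc x ^+ n * _]mulrC.
Qed.

Lemma kernel_vec_le1 y n : cabs y < 1 -> cabs (kernel_vec y n) <= 1.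
Proof.
move=> y1; rewrite cabsM cabsX cabs_conj mulr_ile1 ?cabs_ge0 ?exprn_ge0 ?cabs_ge0//.
  exact: kernel_coef_le1.
by rewrite exprn_ile1 ?cabs_ge0 ?ltW.
Qed.

Lemma bounded_subexponential a (C : R) : (forall n, cabs (a n) <= C) -> subexponential a.
Proof.
move=> aC r /andP[r0 r1]; exists C => n; apply: le_trans (aC n).
by rewrite ler_piMr ?cabs_ge0// exprn_ile1// ltW.
Qed.

Lemma gram_limit_kernel x y : cabs x < 1 -> cabs y < 1 ->
  gram_limit (kernel_vec x) (kernel_vec y) (kernel_series (y * conjc x)).
Proof.
move=> x1 y1; rewrite -cpseries_kernel_vec; apply: gram_limit_eval => //.
by apply: (@bounded_subexponential _ 1) => n; exact: kernel_vec_le1.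
Qed.

(** Truncation only lowers the squared norm, and the full one is the quadratic form of the Gram
    matrix. *)
Lemma gram_upper (xi : nat -> nat -> R[i]) (g : nat -> nat -> R[i]) b I N :
  (forall i j, gram_limit (xi i) (xi j) (g i j)) ->
  \sum_(n < N) n.+1%:R * cabs (\sum_(i < I) b i * xi i n) ^+ 2 <=
  \sum_(i < I) \sum_(j < I) cabs (b i) * cabs (b j) * cabs (g i j).
Proof.
move=> hg.
pose S N := \sum_(n < N) n.+1%:R * cabs (\sum_(i < I) b i * xi i n) ^+ 2.
pose L := \sum_(i < I) \sum_(j < I) (b i * conjc (b j)) * g i j.
have hL : ctends (fun N => real_complex R (S N)) L.
  have hT : ctends (fun M => \sum_(i < I) \sum_(j < I) (b i * conjc (b j)) *
      \sum_(n < M) n.+1%:R * (xi i n * conjc (xi j n))) L.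
    by apply: ctends_sum => i _; apply: ctends_sum => j _; apply: ctendsM; exact: hg.
  apply: ctends_ext hT => M.
  rewrite rmorph_sum /=.
  have -> : \sum_(n < M) real_complex R (n.+1%:R * cabs (\sum_(i < I) b i * xi i n) ^+ 2) =
     \sum_(n < M) \sum_(i < I) \sum_(j < I) (b i * conjc (b j)) * (n.+1%:R * (xi i n * conjc (xi j n))).
    apply: eq_bigr => n _; rewrite rmorphM /= -mulc_conj rmorph_nat rmorph_sum /=.
    rewrite mulr_suml mulr_sumr; apply: eq_bigr => i _.
    rewrite mulr_sumr mulr_sumr; apply: eq_bigr => j _.
    by rewrite rmorphM /=; ring.
  apply/esym; rewrite exchange_big; apply: eq_bigr => i _.
  rewrite exchange_big; apply: eq_bigr => j _.
  by rewrite mulr_sumr.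
have mono M : (N <= M)%N -> S N <= S M.
  move=> NM; rewrite /S -(subnKC NM) big_split_ord /= lerDl sumr_ge0// => n _.
  by rewrite mulr_ge0// sqr_ge0.
have h : S N <= complex.Re L.
  by apply: (ctends_Re_ge hL); exists N => M /mono.
apply: le_trans h _; apply: le_trans (Re_le_cabs _) _; apply: le_trans (cabs_sum _ _ _) _.
apply: ler_sum => i _; apply: le_trans (cabs_sum _ _ _) _; apply: ler_sum => j _.
by rewrite !cabsM cabs_conj.
Qed.

Lemma cauchy_schwarz (x y : nat -> R) N :
  (\sum_(i < N) x i * y i) ^+ 2 <= (\sum_(i < N) x i ^+ 2) * (\sum_(i < N) y i ^+ 2).
Proof.
elim: N => [|N IHN]; first by rewrite !big_ord0 expr0n mul0r.
rewrite !big_ord_recr /=.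
have X0 : 0 <= \sum_(i < N) x i ^+ 2 by apply: sumr_ge0 => i _; exact: sqr_ge0.
have Y0 : 0 <= \sum_(i < N) y i ^+ 2 by apply: sumr_ge0 => i _; exact: sqr_ge0.
move: IHN X0 Y0; move: (\sum_(i < N) _) (\sum_(i < N) _) (\sum_(i < N) _) (x N) (y N).
clear=> Y X S p q SXY X0 Y0.
(* For the cross term: square, use S^2 <= X Y, and compare 4 u v with (u + v)^2. *)
suff h : 2 * (S * (p * q)) <= X * q ^+ 2 + Y * p ^+ 2 by nra.
apply: le_trans (ler_norm _) _; rewrite -ler_sqr ?nnegrE ?normr_ge0//; last first.
  by rewrite addr_ge0// mulr_ge0// sqr_ge0.
rewrite real_normK ?num_real//.
apply: le_trans (_ : 4 * (X * q ^+ 2) * (Y * p ^+ 2) <= _); last first.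
  by move: (X * _) (Y * _) => u v; have := sqr_ge0 (u - v); nra.
have -> : (2 * (S * (p * q))) ^+ 2 = 4 * (p * q) ^+ 2 * S ^+ 2 by ring.
have -> : 4 * (X * q ^+ 2) * (Y * p ^+ 2) = 4 * (p * q) ^+ 2 * (X * Y) by ring.
by rewrite ler_wpM2l// mulr_ge0// sqr_ge0.
Qed.

(** The diagonal gives sum A_i |b_i|^2. The rest is at most (sum p_i eta_i)^2 with p_i = |b_i| sqrt
    A_i, and by Cauchy-Schwarz this is again at most that sum. *)
Lemma riesz_upper (xi g : nat -> nat -> R[i]) (A eta : nat -> R) b I N :
  (forall i j, gram_limit (xi i) (xi j) (g i j)) ->
  (forall i, 0 <= A i) -> (forall i, 0 <= eta i) ->
  (forall n, \sum_(i < n) eta i ^+ 2 <= 1) ->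
  (forall i j, cabs (g i j - real_complex R (A i *+ (i == j))) <=
     eta i * eta j * (Num.sqrt (A i) * Num.sqrt (A j))) ->
  \sum_(n < N) n.+1%:R * cabs (\sum_(i < I) b i * xi i n) ^+ 2 <=
  2 * \sum_(i < I) A i * cabs (b i) ^+ 2.
Proof.
move=> hg A0 eta0 eta1 hA; apply: le_trans (gram_upper b I N hg) _.
pose p i := cabs (b i) * Num.sqrt (A i).
have sq i : A i * cabs (b i) ^+ 2 = p i ^+ 2 by rewrite exprMn sqr_sqrtr// mulrC.
apply: le_trans (_ : \sum_(i < I) \sum_(j < I)
  ((cabs (b i) * cabs (b j) * A i) *+ (i == j) + (p i * eta i) * (p j * eta j)) <= _).
  apply: ler_sum => i _; apply: ler_sum => j _.
  have h : cabs (g i j) <= A i *+ (i == j) + eta i * eta j * (Num.sqrt (A i) * Num.sqrt (A j)).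
    have := hA i j; have := cabsD (g i j - real_complex R (A i *+ (i == j :> nat))) (real_complex R (A i *+ (i == j :> nat))).
    rewrite subrK cabsC ger0_norm ?mulrn_wge0// => h1 h2.
    by apply: le_trans h1 _; rewrite addrC lerD2l.
  apply: le_trans (ler_wpM2l _ h) _; first by rewrite mulr_ge0 ?cabs_ge0.
  rewrite mulrDr -mulrnAr le_eqVlt; apply/orP; left; apply/eqP; rewrite /p; ring.
under eq_bigr do rewrite big_split /=.
rewrite big_split /= mulr_natl mulr2n lerD//.
  apply: ler_sum => i _; rewrite (bigD1 i)//= eqxx mulr1n big1 ?addr0; last first.
    by move=> j; rewrite eq_sym => /negbTE ->.
  by rewrite mulrC expr2.
have -> : \sum_(i < I) \sum_(j < I) p i * eta i * (p j * eta j) = (\sum_(i < I) p i * eta i) ^+ 2.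
  by rewrite expr2 mulr_suml; apply: eq_bigr => i _; rewrite mulr_sumr.
apply: le_trans (cauchy_schwarz p eta I) _.
under [leRHS]eq_bigr do rewrite sq.
by rewrite ler_piMr// sumr_ge0// => i _; exact: sqr_ge0.
Qed.

(** Cauchy-Schwarz between [a] and the combination of the [xi i], taken on partial sums and passed
    to the limit. *)
Lemma pairing_bound a (xi : nat -> nat -> R[i]) (p b : nat -> R[i]) I (B V : R) :
  (forall N, \sum_(n < N) n.+1%:R * cabs (a n) ^+ 2 <= B) ->
  (forall N, \sum_(n < N) n.+1%:R * cabs (\sum_(i < I) b i * xi i n) ^+ 2 <= V) ->
  (forall i, (i < I)%N -> gram_limit a (xi i) (p i)) ->
  cabs (\sum_(i < I) conjc (b i) * p i) ^+ 2 <= B * V.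
Proof.
move=> aB bV hp.
have B0 : 0 <= B by have := aB 0%N; rewrite big_ord0.
have V0 : 0 <= V by have := bV 0%N; rewrite big_ord0.
suff h : cabs (\sum_(i < I) conjc (b i) * p i) <= Num.sqrt (B * V).
  have BV0 : 0 <= B * V by rewrite mulr_ge0.
  by rewrite -(sqr_sqrtr BV0) ler_sqr ?nnegrE ?cabs_ge0 ?sqrtr_ge0.
have hT : ctends (fun N => \sum_(i < I) conjc (b i) *
    \sum_(n < N) n.+1%:R * (a n * conjc (xi i n))) (\sum_(i < I) conjc (b i) * p i).
  by apply: ctends_sum => i _; apply: ctendsM; exact: hp.
apply: (ctends_cabs_le hT); exists 0%N => N _ /=.
have -> : \sum_(i < I) conjc (b i) * (\sum_(n < N) n.+1%:R * (a n * conjc (xi i n))) =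
   \sum_(n < N) n.+1%:R * (a n * conjc (\sum_(i < I) b i * xi i n)).
  under eq_bigr do rewrite mulr_sumr.
  rewrite exchange_big; apply: eq_bigr => n _.
  rewrite rmorph_sum /= mulr_sumr mulr_sumr; apply: eq_bigr => i _.
  by rewrite rmorphM /=; ring.
apply: le_trans (cabs_sum _ _ _) _.
have T0 : 0 <= \sum_(n < N) cabs (n.+1%:R * (a n * conjc (\sum_(i < I) b i * xi i n))).
  by apply: sumr_ge0 => n _; exact: cabs_ge0.
rewrite -ler_sqr ?nnegrE ?sqrtr_ge0//.
rewrite sqr_sqrtr ?mulr_ge0//.
pose s n : R := Num.sqrt n.+1%:R.
have ss n : s n ^+ 2 = n.+1%:R by rewrite sqr_sqrtr.
pose v n := cabs (\sum_(i < I) b i * xi i n).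
have -> : \sum_(n < N) cabs (n.+1%:R * (a n * conjc (\sum_(i < I) b i * xi i n))) =
  \sum_(n < N) (s n * cabs (a n)) * (s n * v n).
  by apply: eq_bigr => n _; rewrite !cabsM cabs_conj cabs_nat -ss /v; ring.
apply: le_trans (@cauchy_schwarz (fun n => s n * cabs (a n)) (fun n => s n * v n) N) _.
have e (w : nat -> R) : \sum_(n < N) (s n * w n) ^+ 2 = \sum_(n < N) n.+1%:R * w n ^+ 2.
  by apply: eq_bigr => n _; rewrite exprMn ss.
rewrite (e (fun n => cabs (a n))) (e v).
by apply: ler_pM (aB N) (bV N); apply: sumr_ge0 => n _; rewrite mulr_ge0// sqr_ge0.
Qed.

End Gram.

(** * Exchange of double series and a Neumann series *)

Section Neumann.
Variable R : realType.
Implicit Types (a b u v : nat -> R[i]) (B C q : R).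

Lemma half_sum C n : 0 <= C -> \sum_(i < n) C / 2 ^+ i <= 2 * C.
Proof.
move=> C0; rewrite -mulr_sumr mulrC ler_wpM2r//.
have := @geometric_partial_le _ (2^-1 : R) n; rewrite invr_ge0 ler0n invf_lt1 ?ltr1n// => /(_ isT).
have -> : (1 - 2^-1)^-1 = 2 :> R by field.
by under eq_bigr do rewrite exprVn.
Qed.

Lemma half_csum_abs u C : 0 <= C -> (forall i, cabs (u i) <= C / 2 ^+ i) ->
  forall n, \sum_(i < n) cabs (u i) <= 2 * C.
Proof.
by move=> C0 uC n; apply: le_trans (half_sum n C0); apply: ler_sum => i _; exact: uC.
Qed.

Lemma half_csum_tail u C n : 0 <= C -> (forall i, cabs (u i) <= C / 2 ^+ i) ->
  cabs (csum u - \sum_(i < n) u i) <= 2 * C / 2 ^+ n.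
Proof.
move=> C0 uC.
apply: (ctends_cabs_le (ctendsB (asum_ctends (half_csum_abs C0 uC)) (ctends_cst _))).
exists n => m nm; rewrite -(subnKC nm) big_split_ord /= [_ + _ - _]addrC addKr.
apply: le_trans (cabs_sum _ _ _) _.
rewrite -mulrA; apply: le_trans (half_sum (m - n) _); last by rewrite divr_ge0// exprn_ge0.
by apply: ler_sum => i _; apply: le_trans (uC _) _; rewrite exprD invfM mulrA.
Qed.

Lemma pow2_small e : 0 < e -> exists N, forall n, (N <= n)%N -> (2 ^+ n)^-1 <= e :> R.
Proof.
move=> e0; have [|N HN] := @pow_small _ (2^-1 : R) e _ e0.
  by rewrite invr_ge0 ler0n invf_lt1 ?ltr1n.
by exists N => n /HN; rewrite exprVn.
Qed.

(** Domination by a product of geometric sequences makes the tail in i uniformly small after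
    summation over n. *)
Lemma csum_exchange (u : nat -> nat -> R[i]) C q : 0 <= q < 1 -> 0 <= C ->
  (forall i n, cabs (u i n) <= C / 2 ^+ i * q ^+ n) ->
  csum (fun n => csum (fun i => u i n)) = csum (fun i => csum (u i)).
Proof.
move=> q01 C0 uC; have /andP[q0 q1] := q01.
have Cq n : 0 <= C * q ^+ n by rewrite mulr_ge0// exprn_ge0.
have uC' n i : cabs (u i n) <= C * q ^+ n / 2 ^+ i by rewrite mulrAC; exact: uC.
have D0 : 0 <= (1 - q)^-1 by rewrite invr_ge0 subr_ge0 ltW.
have qsum K N : 0 <= K -> \sum_(n < N) K * q ^+ n <= K * (1 - q)^-1.
  by move=> K0; rewrite -mulr_sumr ler_wpM2l//; exact: geometric_partial_le.
have c1 N : \sum_(n < N) cabs (csum (fun i => u i n)) <= 2 * C * (1 - q)^-1.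
  apply: le_trans (qsum _ N _); last by rewrite mulr_ge0.
  apply: ler_sum => n _; rewrite -mulrA; apply: csum_cabs_le => m.
  exact: half_csum_abs (Cq n) (uC' n) m.
have c2 i N : \sum_(n < N) cabs (u i n) <= C / 2 ^+ i * (1 - q)^-1.
  apply: le_trans (qsum _ N _); last by rewrite divr_ge0// exprn_ge0.
  by apply: ler_sum => n _.
apply/esym/csum_ctends => e e0.
pose K := 2 * C * (1 - q)^-1.
have K0 : 0 <= K by rewrite mulr_ge0// mulr_ge0.
have [|N HN] := @pow2_small (e / (K + 1)).
  by rewrite divr_gt0// ltr_wpDl.
exists N => I NI.
have eI : \sum_(i < I) csum (u i) = csum (fun n => \sum_(i < I) u i n).
  by rewrite (@csum_sum _ _ _ _ _ (fun i : 'I_I => C / 2 ^+ i * (1 - q)^-1)) => [|i _ n]; last exact: c2.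
have c3 M : \sum_(n < M) cabs (csum (fun i => u i n) - \sum_(i < I) u i n) <= K / 2 ^+ I.
  apply: le_trans (_ : _ <= (2 * C / 2 ^+ I) * (1 - q)^-1) _; last by rewrite /K mulrAC.
  apply: le_trans (qsum _ M _); last by rewrite divr_ge0 ?mulr_ge0// exprn_ge0.
  apply: ler_sum => n _; apply: le_trans (half_csum_tail I (Cq n) (uC' n)) _.
  rewrite le_eqVlt; apply/orP; left; apply/eqP; ring.
rewrite eI cabsBC.
have -> : csum (fun n => csum (fun i => u i n)) - csum (fun n => \sum_(i < I) u i n) =
    csum (fun n => csum (fun i => u i n) - \sum_(i < I) u i n).
  apply/esym; have c4 M : \sum_(n < M) cabs (\sum_(i < I) u i n) <= \sum_(i < I) C / 2 ^+ i * (1 - q)^-1.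
    apply: le_trans (_ : \sum_(n < M) \sum_(i < I) cabs (u i n) <= _).
      by apply: ler_sum => n _; exact: cabs_sum.
    by rewrite exchange_big; apply: ler_sum => i _; exact: c2.
  apply: csum_ctends.
  apply: ctends_ext (ctendsB (asum_ctends c1) (asum_ctends c4)) => M.
  by rewrite sumrB.
apply: le_trans (csum_cabs_le c3) _.
apply: le_trans (ler_wpM2l K0 (HN _ NI)) _.
have K1 : 0 < K + 1 by rewrite ltr_wpDl.
by rewrite mulrCA ger_pMr// ler_pdivrMr// mul1r lerDl.
Qed.

(** Weights for the deviation from orthogonality. The shift by 4 gives 9 eta_i <= 2^-i, which makes
    the operator in [neumann] a contraction. *)
Definition eta (i : nat) : R := (2 ^+ (i + 4))^-1.

Lemma etaE i : eta i = 16^-1 / 2 ^+ i.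
Proof. by rewrite /eta exprD invfM mulrC; congr (_^-1 * _); ring. Qed.

Lemma eta_gt0 i : 0 < eta i.
Proof. by rewrite invr_gt0 exprn_gt0. Qed.

Lemma eta_le i : eta i <= 16^-1.
Proof.
by rewrite etaE ler_piMr ?invr_ge0// invf_le1 ?exprn_gt0// -natrX ler1n expn_gt0.
Qed.

Lemma eta_sum n : \sum_(i < n) eta i <= 8^-1.
Proof.
under eq_bigr do rewrite etaE.
by apply: le_trans (half_sum n _) _; rewrite ?invr_ge0//; lra.
Qed.

Lemma eta_sqr_sum n : \sum_(i < n) eta i ^+ 2 <= 1.
Proof.
apply: le_trans (_ : \sum_(i < n) eta i <= _); last by apply: le_trans (eta_sum n) _; lra.
apply: ler_sum => i _; rewrite expr2 ler_piMl ?(ltW (eta_gt0 i))//.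
by apply: le_trans (eta_le i) _; lra.
Qed.

(** The iteration runs in the bounded sequences, with contraction factor 1/2. The bound b - a =
    O(eta) is what later carries square summability from a to b. *)
Lemma neumann (G : nat -> nat -> R[i]) a B : 0 <= B -> (forall i, cabs (a i) <= B) ->
  (forall i j, cabs (G i j) <= 9 * (eta i * eta j)) ->
  exists b, [/\ (forall i, cabs (b i) <= 2 * B),
    (forall j, cabs (b j - a j) <= 4 * B * eta j) &
    forall j, b j + csum (fun i => b i * G i j) = a j].
Proof.
move=> B0 aB hG.
pose E b j := csum (fun i => b i * G i j).
have termE K b i j : 0 <= K -> (forall i, cabs (b i) <= K) -> cabs (b i * G i j) <= K * eta j / 2 ^+ i.
  move=> K0 bK; rewrite cabsM; apply: le_trans (ler_pM _ _ (bK i) (hG i j)) _; rewrite ?cabs_ge0//.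
  have -> : K * (9 * (eta i * eta j)) = K * eta j * (9 * eta i) by ring.
  rewrite ler_wpM2l ?mulr_ge0 ?(ltW (eta_gt0 j))// etaE.
  rewrite mulrA ler_piMl ?invr_ge0 ?exprn_ge0//; lra.
have sumE K b j : 0 <= K -> (forall i, cabs (b i) <= K) ->
    forall n, \sum_(i < n) cabs (b i * G i j) <= 2 * (K * eta j).
  move=> K0 bK; apply: (@half_csum_abs (fun i => b i * G i j)); first by rewrite mulr_ge0// ltW// eta_gt0.
  by move=> i; exact: termE.
have boundE K b j : 0 <= K -> (forall i, cabs (b i) <= K) -> cabs (E b j) <= 2 * (K * eta j).
  by move=> K0 bK; apply: (@csum_cabs_le _ (fun i => b i * G i j)); exact: sumE.
have boundE' K b j : 0 <= K -> (forall i, cabs (b i) <= K) -> cabs (E b j) <= K / 2.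
  move=> K0 bK; apply: le_trans (boundE K b j K0 bK) _.
  have -> : 2 * (K * eta j) = K * (2 * eta j) by ring.
  by rewrite ler_wpM2l//; have := eta_le j; lra.
(* The terms of the Neumann series, t_s = (- E)^s a. *)
pose t s := iter s (fun v j => - E v j) a.
have tB s i : cabs (t s i) <= B / 2 ^+ s.
  elim: s i => [|s IHs] i; first by rewrite expr0 divr1; exact: aB.
  rewrite /= cabsN exprS invfM mulrCA mulrC.
  by apply: boundE' => //; rewrite divr_ge0// exprn_ge0.
pose b j := csum (fun s => t s j).
pose S n j := \sum_(s < n) t s j.
have bS n j : cabs (b j - S n j) <= 2 * B / 2 ^+ n by apply: half_csum_tail.
have bB i : cabs (b i) <= 2 * B by have := bS 0%N i; rewrite /S big_ord0 subr0 expr0 divr1.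
have eS n j : S n.+1 j = a j - E (S n) j.
  rewrite /S big_ord_recl /=; congr (_ + _).
  have -> : E (S n) j = \sum_(s < n) E (t s) j.
    apply: etrans (@csum_sum _ _ _ _ (fun (s : 'I_n) i => t s i * G i j)
      (fun s : 'I_n => 2 * (B / 2 ^+ s * eta j)) _).
      by congr csum; apply/funext => i; rewrite /S mulr_suml.
    by move=> s _; apply: sumE => //; rewrite divr_ge0// exprn_ge0.
  by rewrite -sumrN; apply: eq_bigr => s _.
have solve j : b j + E b j = a j.
  apply/eqP; rewrite -subr_eq0 -cabs_eq0 eq_le cabs_ge0 andbT.
  apply: (@le_of_eps _ _ _ (4 * B)); first by rewrite mulr_ge0.
  move=> e e0; rewrite add0r; have [N HN] := pow2_small e0.
  have h2 := ler_wpM2l B0 (HN N (leqnn _)).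
  have hB : 0 <= 2 * B / 2 ^+ N by rewrite divr_ge0 ?mulr_ge0// exprn_ge0.
  have -> : b j + E b j - a j = (b j - S N.+1 j) + E (fun i => b i - S N i) j.
    have -> : E (fun i => b i - S N i) j = E b j - E (S N) j.
      apply: csum_ctends.
      have SB i : cabs (S N i) <= 4 * B.
        have -> : S N i = b i - (b i - S N i) by ring.
        apply: le_trans (cabsB _ _) _.
        apply: le_trans (lerD (bB i) (bS N i)) _.
        have : 2 * B / 2 ^+ N <= 2 * B.
          by rewrite ler_piMr ?mulr_ge0// invf_le1 ?exprn_gt0// -natrX ler1n expn_gt0.
        by move: (2 * B / 2 ^+ N) => w; lra.
      have B2 : 0 <= 2 * B by rewrite mulr_ge0.
      have B4 : 0 <= 4 * B by rewrite mulr_ge0.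
      apply: ctends_ext (ctendsB (asum_ctends (sumE _ b j B2 bB)) (asum_ctends (sumE _ (S N) j B4 SB))) => M.
      by rewrite -sumrB; apply: eq_bigr => i _; rewrite mulrBl.
    by rewrite eS; ring.
  apply: le_trans (cabsD _ _) _.
  have h3 := boundE' _ (fun i => b i - S N i) j hB (bS N).
  have h4 := bS N.+1 j.
  have : 2 * B / 2 ^+ N.+1 = B / 2 ^+ N by rewrite exprS; field; rewrite expf_neq0 ?pnatr_eq0.
  have h5 : 2 * B / 2 ^+ N = 2 * (B / 2 ^+ N) by rewrite mulrA.
  move=> h6; rewrite h6 in h4; rewrite h5 in h3.
  apply: le_trans (lerD h4 h3) _; move: h2; move: (B / 2 ^+ N) => w.
  have : 0 <= B * e by rewrite mulr_ge0// ltW.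
  lra.
exists b; split => // j.
have -> : b j - a j = - E b j by rewrite -solve; ring.
rewrite cabsN; apply: le_trans (boundE (2 * B) b j _ bB) _; first by rewrite mulr_ge0.
by rewrite le_eqVlt; apply/orP; left; apply/eqP; ring.
Qed.

End Neumann.

(** * Interpolation by almost dual vectors *)

Section Interpolation.
Variable R : realType.
Implicit Types (a b u v x : nat -> R[i]).

Lemma ctends_sqr_sum_le (v : nat -> nat -> R[i]) (l : nat -> R[i]) (w : nat -> R) N V :
  (forall i, ctends (v i) (l i)) ->
  (forall I, \sum_(i < N) w i * cabs (v i I) ^+ 2 <= V) ->
  \sum_(i < N) w i * cabs (l i) ^+ 2 <= V.
Proof.
move=> vl vV.
have h : (fun I => \sum_(i < N) w i * cabs (v i I) ^+ 2) @ \oo -->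
    (\sum_(i < N) w i * cabs (l i) ^+ 2 : R).
  elim: N {vV} => [|N IHN].
    by under eq_fun do rewrite big_ord0; rewrite big_ord0; exact: cvg_cst.
  under eq_fun do rewrite big_ord_recr /=; rewrite big_ord_recr /=.
  by apply: cvgD IHN _; apply: cvgM; [exact: cvg_cst|exact: ctends_cabs_sqr].
by apply: (cvgr_to_le h); apply: nearW => I; exact: vV.
Qed.

Lemma nneseries_le (c : nat -> R) V : (forall i, 0 <= c i) ->
  (forall N, \sum_(i < N) c i <= V) -> (\sum_(0 <= i <oo) (c i)%:E <= V%:E)%E.
Proof.
move=> c0 cV; apply: lime_le; first by apply: is_cvg_nneseries => i _ _; rewrite lee_fin.
by apply: nearW => N; rewrite big_mkord sumEFin lee_fin.
Qed.

Lemma little_l2_bound a : little_l2 a -> exists V : R, forall N, \sum_(i < N) cabs (a i) ^+ 2 <= V.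
Proof.
rewrite /little_l2 /= => afin; exists (fine (l2_sqnorm a)) => N.
have c0 i : (0 <= (cabs (a i) ^+ 2)%:E)%E by rewrite lee_fin sqr_ge0.
rewrite -lee_fin fineK; last by rewrite ge0_fin_numE//; apply: nneseries_ge0 => i _ _.
rewrite -sumEFin -(big_mkord xpredT (fun i => (cabs (a i) ^+ 2)%:E)).
by apply: nneseries_lim_ge => n _ _.
Qed.

(** The [xi i] are almost dual to the evaluations at the [x j]. After scaling the diagonal to 1, the
    interpolation equations have matrix I + G with G = O(eta_i eta_j), which [neumann] inverts, and
    [riesz_upper] puts the solution in the space. The condition 1 <= sqrt A_i eta_i makes the sum
    over i converge absolutely in each coefficient. *)
Lemma interpolation x (xi g : nat -> nat -> R[i]) (A : nat -> R) :
  in_disc x -> (forall i, 1 <= Num.sqrt (A i) * eta R i) ->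
  (forall i, A i / 2 <= kernel_sqnorm (x i) <= 9 * A i) ->
  (forall i n, cabs (xi i n) <= 2) ->
  (forall i j, gram_limit (xi i) (xi j) (g i j)) ->
  (forall i j, cabs (g i j - real_complex R (A i *+ (i == j))) <=
     eta R i * eta R j * (Num.sqrt (A i) * Num.sqrt (A j))) ->
  (forall i j, cabs (cpseries (xi i) (x j) - real_complex R (A i *+ (i == j))) <=
     eta R i * eta R j * (Num.sqrt (A i) * Num.sqrt (A j))) ->
  onto_interpolating x.
Proof.
move=> x1 sA hd xi2 hg hgA hF a al2.
have eta0 := eta_gt0 R.
have s0 i : 0 < Num.sqrt (A i).
  by have := sA i; have := eta0 i; have := sqrtr_ge0 (A i); move: (Num.sqrt _) (eta R i) => s e; nra.
have A0 i : 0 < A i by rewrite -sqrtr_gt0.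
have sq i : Num.sqrt (A i) ^+ 2 = A i by rewrite sqr_sqrtr// ltW.
pose d i := Num.sqrt (kernel_sqnorm (x i)).
have d2 i : d i ^+ 2 = kernel_sqnorm (x i).
  by rewrite sqr_sqrtr//; have /andP[h _] := hd i; apply: le_trans h; rewrite divr_ge0// ltW.
have d_up i : d i <= 3 * Num.sqrt (A i).
  rewrite -ler_sqr ?nnegrE ?sqrtr_ge0 ?mulr_ge0// ?sqrtr_ge0// exprMn sq d2.
  by have /andP[_ h] := hd i; apply: le_trans h _; rewrite -natrX.
have d_lo i : 2 / 3 * Num.sqrt (A i) <= d i.
  rewrite -ler_sqr ?nnegrE ?sqrtr_ge0 ?mulr_ge0// ?sqrtr_ge0// exprMn sq d2.
  by have /andP[h _] := hd i; apply: le_trans _ h; have := A0 i; nra.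
have d0 i : 0 < d i by apply: lt_le_trans (d_lo i); rewrite mulr_gt0.
have dn0 i : real_complex R (d i) != 0 by rewrite fmorph_eq0 gt_eqF.
pose F i j := cpseries (xi i) (x j).
have Fii i : A i / 2 <= cabs (F i i).
  have := hF i i; rewrite eqxx mulr1n -/(F i i) cabsBC => h.
  have := le_trans (cabsB_ge (real_complex R (A i)) (F i i)) h.
  rewrite cabsC gtr0_norm// -[Num.sqrt _ * _]expr2 sq.
  have := eta_le R i; have := eta0 i; have := A0 i; move: (A i) (cabs _) (eta R i); clear.
  move=> p q e p0 e0 e1 h1; have : e * e <= 1 / 4 by nra.
  by move=> h2; have : e * e * p <= 1/4 * p by [rewrite ler_wpM2r// ltW]; lra.
have Fn0 i : F i i != 0.
  by rewrite -cabs_eq0 gt_eqF//; apply: lt_le_trans (Fii i); rewrite divr_gt0.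
(* With this factor the normalized value of [xi i] at its own node is 1. *)
pose be i := real_complex R (d i) / F i i.
have be_le i : cabs (be i) <= 6 / Num.sqrt (A i).
  rewrite cabsM cabsV cabsC gtr0_norm// ler_pdivrMr; last by rewrite cabs_gt0.
  apply: le_trans (d_up i) _; apply: le_trans (ler_wpM2l _ (Fii i)); last by rewrite divr_ge0// ltW.
  have e3 (s p : R) : 0 < s -> s ^+ 2 = p -> 6 / s * (p / 2) = 3 * s.
    by move=> sp <-; field; rewrite gt_eqF.
  by rewrite (e3 _ _ (s0 i) (sq i)).
(* The off-diagonal part; its constant 9 is 6 / (2/3), from [be_le] and [d_lo]. *)
pose G i j := if i == j then 0 else be i * F i j / real_complex R (d j).
have hG i j : cabs (G i j) <= 9 * (eta R i * eta R j).
  rewrite /G; case: eqP => [_|/eqP ij].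
    by rewrite cabs0 mulr_ge0// mulr_ge0// ltW.
  rewrite cabsM cabsV (cabsC (d j)) gtr0_norm// ler_pdivrMr// cabsM.
  have := hF i j; rewrite (negbTE ij) mulr0n subr0 => h.
  apply: le_trans (ler_pM _ _ (be_le i) h) _; rewrite ?cabs_ge0//.
  apply: le_trans (_ : 9 * (eta R i * eta R j) * (2 / 3 * Num.sqrt (A j)) <= _); last first.
    by rewrite ler_wpM2l// mulr_ge0// mulr_ge0// ltW.
  have s_neq0 : Num.sqrt (A i) != 0 by rewrite gt_eqF.
  by rewrite le_eqVlt; apply/orP; left; apply/eqP; field.
have [Va HVa] := little_l2_bound al2.
have Va0 : 0 <= Va by have := HVa 0%N; rewrite big_ord0.
pose B := 1 + Va.
have B0 : 0 <= B by rewrite addr_ge0.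
have aB i : cabs (a i) <= B.
  have : cabs (a i) ^+ 2 <= Va.
    by apply: le_trans (HVa i.+1); rewrite big_ord_recr /= lerDr sumr_ge0// => j _; exact: sqr_ge0.
  by rewrite /B; have := cabs_ge0 (a i); move: (cabs _) => y; nra.
have [b [bB ba bsolve]] := neumann B0 aB hG.
pose e i n := b i * (be i * xi i n).
have eB i n : cabs (e i n) <= 24 * B / 16 / 2 ^+ i.
  rewrite /e 2!cabsM.
  have h1 : cabs (be i) <= 6 * eta R i.
    apply: le_trans (be_le i) _; rewrite ler_pdivrMr// -mulrA [eta R i * _]mulrC.
    by rewrite ler_peMr.
  have -> : 24 * B / 16 / 2 ^+ i = 2 * B * (6 * eta R i * 2) by rewrite etaE; field; rewrite expf_neq0 ?pnatr_eq0.
  by apply: ler_pM => //; rewrite ?mulr_ge0 ?cabs_ge0//; apply: ler_pM; rewrite ?cabs_ge0.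
have K0 : 0 <= 24 * B / 16 by rewrite divr_ge0 ?mulr_ge0.
pose phi n := csum (fun i => e i n).
have phi_lim n : ctends (fun I => \sum_(i < I) e i n) (phi n).
  exact: asum_ctends (half_csum_abs K0 (fun i => eB i n)).
have bV I : \sum_(i < I) cabs (b i) ^+ 2 <= 2 * Va + 2 * (16 * B ^+ 2).
  apply: le_trans (_ : \sum_(i < I) (2 * cabs (a i) ^+ 2 + 2 * (16 * B ^+ 2) * eta R i ^+ 2) <= _).
    apply: ler_sum => i _.
    have h1 : cabs (b i) <= cabs (a i) + 4 * B * eta R i.
      have -> : b i = a i + (b i - a i) by ring.
      by apply: le_trans (cabsD _ _) _; rewrite lerD2l.
    apply: le_trans (_ : (cabs (a i) + 4 * B * eta R i) ^+ 2 <= _).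
      have h2 := le_trans (cabs_ge0 _) h1.
      by rewrite ler_sqr ?nnegrE ?cabs_ge0.
    have -> : 2 * (16 * B ^+ 2) * eta R i ^+ 2 = 2 * (4 * B * eta R i) ^+ 2 by ring.
    move: (cabs _) (4 * _ * _) => p q; have := sqr_ge0 (p - q); nra.
  rewrite big_split /=; apply: lerD; rewrite -mulr_sumr; first by rewrite ler_wpM2l// HVa.
  by rewrite ler_piMr ?mulr_ge0 ?sqr_ge0//; exact: eta_sqr_sum.
(* 72 = 2 * 36: the factor 2 of [riesz_upper] times A_i |be_i|^2 <= 36. *)
have phiV N : \sum_(n < N) n.+1%:R * cabs (phi n) ^+ 2 <= 72 * (2 * Va + 2 * (16 * B ^+ 2)).
  apply: (@ctends_sqr_sum_le (fun n I => \sum_(i < I) e i n) phi (fun n => n.+1%:R) N _ phi_lim) => I.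
  have := riesz_upper (fun i => b i * be i) I N hg (fun i => ltW (A0 i)) (fun i => ltW (eta0 i))
     (eta_sqr_sum R) hgA.
  have -> : \sum_(n < N) n.+1%:R * cabs (\sum_(i < I) b i * be i * xi i n) ^+ 2 =
    \sum_(n < N) n.+1%:R * cabs (\sum_(i < I) e i n) ^+ 2.
    by apply: eq_bigr => n _; congr (_ * cabs _ ^+ 2); apply: eq_bigr => i _; rewrite /e mulrA.
  move=> h; apply: le_trans h _.
  apply: le_trans (_ : 2 * \sum_(i < I) 36 * cabs (b i) ^+ 2 <= _).
    rewrite ler_pM2l//; apply: ler_sum => i _; rewrite cabsM exprMn mulrCA mulrC.
    apply: ler_wpM2r; first exact: sqr_ge0.
    have e3 (s p : R) : 0 < s -> s ^+ 2 = p -> 36 = p * (6 / s) ^+ 2.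
      by move=> sp <-; field; rewrite gt_eqF.
    rewrite (e3 _ _ (s0 i) (sq i)).
    have h6 := le_trans (cabs_ge0 _) (be_le i).
    by rewrite ler_wpM2l ?(ltW (A0 i))// ler_sqr ?nnegrE ?cabs_ge0.
  by rewrite -mulr_sumr mulrA -natrM ler_wpM2l.
have [hphi hdir] := dirichlet_upper phiV.
exists (cpseries phi) => // j; rewrite /weighted_restriction -/(d j).
apply: (canLR (mulfK (dn0 j))).
have xj1 : cabs (x j) < 1 := x1 j.
rewrite -(bsolve j).
have exch : cpseries phi (x j) = csum (fun i => b i * be i * F i j).
  have -> : cpseries phi (x j) = csum (fun n => csum (fun i => e i n * x j ^+ n)).
    congr csum; apply/funext => n; rewrite mulrC.
    rewrite -(@csumM _ (fun i => e i n) _ _ (half_csum_abs K0 (fun i => eB i n))).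
    by congr csum; apply/funext => i; rewrite mulrC.
  rewrite (@csum_exchange _ (fun i n => e i n * x j ^+ n) (24 * B / 16) (cabs (x j))) ?cabs_ge0//; last first.
    by move=> i n; rewrite cabsM cabsX ler_wpM2r ?exprn_ge0 ?cabs_ge0.
  congr csum; apply/funext => i; rewrite /F /cpseries.
  have [BB HBB] := cpseries_abs (bounded_subexponential (xi2 i)) xj1.
  rewrite -(csumM _ HBB); congr csum; apply/funext => n; rewrite /e; ring.
rewrite exch.
have Ej : ctends (fun I => \sum_(i < I) b i * G i j) (csum (fun i => b i * G i j)).
  apply: (@asum_ctends _ _ (2 * (2 * B))) => n.
  apply: (@half_csum_abs _ (fun i => b i * G i j)); first by rewrite mulr_ge0.
  move=> i; rewrite cabsM; apply: ler_pM (bB i) _; rewrite ?cabs_ge0//.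
  apply: le_trans (hG i j) _; rewrite etaE.
  have := eta_le R j; have := eta0 j; have : (0 : R) < (2 ^+ i)^-1 by rewrite invr_gt0 exprn_gt0.
  by move: (_^-1) (eta R j) => p q; nra.
have hdelta : ctends (fun I => \sum_(i < I) b i *+ (i == j :> nat)) (b j).
  move=> eps eps0; exists j.+1 => I jI.
  rewrite (bigD1 (Ordinal jI))//= eqxx mulr1n big1 ?addr0 ?subrr ?cabs0 ?ltW// => i.
  by rewrite -val_eqE /= => /negbTE ->.
rewrite mulrC; apply: csum_ctends.
apply: ctends_ext (ctendsM (real_complex R (d j)) (ctendsD hdelta Ej)) => I.
rewrite -big_split /= mulr_sumr; apply: eq_bigr => i _.
rewrite /G; case: eqP => [->|_].
  by rewrite mulr1n mulr0 addr0 /be; have := Fn0 j => h; field.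
by rewrite mulr0n add0r; have h := dn0 j; field.
Qed.

End Interpolation.

(** * Bounded restriction, averaging over a block, and estimates in inverted coordinates *)

Section RestrictionAndSeparation.
Variable R : realType.
Implicit Types (x : nat -> R[i]) (X Y W z : R[i]).

(** Duality: S = sum |f(x_i)|^2 / d_i is the pairing of f with the combination of kernels with
    coefficients f(x_i) / d_i, whose squared norm is at most 4 S by [riesz_upper] and A_i <= 2 d_i.
    Hence S^2 <= C S. *)
Lemma bounded_restriction_of_gram x (A : nat -> R) :
  in_disc x -> (forall i, 0 < A i) -> (forall i, A i / 2 <= kernel_sqnorm (x i)) ->
  (forall i j, cabs (kernel_series (x j * conjc (x i)) - real_complex R (A i *+ (i == j))) <=
     eta R i * eta R j * (Num.sqrt (A i) * Num.sqrt (A j))) ->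
  bounded_restriction x.
Proof.
move=> x1 A0 hd hA; have nc0 := norm_const_gt0 R.
exists (Num.sqrt (4 * norm_const R)) => f /dirichlet_lower[a [D [-> hfa [ha aD]]]].
rewrite sqr_sqrtr ?mulr_ge0 ?(ltW nc0)// -EFinM.
apply: nneseries_le => [i|I]; first exact: sqr_ge0.
pose d i := kernel_sqnorm (x i).
have d0 i : 0 < d i by apply: lt_le_trans (hd i); rewrite divr_gt0.
pose p i := f (x i).
have hp i : gram_limit a (kernel_vec (x i)) (p i).
  by rewrite /p hfa; [exact: gram_limit_eval ha (x1 i)|exact: x1].
pose S := \sum_(i < I) cabs (p i) ^+ 2 / d i.
have -> : \sum_(i < I) cabs (weighted_restriction x f i) ^+ 2 = S.
  apply: eq_bigr => i _; rewrite /weighted_restriction cabsM cabsV cabsC.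
  by rewrite ger0_norm ?sqrtr_ge0// exprMn exprVn sqr_sqrtr//; exact: ltW (d0 i).
have S0 : 0 <= S by apply: sumr_ge0 => i _; exact: divr_ge0 (sqr_ge0 _) (ltW (d0 i)).
pose b i := p i / real_complex R (d i).
have hg i j : gram_limit (kernel_vec (x i)) (kernel_vec (x j)) (kernel_series (x j * conjc (x i))).
  by apply: gram_limit_kernel; exact: x1.
have hV N : \sum_(n < N) n.+1%:R * cabs (\sum_(i < I) b i * kernel_vec (x i) n) ^+ 2 <= 4 * S.
  apply: le_trans (riesz_upper b I N hg (fun i => ltW (A0 i)) (fun i => ltW (eta_gt0 R i)) (eta_sqr_sum R) hA) _.
  rewrite mulr_sumr mulr_sumr; apply: ler_sum => i _.
  rewrite /b cabsM cabsV cabsC gtr0_norm ?d0// exprMn exprVn.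
  have -> : 4 * (cabs (p i) ^+ 2 / d i) = 2 * (2 * d i * (cabs (p i) ^+ 2 * (d i ^+ 2)^-1)).
    by field; rewrite gt_eqF// d0.
  rewrite ler_pM2l// ler_wpM2r//; first by rewrite mulr_ge0 ?invr_ge0 ?sqr_ge0.
  by have := hd i; rewrite -/(d i); lra.
have := pairing_bound aD hV (fun i _ => hp i).
have -> : \sum_(i < I) conjc (b i) * p i = real_complex R S.
  rewrite rmorph_sum /=; apply: eq_bigr => i _.
  have -> : conjc (b i) = conjc (p i) / real_complex R (d i).
    by rewrite /b cconjM [conjc _^-1]fmorphV; congr (_ / _); exact: conjc_real.
  by rewrite mulrAC [conjc _ * _]mulrC mulc_conj -fmorphV -rmorphM.
rewrite cabsC ger0_norm// => h.
have [S00|Sn0] := eqVneq S 0.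
  rewrite S00; have := aD 0%N; rewrite big_ord0 => h1.
  by rewrite -mulrA mulr_ge0.
rewrite -(ler_pM2r (_ : 0 < S)); last by rewrite lt_neqAle eq_sym Sn0.
by rewrite -[S * S]expr2; apply: le_trans h _; rewrite le_eqVlt; apply/orP; left; apply/eqP; ring.
Qed.

(** Here [z i] is the centre subtracted at [w i], constant on the block. As f vanishes at the [w i],
    pairing f with the average of the M differences returns - f(z_s), and near orthogonality gives
    the average squared norm at most 2 A / M. *)
Lemma block_bound (w z : nat -> R[i]) (g : nat -> nat -> R[i]) (A : nat -> R)
    (f : R[i] -> R[i]) s M :
  (0 < M)%N -> in_disc w -> in_disc z -> (forall i, 0 < A i) ->
  (forall i j, gram_limit (fun n => kernel_vec (w i) n - kernel_vec (z i) n)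
      (fun n => kernel_vec (w j) n - kernel_vec (z j) n) (g i j)) ->
  (forall i j, cabs (g i j - real_complex R (A i *+ (i == j))) <=
     eta R i * eta R j * (Num.sqrt (A i) * Num.sqrt (A j))) ->
  dirichlet_space f -> (forall i, f (w i) = 0) ->
  (forall i, (s <= i < s + M)%N -> z i = z s /\ A i = A s) ->
  cabs (f (z s)) ^+ 2 <= 2 * norm_const R * fine (dirichlet_sqnorm f) * A s / M%:R.
Proof.
move=> M0 w1 z1 A0 hg hA /dirichlet_lower[a [D [-> hfa [ha aD]]]] fw hblock /=.
have Mr : (0 : R) < M%:R by rewrite ltr0n.
pose xi i n := kernel_vec (w i) n - kernel_vec (z i) n.
pose b i : R[i] := if (s <= i)%N then M%:R^-1 else 0.
have hp i : gram_limit a (xi i) (- f (z i)).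
  have -> : - f (z i) = cpseries a (w i) - cpseries a (z i).
    by rewrite -!hfa ?fw ?sub0r//; [exact: z1|exact: w1].
  by apply: gram_limitBr; apply: gram_limit_eval ha _; [exact: w1|exact: z1].
have sumb (T : nmodType) (F : nat -> T) (c : T) : (forall i, (i < s)%N -> F i = 0) ->
    (forall i, (s <= i < s + M)%N -> F i = c) -> \sum_(i < s + M) F i = c *+ M.
  move=> h0 h1; rewrite big_split_ord /= big1 ?add0r => [|i _]; last exact: h0.
  under eq_bigr => i _ do rewrite h1 ?leq_addr ?ltn_add2l ?ltn_ord//.
  by rewrite sumr_const card_ord.
have hV N : \sum_(n < N) n.+1%:R * cabs (\sum_(i < s + M) b i * xi i n) ^+ 2 <= 2 * (A s / M%:R).
  apply: le_trans (riesz_upper b (s + M) N hg (fun i => ltW (A0 i)) (fun i => ltW (eta_gt0 R i)) (eta_sqr_sum R) hA) _.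
  rewrite (sumb _ (fun i => A i * cabs (b i) ^+ 2) (A s * (M%:R ^-1) ^+ 2)).
  - rewrite le_eqVlt; apply/orP; left; apply/eqP; rewrite -mulr_natr; field.
    by rewrite gt_eqF.
  - by move=> i si; rewrite /b leqNgt si cabs0 expr0n mulr0.
  - by move=> i ii; have [_ ->] := hblock i ii; rewrite /b; case/andP: ii => -> _; rewrite cabsV cabs_nat.
have := pairing_bound aD hV (fun i _ => hp i).
rewrite (sumb _ (fun i => conjc (b i) * - f (z i)) (M%:R^-1 * - f (z s))).
- rewrite -(mulr_natl (M%:R^-1 * - f (z s))) mulVKf ?pnatr_eq0 -?lt0n// cabsN => h; apply: le_trans h _.
  by rewrite le_eqVlt; apply/orP; left; apply/eqP; ring.
- by move=> i si; rewrite /b leqNgt si rmorph0 mul0r.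
- move=> i ii; have [-> _] := hblock i ii; rewrite /b; case/andP: ii => -> _.
  by congr (_ * _); rewrite fmorphV /= rmorph_nat.
Qed.

(** The nodes are given by their inverses. Since 1 - 1/X = (X - 1) / X, the bound |X| <= 2 costs the
    factor 2 allowed in [kernel_log]. *)
Lemma kernel_inv X m (B : R) : (0 < m)%N -> 1 < cabs X <= 2 ->
  1 <= m%:R * cabs (X - 1) <= B ->
  cabs (kernel_series X^-1 - real_complex R (ln m%:R)) <= B + 5.
Proof.
move=> m0 /andP[X1 X2] /andP[h1 h2].
have X0 : 0 < cabs X := lt_trans ltr01 X1.
have Xn0 : X != 0 by rewrite -cabs_eq0 gt_eqF.
have B0 : 0 <= B := le_trans ler01 (le_trans h1 h2).
have e : cabs (1 - X^-1) = cabs (X - 1) / cabs X.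
  by rewrite -cabsV -cabsM; congr cabs; field.
apply: kernel_log => //; first by rewrite cabsV invf_lt1.
  rewrite e mulrA ler_pdivrMr//; apply: le_trans h2 _; rewrite ler_peMr ?(ltW X1)//.
by rewrite e !mulrA ler_pdivlMr// mul1r -mulrA; lra.
Qed.

Lemma ln_le_sub1 (t : R) : 0 < t -> ln t <= t - 1.
Proof.
move=> t0; have -> : ln t = ln (1 + (t - 1)) by congr ln; ring.
by apply: le_ln1Dx; lra.
Qed.

(** With N = |Y|^2 the closed form at 1/Y is N (ln N + ln m - ln (m (N - 1))), where 1 <= N <= 2 and
    the last logarithm is at most B - 1. *)
Lemma kernel_sqnorm_inv Y m (A B : R) : 1 < cabs Y ^+ 2 <= 2 -> (0 < m)%N ->
  1 <= m%:R * (cabs Y ^+ 2 - 1) <= B -> A <= ln m%:R -> ln m%:R <= 2 * A -> 2 * B <= A ->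
  A / 2 <= kernel_sqnorm Y^-1 <= 9 * A.
Proof.
set N := cabs Y ^+ 2 => /andP[N1 N2] m0 /andP[h1 h2] hA hA' hB.
have Yn0 : Y != 0.
  by apply/eqP => Y0; move: N1; rewrite /N Y0 cabs0 expr0n /= ltr10.
have N0 : 0 < N := lt_trans ltr01 N1.
have Nm1 : 0 < N - 1 by rewrite subr_gt0.
have mr0 : (0 : R) < m%:R by rewrite ltr0n.
have B1 : 1 <= B := le_trans h1 h2.
have -> : kernel_sqnorm Y^-1 = N * (ln N + ln m%:R - ln (m%:R * (N - 1))).
  rewrite /kernel_sqnorm invr_eq0 (negbTE Yn0) cabsV exprVn -/N invrK.
  congr (_ * _); rewrite lnM ?posrE// opprD addrA addrK -ln_div ?posrE//.
  by congr ln; field; rewrite !gt_eqF.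
clearbody N.
have l1 : 0 <= ln N by rewrite ln_ge0// ltW.
have l2 : ln N <= 1.
  by apply: le_trans (ln_le_sub1 N0) _; rewrite lerBlDr.
have l3 : 0 <= ln (m%:R * (N - 1)) by rewrite ln_ge0.
have l4 : ln (m%:R * (N - 1)) <= B - 1.
  by apply: le_trans (ln_le_sub1 (mulr_gt0 mr0 Nm1)) _; lra.
move: (ln N) (ln (m%:R * (N - 1))) (ln m%:R) l1 l2 l3 l4 hA hA' => a b c l1 l2 l3 l4 hA hA'.
apply/andP; split.
  apply: le_trans (_ : a + c - b <= _); first by lra.
  by rewrite ler_peMl ?(ltW N1)//; lra.
apply: le_trans (_ : 2 * (a + c - b) <= _); last by lra.
by rewrite ler_wpM2r//; lra.
Qed.

Lemma pseudo_hyperbolic_inv Y W : 1 < cabs Y ^+ 2 -> 1 < cabs W ^+ 2 ->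
  pseudo_hyperbolic Y^-1 W^-1 = cabs (Y - W) / cabs (Y * conjc W - 1).
Proof.
move=> Y1 W1.
have n0 (Z : R[i]) : 1 < cabs Z ^+ 2 -> Z != 0.
  by move=> h; apply/eqP => Z0; move: h; rewrite Z0 cabs0 expr0n /= ltr10.
have Yn0 := n0 _ Y1; have Wn0 := n0 _ W1.
have cWn0 : conjc W != 0 by rewrite -cabs_eq0 cabs_conj cabs_eq0.
rewrite /pseudo_hyperbolic.
have -> : Y^-1 - W^-1 = (W - Y) / (Y * W) by field; rewrite ?Yn0 ?Wn0.
have -> : 1 - conjc W^-1 * Y^-1 = (Y * conjc W - 1) / (Y * conjc W).
  have -> : conjc W^-1 = (conjc W)^-1 by exact: fmorphV.
  by move: (conjc W) cWn0 => V Vn0; field; rewrite ?Yn0 ?Vn0.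
rewrite cabsM cabsV !cabsM !cabsV !cabsM cabs_conj cabsBC.
have a0 : cabs Y * cabs W != 0 by rewrite mulf_neq0 ?cabs_eq0.
by rewrite [(_ * (_ * _)^-1)^-1]invfM invrK mulrACA [(cabs Y * _)^-1 * _]mulVf// mulr1.
Qed.

Lemma blaschke_identity Y W :
  cabs (Y * conjc W - 1) ^+ 2 - cabs (Y - W) ^+ 2 = (cabs Y ^+ 2 - 1) * (cabs W ^+ 2 - 1).
Proof. by case: Y W => a b [c d]; rewrite !cabs_sqr /=; ring. Qed.

(** If the pseudo-hyperbolic distance is p / q, then (1 + p/q) / (1 - p/q) = (q + p)^2 / (q^2 - p^2)
    >= q^2 / (q^2 - p^2), and [blaschke_identity] evaluates the denominator. *)
Lemma hyperbolic_dist_ge Y W : 1 < cabs Y ^+ 2 -> 1 < cabs W ^+ 2 ->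
  ln (cabs (Y * conjc W - 1) ^+ 2 / ((cabs Y ^+ 2 - 1) * (cabs W ^+ 2 - 1))) / ln 2 <=
  hyperbolic_dist Y^-1 W^-1.
Proof.
move=> Y1 W1; rewrite /hyperbolic_dist pseudo_hyperbolic_inv//.
have ln2 : 0 < ln 2 :> R by rewrite ln_gt0// ltr1n.
rewrite ler_pM2r ?invr_gt0//.
have q0 : 0 < (cabs Y ^+ 2 - 1) * (cabs W ^+ 2 - 1) by rewrite mulr_gt0// subr_gt0.
have id := blaschke_identity Y W.
move: (cabs_ge0 (Y - W)) (cabs_ge0 (Y * conjc W - 1)) q0; rewrite -id.
move: (cabs (Y - W)) (cabs (_ - 1)) => p q p0 q0 pq.
have qp : p < q by rewrite -ltr_sqr ?nnegrE// -subr_gt0.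
have q1 : 0 < q := le_lt_trans p0 qp.
have -> : (1 + p / q) / (1 - p / q) = (q + p) ^+ 2 / (q ^+ 2 - p ^+ 2).
  have -> : q ^+ 2 - p ^+ 2 = (q - p) * (q + p) by ring.
  by field; rewrite !gt_eqF ?subr_gt0 ?ltr_wpDr.
have qp0 : 0 < q + p by rewrite ltr_wpDr.
have qp2 : 0 < (q + p) ^+ 2 by rewrite exprn_gt0.
rewrite ler_ln ?posrE ?divr_gt0 ?exprn_gt0//.
by rewrite ler_pM2r ?invr_gt0// ler_sqr ?nnegrE ?addr_ge0// ?lerDl// ltW.
Qed.

Lemma hyperbolic_dist0_le Y : 1 < cabs Y ^+ 2 <= 2 ->
  hyperbolic_dist Y^-1 0 <= ln (16 / (cabs Y ^+ 2 - 1)) / ln 2.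
Proof.
move=> /andP[Y1 Y2]; have ln2 : 0 < ln 2 :> R by rewrite ln_gt0// ltr1n.
rewrite /hyperbolic_dist ler_pM2r ?invr_gt0//.
rewrite /pseudo_hyperbolic subr0 rmorph0 mul0r subr0 divr1 cabsV.
move: (cabs_ge0 Y) Y1 Y2; move: (cabs Y) => y y0 y1 y2.
have yy : 1 < y by rewrite -ltr_sqr ?nnegrE// expr1n.
have y3 : y <= 2 by rewrite -ler_sqr ?nnegrE//; lra.
have -> : (1 + y^-1) / (1 - y^-1) = (y + 1) ^+ 2 / (y ^+ 2 - 1).
  have -> : y ^+ 2 - 1 = (y - 1) * (y + 1) by ring.
  by field; rewrite !gt_eqF//; lra.
have q0 : 0 < y ^+ 2 - 1 by rewrite subr_gt0.
have q1 : 0 < (y + 1) ^+ 2 by rewrite exprn_gt0//; lra.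
rewrite ler_ln ?posrE ?divr_gt0// ler_pM2r ?invr_gt0//.
by nra.
Qed.

End RestrictionAndSeparation.

(** * The two sequences *)

Section Nodes.
Variable R : realType.

(** Dominates i + 1 for every index i of cluster k, in both families. *)
Definition label_bound (k : nat) : R := (16 ^ k.+1)%:R.

(** The constant B of [kernel_inv] for all pairs of nodes of cluster k. *)
Definition spread (k : nat) : R := 3 * label_bound k ^+ 2.

(** Its inverse is a lower bound for [eta i] over the indices of cluster k. *)
Definition weight_bound (k : nat) : R := 2 ^+ (16 ^ k.+1 + 3).

(* The lower bound on sqrt (log m_k) in terms of r = m_(k-1). *)
Definition threshold (k r : nat) : R :=
  24 * (spread k + 5) * weight_bound k ^+ 2 * r%:R ^+ 2.

(** Rounding exp (threshold^2) up makes sqrt (log m_k) at least the threshold set by m_(k-1). *)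
Fixpoint modulus (k : nat) : nat :=
  (Num.truncn (expR (threshold k (if k is k'.+1 then modulus k' else 1) ^+ 2))).+2.

Definition level (k : nat) : R := ln (modulus k)%:R.

Lemma label_bound_ge1 k : 1 <= label_bound k.
Proof. by rewrite ler1n expn_gt0. Qed.

Lemma spread_ge3 k : 3 <= spread k.
Proof. by rewrite /spread; have := label_bound_ge1 k; move: (label_bound k) => p; nra. Qed.

Lemma weight_bound_ge1 k : 1 <= weight_bound k.
Proof. by rewrite exprn_ege1// ler1n. Qed.

(** The second bound absorbs the errors within a cluster, the third those against earlier
    clusters. *)
Lemma threshold_ge k r : (0 < r)%N -> [/\ spread k + 5 <= threshold k r,
  24 * (spread k + 5) * weight_bound k ^+ 2 <= threshold k r &
  24 * weight_bound k * r%:R ^+ 2 <= threshold k r].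
Proof.
move=> r0; have r1 : 1 <= r%:R :> R by rewrite ler1n.
have r2 : 1 <= r%:R ^+ 2 :> R by rewrite exprn_ege1.
have t1 := weight_bound_ge1 k.
have t2 : weight_bound k <= weight_bound k ^+ 2 by rewrite expr2 ler_peMr//; lra.
have s1 := spread_ge3 k; rewrite /threshold.
move: (r%:R ^+ 2) (weight_bound k) (spread k) (weight_bound k ^+ 2) r2 t1 t2 s1.
clear=> r t s t2 r1 t1 tt s3.
have h1 : 1 <= t2 * r by nra.
have h2 : t * r <= t2 * r by rewrite ler_wpM2r//; lra.
split; first by have : 0 <= (s + 5) * (24 * (t2 * r) - 1) by [rewrite mulr_ge0//; lra]; lra.
  by have : 0 <= (24 * (s + 5) * t2) * (r - 1) by [rewrite mulr_ge0//; nra]; lra.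
by have : 0 <= (s + 4) * (t2 * r) by [rewrite mulr_ge0//; lra]; lra.
Qed.

Lemma modulus_spec k : exists2 r, threshold k r ^+ 2 <= level k &
  [/\ (0 < r)%N, (r <= modulus k)%N & forall j, (j < k)%N -> (modulus j <= r)%N].
Proof.
have pick L r : (0 < r)%N -> r%:R <= L -> L ^+ 2 <= ln (Num.truncn (expR (L ^+ 2))).+2%:R :> R /\
    (r <= (Num.truncn (expR (L ^+ 2))).+2)%N.
  move=> r0 rL; have e0 := expR_gt0 (L ^+ 2).
  have h : expR (L ^+ 2) <= (Num.truncn (expR (L ^+ 2))).+2%:R.
    apply: le_trans (ltW (truncnS_gt _)) _; by rewrite ler_nat.
  split.
    by rewrite -[leLHS]expRK ler_ln ?posrE ?ltr0n.
  rewrite -(ler_nat R); apply: le_trans rL _; apply: le_trans h.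
  by apply: le_trans (expR_ge1Dx _); have := sqr_ge0 (L - 1 / 2); lra.
have rthr k' r : (0 < r)%N -> r%:R <= threshold k' r.
  move=> r0; have [_ _ h] := threshold_ge k' r0; apply: le_trans h.
  have : 1 <= r%:R :> R by rewrite ler1n.
  have := weight_bound_ge1 k'; move: (r%:R) (weight_bound k') => p q h1 h2.
  by have : 0 <= (q - 1) * p ^+ 2 by [rewrite mulr_ge0 ?sqr_ge0//; lra]; nra.
elim: k => [|k [r _ [r0 rk IH]]].
  by exists 1%N; have [] := pick _ 1%N isT (rthr 0%N 1%N isT).
have mk0 : (0 < modulus k)%N by case: (k).
have [h1 h2] := pick _ _ mk0 (rthr k.+1 _ mk0).
exists (modulus k) => //; split => // j; rewrite ltnS leq_eqVlt => /orP[/eqP ->//|/IH h].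
exact: leq_trans h rk.
Qed.

Lemma modulus_gt0 k : (0 < modulus k)%N. Proof. by case: k. Qed.

Lemma level_facts k : [/\ 1 <= Num.sqrt (level k), Num.sqrt (level k) <= level k,
  level k <= (modulus k)%:R,
  24 * (spread k + 5) * weight_bound k ^+ 2 <= Num.sqrt (level k) &
  forall j, (j < k)%N -> threshold k (modulus j) <= Num.sqrt (level k)].
Proof.
have [r hr [r0 rm rj]] := modulus_spec k.
have [t1 t2 t3] := threshold_ge k r0.
have sp := spread_ge3 k.
have th0 : 0 <= threshold k r by lra.
have hs : threshold k r <= Num.sqrt (level k).
  by rewrite -[leLHS]ger0_norm// -sqrtr_sqr ler_sqrt// (le_trans (sqr_ge0 _) hr).
have s1 : 1 <= Num.sqrt (level k) by lra.
have l0 : 0 <= level k := le_trans (sqr_ge0 _) hr.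
split => //.
- by rewrite -{2}(sqr_sqrtr l0) expr2 ler_peMr// sqrtr_ge0.
- apply: le_trans (ln_le_sub1 _) _; first by rewrite ltr0n modulus_gt0.
  by rewrite lerBlDr lerDl.
- exact: le_trans t2 hs.
- move=> j jk; apply: le_trans hs; rewrite /threshold ler_wpM2l//.
    by rewrite mulr_ge0 ?sqr_ge0// mulr_ge0//; lra.
  by rewrite ler_sqr ?nnegrE// ler_nat rj.
Qed.

(** The boolean selects the family, [false] for z and [true] for w, so that both share their
    estimates. Cluster k holds one z and 15 * 16^k points w. *)
Definition node_cluster (b : bool) (i : nat) : nat := if b then trunc_log 16 i.+1 else i.

(* With d = 1 / m_k the inverses of the points of cluster k are 1 + d for z_k and
   1 + d^2 + i p d for the w_p with 16^k <= p + 1 < 16^(k+1). *)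
Definition inv_node (b : bool) (i : nat) : R[i] :=
  let d := (modulus (node_cluster b i))%:R^-1 in
  if b then Complex (1 + d ^+ 2) (i%:R * d) else Complex (1 + d) 0.

(* Up to the factor [spread k], 1 - |x|^2 is 1 / node_scale. *)
Definition node_scale (b : bool) (k : nat) : nat :=
  if b then (modulus k ^ 2)%N else modulus k.

Lemma cluster_label b i : (i.+1 <= 16 ^ (node_cluster b i).+1)%N.
Proof.
case: b => /=; first exact: (ltnW (trunc_log_ltn _ _)).
by apply: ltnW; exact: ltn_expl.
Qed.

Lemma label_le b i k : node_cluster b i = k -> i%:R + 1 <= label_bound k.
Proof. by move=> <-; rewrite natr1 ler_nat cluster_label. Qed.

Lemma inv_modulus k (d : R) : d = (modulus k)%:R^-1 ->
  [/\ 0 < d, d <= 1 & (modulus k)%:R * d = 1].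
Proof.
move=> ->; have m0 : (0 : R) < (modulus k)%:R by rewrite ltr0n modulus_gt0.
split; first by rewrite invr_gt0.
  by rewrite invf_le1// ler1n modulus_gt0.
by rewrite mulfV// gt_eqF.
Qed.

(** Exactly, m (|Y|^2 - 1) = 2 + d for z and m^2 (|Y|^2 - 1) = 2 + d^2 + p^2 for w: the height p d
    contributes at the order of the depth d^2. *)
Lemma node_sqr b i k : node_cluster b i = k ->
  1 <= (node_scale b k)%:R * (cabs (inv_node b i) ^+ 2 - 1) <= spread k.
Proof.
move=> ck; have hl := label_le ck; rewrite /inv_node ck cabs_sqr /spread.
have [m [d [em ed]]] : exists m d : R, (modulus k)%:R = m /\ (modulus k)%:R^-1 = d by eauto.
have [d0 d1 md] := inv_modulus (esym ed); rewrite em in md; rewrite ed.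
case: b {ck} => /=.
  rewrite natrX em; have := ler0n R i; move: (i%:R) (label_bound k) hl => p P hl p0.
  have -> : m ^+ 2 * ((1 + d ^+ 2) ^+ 2 + (p * d) ^+ 2 - 1) =
    (m * d) ^+ 2 * (2 + d ^+ 2 + p ^+ 2) by ring.
  rewrite md expr1n mul1r; have p2 := sqr_ge0 p; have d2 : 0 <= d ^+ 2 <= 1 by rewrite sqr_ge0 expr_le1// ltW.
  have /andP[d3 d4] := d2.
  have : (p + 1) ^+ 2 <= P ^+ 2 by rewrite ler_sqr ?nnegrE//; lra.
  by move: (P ^+ 2) => Q h; apply/andP; split; nra.
rewrite em.
have -> : m * ((1 + d) ^+ 2 + 0 ^+ 2 - 1) = (m * d) * (2 + d) by ring.
rewrite md mul1r; have := label_bound_ge1 k; move: (label_bound k) => P hP.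
by apply/andP; split; nra.
Qed.

Lemma node_range b i : 1 < cabs (inv_node b i) ^+ 2 <= 2.
Proof.
have /andP[h1 h2] := node_sqr (erefl (node_cluster b i)).
set k := node_cluster b i in h1 h2; have [s1 s2 s3 s4 _] := level_facts k.
have sp := spread_ge3 k; have t1 := weight_bound_ge1 k.
have t2 : 1 <= weight_bound k ^+ 2 by rewrite exprn_ege1.
have hm : spread k <= (modulus k)%:R.
  have : spread k <= 24 * (spread k + 5) * weight_bound k ^+ 2.
    by move: (weight_bound k ^+ 2) t2 => t t2; have : 0 <= (spread k + 5) * (t - 1) by [rewrite mulr_ge0//; lra]; lra.
  lra.
have hmu : (modulus k)%:R <= (node_scale b k)%:R :> R.
  by rewrite ler_nat /node_scale; case: (b) => //; rewrite expnS leq_pmulr// expn_gt0 modulus_gt0.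
have mu0 : 0 < (node_scale b k)%:R :> R by apply: lt_le_trans hmu; rewrite ltr0n modulus_gt0.
move: (cabs _ ^+ 2) (node_scale b k)%:R h1 h2 hm hmu mu0 => N mu h1 h2 hm hmu mu0.
have N1 : 0 < N - 1 by rewrite -(pmulr_rgt0 _ mu0); lra.
apply/andP; split; first lra.
have : mu * (N - 1) <= mu * 1 by lra.
rewrite ler_pM2l//; lra.
Qed.

Lemma cabs_pair_sym (X Y : R[i]) : cabs (X * conjc Y - 1) = cabs (Y * conjc X - 1).
Proof.
rewrite -cabs_conj; congr cabs; case: X Y => a b [c d].
by apply/eqP; rewrite eq_complex /=; apply/andP; split; apply/eqP; ring.
Qed.

Lemma complex_size_bounds (z : R[i]) (m B : R) : 0 <= m ->
  m * `|complex.Re z| + m * `|complex.Im z| <= B ->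
  1 <= m * `|complex.Re z| \/ 1 <= m * `|complex.Im z| -> 1 <= m * cabs z <= B.
Proof.
move=> m0 hB h; apply/andP; split; last first.
  by apply: le_trans hB; rewrite -mulrDr ler_wpM2l// cabs_leD.
by case: h => h; apply: le_trans h _; rewrite ler_wpM2l// ?normRe_le ?normIm_le.
Qed.

(** The product minus 1 has real part d + d^2 + d^3 for a w and the z, and imaginary part (p - q) d
    (1 + d^2) for two w's; either way its size is of order d = 1 / m. *)
Lemma node_pair b i b' i' k : node_cluster b i = k -> node_cluster b' i' = k -> (b, i) != (b', i') ->
  1 <= (modulus k)%:R * cabs (inv_node b i * conjc (inv_node b' i') - 1) <= spread k.
Proof.
move=> ck ck' ne.
have wlog_ : forall j j', node_cluster true j = k -> node_cluster false j' = k ->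
   1 <= (modulus k)%:R * cabs (inv_node true j * conjc (inv_node false j') - 1) <= spread k.
  move=> {ck ck' ne} j j' cj cj'; have hl := label_le cj; rewrite /inv_node cj cj' /spread.
  have [m [d [em ed]]] : exists m d : R, (modulus k)%:R = m /\ (modulus k)%:R^-1 = d by eauto.
  have [d0 d1 md] := inv_modulus (esym ed); rewrite em in md; rewrite ed em.
  have m0 : 0 <= m by rewrite -em ler0n.
  move: hl (ler0n R j); move: (j%:R) (label_bound k) => p P hl p0.
  have d2 : d ^+ 2 <= 1 by rewrite expr_le1// ltW.
  have d20 := sqr_ge0 d; have q0 : 0 <= d + d ^+ 2 + d ^+ 3 by rewrite !addr_ge0 ?exprn_ge0// ltW.
  have eR : m * `|d + d ^+ 2 + d ^+ 3| = 1 + d + d ^+ 2.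
    rewrite ger0_norm//.
    have -> : m * (d + d ^+ 2 + d ^+ 3) = (m * d) * (1 + d + d ^+ 2) by ring.
    by rewrite md mul1r.
  have eI : m * `|p * d * (1 + d)| = p * (1 + d).
    rewrite ger0_norm ?mulr_ge0 ?(ltW d0)//; last by lra.
    have -> : m * (p * d * (1 + d)) = (m * d) * (p * (1 + d)) by ring.
    by rewrite md mul1r.
  have -> : Complex (1 + d ^+ 2) (p * d) * conjc (Complex (1 + d) 0) - 1 =
     Complex (d + d ^+ 2 + d ^+ 3) (p * d * (1 + d)).
    by apply/eqP; rewrite eq_complex /=; apply/andP; split; apply/eqP; ring.
  apply: complex_size_bounds => //=; rewrite eR eI; last by left; lra.
  have : (p + 1) ^+ 2 <= P ^+ 2 by rewrite ler_sqr ?nnegrE//; lra.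
  by move: (P ^+ 2) => Q h; nra.
case: b b' ck ck' ne => [] [] ck ck' ne.
- have hl := label_le ck; have hl' := label_le ck'; rewrite /inv_node ck ck' /spread.
  have [m [d [em ed]]] : exists m d : R, (modulus k)%:R = m /\ (modulus k)%:R^-1 = d by eauto.
  have [d0 d1 md] := inv_modulus (esym ed); rewrite em in md; rewrite ed em.
  have m0 : 0 <= m by rewrite -em ler0n.
  have pq1 : 1 <= `|i%:R - i'%:R| :> R.
    have ii : i != i' by apply: contra ne => /eqP ->.
    have [lt|lt|e] := ltngtP i i'; last by rewrite e eqxx in ii.
      by rewrite distrC -natrB ?(ltnW lt)// normr_nat ler1n subn_gt0.
    by rewrite -natrB ?(ltnW lt)// normr_nat ler1n subn_gt0.
  move: hl hl' (ler0n R i) (ler0n R i') pq1.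
  move: (i%:R) (i'%:R) (label_bound k) => p q P hl hl' p0 q0 pq1.
  have d2 : d ^+ 2 <= 1 by rewrite expr_le1// ltW.
  have d20 := sqr_ge0 d.
  have pq0 : 0 <= p * q by rewrite mulr_ge0.
  have eR : m * `|2 * d ^+ 2 + d ^+ 4 + p * q * d ^+ 2| = 2 * d + d ^+ 3 + p * q * d.
    rewrite ger0_norm; last by rewrite !addr_ge0 ?mulr_ge0 ?exprn_ge0// ltW.
    have -> : m * (2 * d ^+ 2 + d ^+ 4 + p * q * d ^+ 2) = (m * d) * (2 * d + d ^+ 3 + p * q * d) by ring.
    by rewrite md mul1r.
  have eI : m * `|(p - q) * (d * (1 + d ^+ 2))| = `|p - q| * (1 + d ^+ 2).
    rewrite normrM (ger0_norm (_ : 0 <= d * (1 + d ^+ 2))); last by rewrite mulr_ge0 ?(ltW d0)//; lra.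
    have -> : m * (`|p - q| * (d * (1 + d ^+ 2))) = (m * d) * (`|p - q| * (1 + d ^+ 2)) by ring.
    by rewrite md mul1r.
  have -> : Complex (1 + d ^+ 2) (p * d) * conjc (Complex (1 + d ^+ 2) (q * d)) - 1 =
     Complex (2 * d ^+ 2 + d ^+ 4 + p * q * d ^+ 2) ((p - q) * (d * (1 + d ^+ 2))).
    by apply/eqP; rewrite eq_complex /=; apply/andP; split; apply/eqP; ring.
  apply: complex_size_bounds => //=; rewrite eR eI; last by right; nra.
  have npq : `|p - q| <= p + q by rewrite ler_norml; apply/andP; split; lra.
  have PP : (p + 1) * (q + 1) <= P ^+ 2 by rewrite expr2; apply: ler_pM => //; lra.
  have b1 : d ^+ 3 <= 1 by rewrite exprn_ile1// ltW.
  have b2 : p * q * d <= p * q by rewrite ler_piMr.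
  have b3 : `|p - q| * (1 + d ^+ 2) <= (p + q) * 2.
    by apply: ler_pM => //; lra.
  by move: (P ^+ 2) (d ^+ 3) (p * q * d) (`|p - q| * _) PP b1 b2 b3 => Q a b c PP b1 b2 b3; nra.
- exact: wlog_.
- have -> : cabs (inv_node false i * conjc (inv_node true i') - 1) =
     cabs (inv_node true i' * conjc (inv_node false i) - 1).
    exact: cabs_pair_sym.
  exact: wlog_.
- by move: ck ck' ne => /= -> ->; rewrite eqxx.
Qed.

End Nodes.

(** * Kernels at the nodes *)

Section NodeKernel.
Variable R : realType.

Definition node (b : bool) (i : nat) : R[i] := (inv_node R b i)^-1.

Definition node_kernel b i b' i' : R[i] :=
  kernel_series (node b' i' * conjc (node b i)).

Lemma inv_node_gt1 b i : 1 < cabs (inv_node R b i).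
Proof.
have /andP[h _] := node_range R b i.
by rewrite -ltr_sqr ?nnegrE ?cabs_ge0// expr1n.
Qed.

Lemma node_lt1 b i : cabs (node b i) < 1.
Proof.
have h := inv_node_gt1 b i.
by rewrite cabsV invf_lt1// (lt_trans ltr01 h).
Qed.

Lemma node_kernelE b i b' i' :
  node_kernel b i b' i' = kernel_series (inv_node R b' i' * conjc (inv_node R b i))^-1.
Proof. by rewrite /node_kernel /node [conjc _^-1]fmorphV invfM. Qed.

Lemma inv_node_pair_range b i b' i' :
  1 < cabs (inv_node R b' i' * conjc (inv_node R b i)) <= 2.
Proof.
have h := inv_node_gt1 b i; have h' := inv_node_gt1 b' i'.
have /andP[_ k] := node_range R b i; have /andP[_ k'] := node_range R b' i'.
rewrite cabsM cabs_conj; move: (cabs _) (cabs _) h h' k k' => p q h h' k k'.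
apply/andP; split; first by nra.
by have := sqr_ge0 (p - q); nra.
Qed.

Lemma node_scale_gt0 b k : (0 < node_scale R b k)%N.
Proof. by rewrite /node_scale; case: b; rewrite ?expn_gt0 modulus_gt0. Qed.

Lemma node_scale_le b k : (node_scale R b k)%:R <= (modulus R k)%:R ^+ 2 :> R.
Proof.
rewrite -natrX ler_nat /node_scale; case: b => //.
by rewrite -{1}(expn1 (modulus R k)) leq_pexp2l// modulus_gt0.
Qed.

Lemma ln_node_scale b k : ln (node_scale R b k)%:R = level R k *+ (if b then 2 else 1).
Proof. by rewrite /node_scale; case: b => //; rewrite natrX lnXn// ltr0n modulus_gt0. Qed.

(** The error allowed for a single kernel value. The 4 in the denominator lets four such errors, as
    in [w_gram], stay within the tolerance of [riesz_upper]. *)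
Definition cross_bound (k l : nat) : R :=
  Num.sqrt (level R k) * Num.sqrt (level R l) / (4 * (weight_bound R k * weight_bound R l)).

Lemma cross_boundC k l : cross_bound k l = cross_bound l k.
Proof. by rewrite /cross_bound (mulrC (Num.sqrt (level R k))) (mulrC (weight_bound R k)). Qed.

Lemma spread_le_cross k : spread R k + 5 <= cross_bound k k.
Proof.
have [s1 s2 _ s4 _] := level_facts R k.
have t1 := weight_bound_ge1 R k; have sp := spread_ge3 R k.
have l0 : 0 <= level R k by lra.
rewrite /cross_bound -expr2 sqr_sqrtr// ler_pdivlMr; last by rewrite mulr_gt0// mulr_gt0//; lra.
rewrite -[weight_bound R k * _]expr2; apply: le_trans s2; apply: le_trans s4.
have : 0 <= (spread R k + 5) * weight_bound R k ^+ 2 by rewrite mulr_ge0 ?sqr_ge0//; lra.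
lra.
Qed.

Lemma node_kernel_crude b i k z : node_cluster b i = k -> cabs z <= cabs (node b i) ->
  cabs (kernel_series z) <= 6 * (modulus R k)%:R ^+ 2.
Proof.
move=> ck zn; apply: le_trans (kernel_crude (le_lt_trans zn (node_lt1 b i))) _.
have h1 := node_lt1 b i.
apply: le_trans (_ : (1 - cabs (node b i))^-1 <= _).
  by rewrite lef_pV2 ?posrE ?subr_gt0 ?(le_lt_trans zn)// lerD2l lerN2.
have /andP[k1 _] := node_sqr R ck; have k2 := node_scale_le b k.
have y1 := inv_node_gt1 b i; have /andP[_ y2] := node_range R b i.
rewrite /node cabsV in h1 *.
have mu0 : (0 : R) < (node_scale R b k)%:R by rewrite ltr0n node_scale_gt0.
move: (cabs _) (node_scale R b k)%:R ((modulus R k)%:R ^+ 2) y1 y2 h1 k1 k2 mu0 => y mu M y1 y2 h1 k1 k2 mu0.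
have y3 : y <= 2 by rewrite -ler_sqr ?nnegrE//; lra.
have -> : (1 - y^-1)^-1 = y / (y - 1) by field; rewrite !gt_eqF//; lra.
rewrite ler_pdivrMr; last by rewrite subr_gt0.
have e : M * (y ^+ 2 - 1) = M * (y - 1) * (y + 1) by ring.
have h2 : 1 <= M * (y ^+ 2 - 1) by apply: le_trans k1 _; rewrite ler_wpM2r//; nra.
have h3 : M * (y - 1) * (y + 1) <= M * (y - 1) * 3.
  by rewrite ler_wpM2l//; [rewrite mulr_ge0//; lra|lra].
lra.
Qed.

Lemma modulus_sqr_le_cross j k : (j < k)%N -> 6 * (modulus R j)%:R ^+ 2 <= cross_bound j k.
Proof.
move=> jk; have [_ _ _ _ h] := level_facts R k.
have [s1 s2 _ s4 _] := level_facts R j.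
have [_ _ h3] := threshold_ge R k (modulus_gt0 R j).
have h4 := le_trans h3 (h _ jk).
have tk := weight_bound_ge1 R k; have tj := weight_bound_ge1 R j; have sp := spread_ge3 R j.
have h5 : weight_bound R j <= Num.sqrt (level R j).
  apply: le_trans s4; move: (weight_bound R j) tj => t t1; have : t <= t ^+ 2 by nra.
  by move: (t ^+ 2) => u tu; nra.
rewrite /cross_bound ler_pdivlMr; last by rewrite mulr_gt0// mulr_gt0//; lra.
have -> : 6 * (modulus R j)%:R ^+ 2 * (4 * (weight_bound R j * weight_bound R k)) =
   weight_bound R j * (24 * weight_bound R k * (modulus R j)%:R ^+ 2) by ring.
apply: ler_pM => //; first by lra.
by rewrite mulr_ge0 ?sqr_ge0// mulr_ge0//; lra.
Qed.

(* The inner product of the kernels at two points is about this multiple of log m_k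
   within cluster k, and negligible across clusters. *)
Definition kernel_weight (b b' : bool) (i i' : nat) : nat :=
  if node_cluster b i == node_cluster b' i' then (if [&& b, b' & i == i'] then 2 else 1) else 0.

(** Across clusters the crude bound 1 / (1 - |z|) for the earlier cluster is absorbed by the growth
    of m. Within a cluster [kernel_inv] applies with [node_scale] on the diagonal and with m_k off
    it. *)
Lemma node_kernel_approx b i b' i' k l : node_cluster b i = k -> node_cluster b' i' = l ->
  cabs (node_kernel b i b' i' - real_complex R (level R k *+ kernel_weight b b' i i')) <=
  cross_bound k l.
Proof.
move=> ck cl; rewrite /kernel_weight ck cl.
have [kl|kl] := eqVneq k l; last first.
  rewrite mulr0n rmorph0 subr0 /node_kernel.
  have n1 := node_lt1 b i; have n2 := node_lt1 b' i'.
  have [lt|lt|e] := ltngtP k l; last by rewrite e eqxx in kl.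
  - apply: le_trans (modulus_sqr_le_cross lt); apply: (node_kernel_crude ck).
    by rewrite cabsM cabs_conj ler_piMl ?cabs_ge0// ltW.
  - rewrite cross_boundC; apply: le_trans (modulus_sqr_le_cross lt); apply: (node_kernel_crude cl).
    by rewrite cabsM cabs_conj ler_piMr ?cabs_ge0// ltW.
rewrite node_kernelE -kl; apply: le_trans (spread_le_cross k).
have hr := inv_node_pair_range b i b' i'.
have [e|ne] := eqVneq (b, i) (b', i').
  case: e cl => <- <- _ in hr *; rewrite eqxx andbT andbb -ln_node_scale.
  apply: kernel_inv => //; first exact: node_scale_gt0.
  have -> : cabs (inv_node R b i * conjc (inv_node R b i) - 1) = cabs (inv_node R b i) ^+ 2 - 1.
    rewrite mulc_conj -(rmorph1 (real_complex R)) -rmorphB cabsC ger0_norm// subr_ge0.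
    by rewrite exprn_ege1// ltW// inv_node_gt1.
  exact: node_sqr.
have -> : [&& b, b' & i == i'] = false.
  by apply/negbTE; apply: contra ne => /and3P[-> -> /eqP ->].
apply: kernel_inv => //; first exact: modulus_gt0.
by apply: node_pair => //; [rewrite cl kl|rewrite eq_sym].
Qed.

Lemma weight_bound_eta b i k : node_cluster b i = k -> (weight_bound R k)^-1 <= eta R i.
Proof.
move=> ck; rewrite /eta /weight_bound lef_pV2 ?posrE ?exprn_gt0//.
rewrite ler_eXn2l ?ltr1n// addnS -addSn leq_add2r -ck; exact: cluster_label.
Qed.

Lemma cross_bound_eta b i b' i' k l : node_cluster b i = k -> node_cluster b' i' = l ->
  4 * cross_bound k l <= eta R i * eta R i' * (Num.sqrt (level R k) * Num.sqrt (level R l)).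
Proof.
move=> ck cl; have h := weight_bound_eta ck; have h' := weight_bound_eta cl.
have tk := weight_bound_ge1 R k; have tl := weight_bound_ge1 R l.
have -> : 4 * cross_bound k l = ((weight_bound R k)^-1 * (weight_bound R l)^-1) *
   (Num.sqrt (level R k) * Num.sqrt (level R l)).
  by rewrite /cross_bound; field; rewrite !gt_eqF//; lra.
rewrite ler_wpM2r ?mulr_ge0 ?sqrtr_ge0//; apply: ler_pM => //; rewrite invr_ge0; lra.
Qed.

Lemma level_gt0 k : 0 < level R k.
Proof. by have [s1 s2 _ _ _] := level_facts R k; lra. Qed.

Lemma level_eta b i k : node_cluster b i = k -> 1 <= Num.sqrt (level R k) * eta R i.
Proof.
move=> ck; have h := weight_bound_eta ck; have t1 := weight_bound_ge1 R k.
have [_ _ _ s4 _] := level_facts R k; have sp := spread_ge3 R k.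
have h5 : weight_bound R k <= Num.sqrt (level R k).
  apply: le_trans s4; move: (weight_bound R k) t1 => t t1; have : t <= t ^+ 2 by nra.
  by move: (t ^+ 2) => u tu; nra.
apply: le_trans (_ : weight_bound R k * (weight_bound R k)^-1 <= _).
  by rewrite mulfV// gt_eqF//; lra.
by apply: ler_pM => //; [lra|rewrite invr_ge0; lra].
Qed.

Lemma node_sqnorm b i k : node_cluster b i = k ->
  level R k / 2 <= kernel_sqnorm (node b i) <= 9 * level R k.
Proof.
move=> ck; have l0 := level_gt0 k.
apply: (kernel_sqnorm_inv (node_range R b i) (node_scale_gt0 b k) (node_sqr R ck)).
- by rewrite ln_node_scale; case: (b) => //; rewrite mulr2n lerDl ltW.
- by rewrite ln_node_scale; case: (b); rewrite mulr_natl ?mulr2n// lerDl ltW.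
have [s1 s2 _ s4 _] := level_facts R k; have sp := spread_ge3 R k.
have t1 : 1 <= weight_bound R k ^+ 2 by rewrite exprn_ege1// weight_bound_ge1.
apply: le_trans s2; apply: le_trans s4; move: (weight_bound R k ^+ 2) t1 => t t1.
by have : 0 <= (spread R k + 5) * (t - 1) by [rewrite mulr_ge0//; lra]; lra.
Qed.

End NodeKernel.

(** * Hyperbolic separation of the nodes *)

Section NodeSeparation.
Variable R : realType.

(** By [blaschke_identity] this is 1 / (1 - rho^2), rho the pseudo-hyperbolic distance of the two
    nodes. *)
Definition node_ratio b i b' i' : R :=
  cabs (inv_node R b i * conjc (inv_node R b' i') - 1) ^+ 2 /
  ((cabs (inv_node R b i) ^+ 2 - 1) * (cabs (inv_node R b' i') ^+ 2 - 1)).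

Lemma node_ratioC b i b' i' : node_ratio b i b' i' = node_ratio b' i' b i.
Proof. by rewrite /node_ratio cabs_pair_sym [X in _ / X]mulrC. Qed.

Lemma ln_ratio_ge (m c Q : R) : 0 < m -> 0 < c -> m / c <= Q -> ln m - c <= ln Q.
Proof.
move=> m0 c0 hQ; apply: le_trans (_ : ln (m / c) <= _).
  by rewrite ln_div ?posrE// lerD2l lerN2; apply: le_trans (ln_le_sub1 c0) _; lra.
by rewrite ler_ln ?posrE ?divr_gt0//; apply: lt_le_trans hQ; rewrite divr_gt0.
Qed.

Lemma ln_ratio_ge2 (m c Q : R) : 0 < m -> 0 < c -> m / c ^+ 2 <= Q -> ln m - 2 * ln c <= ln Q.
Proof.
move=> m0 c0 hQ; have q0 : 0 < m / c ^+ 2 by rewrite divr_gt0// exprn_gt0.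
apply: le_trans (_ : ln (m / c ^+ 2) <= _).
  by rewrite ln_div ?posrE ?exprn_gt0// lnXn// mulr_natl.
by rewrite ler_ln ?posrE//; apply: lt_le_trans hQ.
Qed.

Lemma ratio_same (m B c x y mu mu' : R) : 0 < m -> 0 < B -> 0 < x -> 0 < y ->
  0 < mu -> 0 < mu' -> 1 <= m * c -> mu * x <= B -> mu' * y <= B -> m ^+ 3 <= mu * mu' ->
  m / B ^+ 2 <= c ^+ 2 / (x * y).
Proof.
move=> m0 B0 x0 y0 mu0 mu0' hc hx hy hm.
rewrite ler_pdivrMr ?exprn_gt0// mulrAC ler_pdivlMr ?mulr_gt0//.
rewrite -(@ler_pM2r _ (m ^+ 2)) ?exprn_gt0//.
apply: le_trans (_ : B ^+ 2 <= _).
  have -> : m * (x * y) * m ^+ 2 = m ^+ 3 * (x * y) by ring.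
  apply: le_trans (_ : (mu * x) * (mu' * y) <= _).
    have -> : mu * x * (mu' * y) = mu * mu' * (x * y) by ring.
    by rewrite ler_wpM2r// mulr_ge0// ltW.
  by rewrite expr2; apply: ler_pM => //; rewrite mulr_ge0// ltW.
have -> : c ^+ 2 * B ^+ 2 * m ^+ 2 = (m * c) ^+ 2 * B ^+ 2 by ring.
by rewrite ler_peMl ?sqr_ge0// exprn_ege1.
Qed.

(** Here c is at least y - 1, so at least a third of y^2 - 1. The quotient thus dominates (y^2 - 1)
    / (9 (y'^2 - 1)), the ratio of the two depths. *)
Lemma ratio_cross (m M B c y y' mu mu' : R) : mu <= M -> m <= mu' ->
  1 <= mu * (y ^+ 2 - 1) -> mu' * (y' ^+ 2 - 1) <= B -> 1 < y ^+ 2 -> y ^+ 2 <= 2 ->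
  1 < y' ^+ 2 -> 1 < y -> y - 1 <= c -> 0 < m -> 0 < B -> 0 < M ->
  m / (9 * M * B) <= c ^+ 2 / ((y ^+ 2 - 1) * (y' ^+ 2 - 1)).
Proof.
move=> muM mmu h1 h2 n1 n2 n1' y1 yc m0 B0 M0.
have x0 : 0 < y ^+ 2 - 1 by rewrite subr_gt0.
have x0' : 0 < y' ^+ 2 - 1 by rewrite subr_gt0.
have y2 : y <= 2 by rewrite -ler_sqr ?nnegrE//; lra.
have h3 : y ^+ 2 - 1 <= 3 * c.
  have -> : y ^+ 2 - 1 = (y + 1) * (y - 1) by ring.
  by apply: ler_pM => //; lra.
move: (y ^+ 2 - 1) (y' ^+ 2 - 1) h1 h2 h3 x0 x0' => x x' h1 h2 h3 x0 x0'.
rewrite ler_pdivrMr ?mulr_gt0// mulrAC ler_pdivlMr ?mulr_gt0//.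
have a1 : m * x' <= B by apply: le_trans h2; rewrite ler_pM2r.
have a2 : 1 <= M * x by apply: le_trans h1 _; rewrite ler_pM2r.
have a3 : x ^+ 2 <= 9 * c ^+ 2.
  have -> : 9 * c ^+ 2 = (3 * c) ^+ 2 by ring.
  by rewrite ler_sqr ?nnegrE//; lra.
have -> : m * (x * x') = (m * x') * x by ring.
have -> : c ^+ 2 * (9 * M * B) = B * (M * (9 * c ^+ 2)) by ring.
apply: ler_pM => //; [by rewrite mulr_ge0 ?ltW|exact: ltW|].
apply: le_trans (_ : M * x ^+ 2 <= _); last by rewrite ler_pM2l.
by rewrite expr2 mulrA ler_peMl// ltW.
Qed.

Lemma node_ratio_same b i b' i' k : node_cluster b i = k -> node_cluster b' i' = k ->
  (b, i) != (b', i') -> level R k / 2 <= ln (node_ratio b i b' i').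
Proof.
move=> ck ck' ne.
have /andP[p1 _] := node_pair R ck ck' ne.
have /andP[n1 n2] := node_sqr R ck; have /andP[n1' n2'] := node_sqr R ck'.
have /andP[r1 _] := node_range R b i; have /andP[r1' _] := node_range R b' i'.
have [s1 s2 _ s4 _] := level_facts R k; have sp := spread_ge3 R k.
have t1 : 1 <= weight_bound R k ^+ 2 by rewrite exprn_ege1// weight_bound_ge1.
have m0 : (0 : R) < (modulus R k)%:R by rewrite ltr0n modulus_gt0.
have m1 : (1 : R) <= (modulus R k)%:R by rewrite ler1n modulus_gt0.
(* A cluster has a single z, so at least one of two distinct nodes is a w, with scale m^2. *)
have mu3 : (modulus R k)%:R ^+ 3 <= (node_scale R b k)%:R * (node_scale R b' k)%:R :> R.
  move: ne ck ck'; rewrite /node_scale; case: b b' {p1 n1 n2 n1' n2' r1 r1'} => [] [] ne ck ck';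
    rewrite ?natrX; move: (modulus R k)%:R m1 => m m1.
  - by rewrite -exprD ler_weXn2l.
  - by rewrite -exprSr.
  - by rewrite -exprS.
  - by move: ck ck' ne => /= -> ->; rewrite eqxx.
have lnB : 2 * ln (spread R k) <= level R k / 2.
  have h1 : ln (spread R k) <= spread R k - 1 by apply: ln_le_sub1; lra.
  move: (weight_bound R k ^+ 2) t1 s4 => t t1 s4.
  have h : 0 <= (spread R k + 5) * (t - 1) by rewrite mulr_ge0//; lra.
  lra.
have B0 : 0 < spread R k by lra.
have hQ : (modulus R k)%:R / spread R k ^+ 2 <= node_ratio b i b' i'.
  by apply: ratio_same (mu3) => //; rewrite ?subr_gt0// ltr0n node_scale_gt0.
have := ln_ratio_ge2 m0 B0 hQ; rewrite -/(level R k); lra.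
Qed.

Lemma level_le k l : (k < l)%N -> level R k <= level R l.
Proof.
move=> kl; have [_ _ s3 _ _] := level_facts R k; have [_ s2 _ _ h] := level_facts R l.
have [h1 h2 h3] := threshold_ge R l (modulus_gt0 R k).
apply: le_trans s3 _; apply: le_trans s2; apply: le_trans (h _ kl); apply: le_trans h3.
have t1 := weight_bound_ge1 R l; have m1 : (1 : R) <= (modulus R k)%:R by rewrite ler1n modulus_gt0.
move: (weight_bound R l) (modulus R k)%:R t1 m1 => t m t1 m1.
by have : 0 <= (t - 1) * m ^+ 2 by [rewrite mulr_ge0 ?sqr_ge0//; lra]; nra.
Qed.

Lemma node_ratio_cross b i b' i' k l : node_cluster b i = k -> node_cluster b' i' = l ->
  (k < l)%N -> level R l / 2 <= ln (node_ratio b i b' i').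
Proof.
move=> ck cl kl.
have /andP[n1 n2] := node_sqr R ck; have /andP[n1' n2'] := node_sqr R cl.
have /andP[r1 r2] := node_range R b i; have /andP[r1' _] := node_range R b' i'.
have y1 := inv_node_gt1 R b i; have y1' := inv_node_gt1 R b' i'.
have [_ s2 _ _ h] := level_facts R l; have {h} hth := le_trans (h _ kl) s2.
have sp := spread_ge3 R l; have t1 : 1 <= weight_bound R l ^+ 2 by rewrite exprn_ege1// weight_bound_ge1.
have m0 : (0 : R) < (modulus R l)%:R by rewrite ltr0n modulus_gt0.
have mk1 : (1 : R) <= (modulus R k)%:R ^+ 2 by rewrite exprn_ege1// ler1n modulus_gt0.
have c1 : cabs (inv_node R b i) - 1 <= cabs (inv_node R b i * conjc (inv_node R b' i') - 1).
  apply: le_trans (cabsB_ge _ _); rewrite cabs1 lerD2r cabsM cabs_conj ler_peMr ?cabs_ge0//.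
  exact: ltW.
have hmu := node_scale_le R b k.
have hmu' : (modulus R l)%:R <= (node_scale R b' l)%:R :> R.
  by rewrite ler_nat /node_scale; case: (b') => //; rewrite expnS leq_pmulr// expn_gt0 modulus_gt0.
have c0 : 0 < 9 * (modulus R k)%:R ^+ 2 * spread R l by rewrite mulr_gt0//; lra.
have hQ : (modulus R l)%:R / (9 * (modulus R k)%:R ^+ 2 * spread R l) <= node_ratio b i b' i'.
  by have := ratio_cross hmu hmu' n1 n2' r1 r2 r1' y1 c1; apply => //; lra.
have := ln_ratio_ge m0 c0 hQ; rewrite -/(level R l).
move: hth; rewrite /threshold.
move: (weight_bound R l ^+ 2) ((modulus R k)%:R ^+ 2) (spread R l) (level R l) t1 mk1 sp => t M B A t1 mk1 sp hth.
have h1 : 0 <= (24 * (B + 5) * M) * (t - 1) by rewrite mulr_ge0//; nra.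
have h2 : 0 <= B * M by rewrite mulr_ge0//; lra.
lra.
Qed.

Lemma node_separated b i b' i' : (b, i) != (b', i') ->
  level R (node_cluster b i) / 2 <= ln (node_ratio b i b' i').
Proof.
move=> ne; have [lt|lt|e] := ltngtP (node_cluster b i) (node_cluster b' i').
- apply: le_trans (node_ratio_cross erefl erefl lt); have := level_le lt; lra.
- rewrite node_ratioC; exact: node_ratio_cross erefl erefl lt.
- exact: node_ratio_same erefl (esym e) ne.
Qed.

(** Coinciding nodes would have ratio 1, with logarithm 0, against [node_separated]. *)
Lemma node_inj b i b' i' : node R b i = node R b' i' -> (b, i) = (b', i').
Proof.
move=> /invr_inj e; apply/eqP; apply/negPn/negP => ne.
have := node_separated ne; rewrite /node_ratio -e.
have /andP[r1 _] := node_range R b i.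
have -> : cabs (inv_node R b i * conjc (inv_node R b i) - 1) = cabs (inv_node R b i) ^+ 2 - 1.
  rewrite mulc_conj -(rmorph1 (real_complex R)) -rmorphB cabsC ger0_norm//.
  by rewrite subr_ge0 ltW.
rewrite -expr2 divff ?ln1; last by rewrite expf_neq0// gt_eqF// subr_gt0.
by have := level_gt0 R (node_cluster b i); lra.
Qed.

Lemma node_dist0 b i :
  hyperbolic_dist (node R b i) 0 <= (2 * level R (node_cluster b i) + 4) / ln 2.
Proof.
have ln2 : 0 < ln 2 :> R by rewrite ln_gt0// ltr1n.
apply: le_trans (hyperbolic_dist0_le (node_range R b i)) _.
rewrite ler_pM2r ?invr_gt0//.
set k := node_cluster b i.
have /andP[n1 _] := node_sqr R (erefl k).
have /andP[r1 _] := node_range R b i.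
have hmu := node_scale_le R b k.
have m0 : (0 : R) < (modulus R k)%:R by rewrite ltr0n modulus_gt0.
have x0 : 0 < cabs (inv_node R b i) ^+ 2 - 1 by rewrite subr_gt0.
have mm0 : 0 < 2 ^+ 4 * (modulus R k)%:R ^+ 2 :> R by rewrite mulr_gt0 ?exprn_gt0.
apply: le_trans (_ : ln (2 ^+ 4 * (modulus R k)%:R ^+ 2) <= _).
  rewrite ler_ln ?posrE ?divr_gt0//.
  rewrite ler_pdivrMr//.
  have h1 : 1 <= (modulus R k)%:R ^+ 2 * (cabs (inv_node R b i) ^+ 2 - 1).
    by apply: le_trans n1 _; rewrite ler_wpM2r// ltW.
  move: (modulus R k)%:R (cabs _ ^+ 2 - 1) h1 => m x h1.
  have -> : 2 ^+ 4 * m ^+ 2 * x = 16 * (m ^+ 2 * x) by ring.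
  by rewrite ler_peMr.
rewrite lnM ?posrE ?exprn_gt0// !lnXn// -/(level R k).
have : ln 2 <= 1 :> R by apply: le_trans (ln_le_sub1 _) _ => //; lra.
move: (level R k) (ln 2) => a c h; rewrite !mulrS mulr0n; lra.
Qed.

End NodeSeparation.

(** * Interpolation for the two families and failure for their union *)

Section Families.
Variable R : realType.

Definition z_seq : nat -> R[i] := node R false.
Definition w_seq : nat -> R[i] := node R true.
Definition label_cluster (p : nat) : nat := trunc_log 16 p.+1.
Definition center (p : nat) : R[i] := z_seq (label_cluster p).
(* The kernels at the w_p of one cluster have pairwise inner products of about
   log m_k; subtracting the kernel at z_k makes them nearly orthogonal. *)
Definition w_vec (p n : nat) : R[i] := kernel_vec (w_seq p) n - kernel_vec (center p) n.

Lemma node_in_disc b : in_disc (node R b).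
Proof. by move=> i; exact: node_lt1. Qed.

(** 1 / d <= 2 / A <= 2 eta_i^2, since sqrt A was made to exceed 1 / eta_i. *)
Lemma node_finite_measure b : finite_associated_measure (node R b).
Proof.
apply: le_lt_trans (ltry 2); apply: nneseries_le.
  move=> i; rewrite invr_ge0; have /andP[h _] := node_sqnorm R (erefl (node_cluster b i)).
  by apply: le_trans h; rewrite divr_ge0// ltW// level_gt0.
move=> N; apply: le_trans (_ : \sum_(i < N) 2 * eta R i ^+ 2 <= _); last first.
  by rewrite -mulr_sumr ler_piMr//; exact: eta_sqr_sum.
apply: ler_sum => i _; have /andP[h _] := node_sqnorm R (erefl (node_cluster b i)).
have l0 := level_gt0 R (node_cluster b i).
have h1 := level_eta R (erefl (node_cluster b i)).
have h2 : 1 <= level R (node_cluster b i) * eta R i ^+ 2.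
  by rewrite -{1}(sqr_sqrtr (ltW l0)) -exprMn exprn_ege1.
have k0 : 0 < kernel_sqnorm (node R b i) by apply: lt_le_trans h; rewrite divr_gt0.
rewrite -(@ler_pM2l _ (kernel_sqnorm (node R b i)))// mulfV ?gt_eqF//.
apply: le_trans h2 _; have := sqr_ge0 (eta R i); move: (eta R i ^+ 2) => e e0.
by rewrite mulrA ler_wpM2r//; lra.
Qed.

Lemma z_gram i j :
  cabs (kernel_series (z_seq j * conjc (z_seq i)) - real_complex R (level R i *+ (i == j))) <=
     eta R i * eta R j * (Num.sqrt (level R i) * Num.sqrt (level R j)).
Proof.
have h := node_kernel_approx R (erefl (node_cluster false i)) (erefl (node_cluster false j)).
have h2 := cross_bound_eta R (erefl (node_cluster false i)) (erefl (node_cluster false j)).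
rewrite /= in h h2.
have -> : nat_of_bool (i == j) = kernel_weight false false i j.
  by rewrite /kernel_weight /=; case: eqP.
apply: le_trans h _; apply: le_trans h2; have : 0 <= cross_bound R i j; last by lra.
rewrite /cross_bound divr_ge0// ?mulr_ge0 ?sqrtr_ge0//; exact: le_trans ler01 (weight_bound_ge1 _ _).
Qed.

Lemma z_interpolating : universally_interpolating z_seq.
Proof.
split; last first.
  apply: (@bounded_restriction_of_gram _ _ (level R)) z_gram.
  - exact: node_in_disc.
  - exact: level_gt0.
  - by move=> i; have /andP[] := node_sqnorm R (erefl (node_cluster false i)).
apply: (@interpolation _ _ (fun i => kernel_vec (z_seq i))
   (fun i j => kernel_series (z_seq j * conjc (z_seq i))) (level R)).
- exact: node_in_disc.
- by move=> i; exact: (level_eta R (erefl (node_cluster false i))).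
- by move=> i; exact: (node_sqnorm R (erefl (node_cluster false i))).
- move=> i n; apply: le_trans (kernel_vec_le1 _ _) _; first exact: node_in_disc.
  by rewrite ler1n.
- by move=> i j; apply: gram_limit_kernel; exact: node_in_disc.
- exact: z_gram.
- by move=> i j; rewrite cpseries_kernel_vec; exact: z_gram.
Qed.

Definition w_pairing (i j : nat) : R[i] :=
  node_kernel R true i true j - node_kernel R false (label_cluster i) true j.

Definition w_gram (i j : nat) : R[i] :=
  node_kernel R true i true j - node_kernel R true i false (label_cluster j) -
  (node_kernel R false (label_cluster i) true j -
   node_kernel R false (label_cluster i) false (label_cluster j)).

Lemma w_gram_limit i j : gram_limit (w_vec i) (w_vec j) (w_gram i j).
Proof.
by apply: gram_limitBl; apply: gram_limitBr; apply: gram_limit_kernel; exact: node_in_disc.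
Qed.

(** Both matrices have diagonal A: 2 A - A for the values, 2 A - A - A + A for the inner products.
    They combine two and four kernel values, each with error [cross_bound]. *)
Lemma w_approx i j (A := level R (label_cluster i)) (A' := level R (label_cluster j)) :
  cabs (w_pairing i j - real_complex R (A *+ (i == j))) <=
     eta R i * eta R j * (Num.sqrt A * Num.sqrt A') /\
  cabs (w_gram i j - real_complex R (A *+ (i == j))) <=
     eta R i * eta R j * (Num.sqrt A * Num.sqrt A').
Proof.
have h1 := node_kernel_approx R (erefl (node_cluster true i)) (erefl (node_cluster true j)).
have h2 := node_kernel_approx R (erefl (node_cluster true i)) (erefl (node_cluster false (label_cluster j))).
have h3 := node_kernel_approx R (erefl (node_cluster false (label_cluster i))) (erefl (node_cluster true j)).
have h4 := node_kernel_approx R (erefl (node_cluster false (label_cluster i))) (erefl (node_cluster false (label_cluster j))).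
have hb := cross_bound_eta R (erefl (node_cluster true i)) (erefl (node_cluster true j)).
rewrite /= -/(label_cluster i) -/(label_cluster j) -/A -/A' in h1 h2 h3 h4 hb.
have [e1 e2] : A *+ (i == j) = A *+ kernel_weight true true i j -
      A *+ kernel_weight false true (label_cluster i) j /\
   A *+ kernel_weight true false i (label_cluster j) =
      A *+ kernel_weight false false (label_cluster i) (label_cluster j).
  rewrite /kernel_weight /= -/(label_cluster i) -/(label_cluster j).
  case: (eqVneq i j) => [->|_]; first by rewrite eqxx mulr2n addrK.
  by case: eqP; rewrite ?subrr.
have w0 : 0 <= cross_bound R (label_cluster i) (label_cluster j).
  exact: le_trans (cabs_ge0 _) h1.
have alg (a b x y : R[i]) : a - b - (x - y) = (a - x) - (b - y) by ring.
have alg' (a b x y u v : R[i]) : a - b - (x - y) - u = a - x - u - ((b - v) - (y - v)) by ring.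
have d1 : cabs (w_pairing i j - real_complex R (A *+ (i == j))) <=
    2 * cross_bound R (label_cluster i) (label_cluster j).
  rewrite e1 rmorphB /=.
  have -> : w_pairing i j - (real_complex R (A *+ kernel_weight true true i j) -
     real_complex R (A *+ kernel_weight false true (label_cluster i) j)) =
     (node_kernel R true i true j - real_complex R (A *+ kernel_weight true true i j)) -
     (node_kernel R false (label_cluster i) true j -
       real_complex R (A *+ kernel_weight false true (label_cluster i) j)).
    exact: alg.
  by apply: le_trans (cabsB _ _) _; rewrite mulr_natl mulr2n; exact: lerD h1 h3.
have hb2 : 4 * cross_bound R (label_cluster i) (label_cluster j) =
    2 * cross_bound R (label_cluster i) (label_cluster j) +
    2 * cross_bound R (label_cluster i) (label_cluster j).
  by rewrite -mulrDl -natrD.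
rewrite hb2 in hb; split.
  by apply: le_trans d1 (le_trans _ hb); rewrite lerDl mulr_ge0.
apply: le_trans hb.
have -> : w_gram i j - real_complex R (A *+ (i == j)) =
    (w_pairing i j - real_complex R (A *+ (i == j))) -
    ((node_kernel R true i false (label_cluster j) -
       real_complex R (A *+ kernel_weight true false i (label_cluster j))) -
     (node_kernel R false (label_cluster i) false (label_cluster j) -
       real_complex R (A *+ kernel_weight false false (label_cluster i) (label_cluster j)))).
  by rewrite e2; exact: alg'.
apply: le_trans (cabsB _ _) _.
apply: lerD d1 _; apply: le_trans (cabsB _ _) _.
by rewrite mulr_natl mulr2n; exact: lerD h2 h4.
Qed.

Lemma w_vec_bound i n : cabs (w_vec i n) <= 2.
Proof.
apply: le_trans (cabsB _ _) _; rewrite (_ : 2 = 1 + 1)//.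
by apply: lerD; apply: kernel_vec_le1; exact: node_in_disc.
Qed.

Lemma cpseries_w_vec i j : cpseries (w_vec i) (w_seq j) = w_pairing i j.
Proof.
have s p : subexponential (kernel_vec (node R p.1 p.2)).
  by apply: (@bounded_subexponential _ _ 1) => n; apply: kernel_vec_le1; exact: node_in_disc.
have w1 := node_in_disc true j.
rewrite /w_pairing /node_kernel -!cpseries_kernel_vec; apply: csum_ctends.
have := ctendsB (cpseries_ctends (s (true, i)) w1)
  (cpseries_ctends (s (false, label_cluster i)) w1).
by apply: ctends_ext => N; rewrite -sumrB; apply: eq_bigr => n _; rewrite /w_vec mulrBl.
Qed.

Lemma w_interpolating : onto_interpolating w_seq.
Proof.
apply: (@interpolation _ _ w_vec w_gram (fun p => level R (label_cluster p))).
- exact: node_in_disc.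
- by move=> i; exact: (level_eta R (erefl (node_cluster true i))).
- by move=> i; exact: (node_sqnorm R (erefl (node_cluster true i))).
- exact: w_vec_bound.
- exact: w_gram_limit.
- by move=> i j; have [] := w_approx i j.
- by move=> i j; rewrite cpseries_w_vec; have [] := w_approx i j.
Qed.

Definition union_seq (n : nat) : R[i] := node R (odd n) n./2.

Lemma union_enumerates : enumerates_union union_seq z_seq w_seq.
Proof.
split.
  move=> n n' /node_inj[e1 e2].
  by rewrite -(odd_double_half n) -(odd_double_half n') e1 e2.
apply/seteqP; split => [_ [n _ <-]|_ [[n _ <-]|[n _ <-]]].
- rewrite /union_seq; case: (odd n); [right|left]; by exists n./2.
- by exists n.*2 => //; rewrite /union_seq odd_double doubleK.
- by exists n.*2.+1 => //; rewrite /union_seq /= odd_double uphalf_double.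
Qed.

(** In units of 1 / ln 2, distances to 0 are at most 2 A + 4 and mutual distances at least A / 2;
    with the added ln 2 <= 1, the constant 1/6 requires exactly A >= 5. *)
Lemma union_separated : weakly_separated union_seq.
Proof.
exists 6^-1; first by rewrite invr_gt0.
move=> n n' ne; have ne' : (odd n, n./2) != (odd n', n'./2).
  by apply/eqP => -[e1 e2]; apply: ne; rewrite /union_seq e1 e2.
have /andP[r _] := node_range R (odd n) n./2.
have /andP[r' _] := node_range R (odd n') n'./2.
apply: le_trans (hyperbolic_dist_ge r r').
have h := node_separated R ne'; rewrite /node_ratio in h.
have h0 := node_dist0 R (odd n) n./2.
have ln2 : 0 < ln 2 :> R by rewrite ln_gt0// ltr1n.
have ln21 : ln 2 <= 1 :> R by apply: le_trans (ln_le_sub1 _) _ => //; lra.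
have l5 : 5 <= level R (node_cluster (odd n) n./2).
  have [s1 s2 _ s4 _] := level_facts R (node_cluster (odd n) n./2).
  have sp := spread_ge3 R (node_cluster (odd n) n./2).
  have t1 : 1 <= weight_bound R (node_cluster (odd n) n./2) ^+ 2 by rewrite exprn_ege1// weight_bound_ge1.
  by move: (_ ^+ 2) t1 s4 => t t1 s4; nra.
rewrite ler_pdivlMr//; apply: le_trans h.
move: h0; rewrite ler_pdivlMr// => h0.
rewrite -/(union_seq n) in h0.
move: (hyperbolic_dist _ _) (ln 2) (level R _) h0 ln2 ln21 l5 => a c l h0 ln2 ln21 l5.
have -> : 6^-1 * (a + 1) * c = 6^-1 * (a * c + c) by ring.
lra.
Qed.

(** The first 16^k labels of the cluster, out of 15 * 16^k. *)
Lemma block_cluster k i : (16 ^ k - 1 <= i < 16 ^ k - 1 + 16 ^ k)%N -> label_cluster i = k.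
Proof.
move=> /andP[h1 h2]; have p0 : (0 < 16 ^ k)%N by rewrite expn_gt0.
apply: trunc_log_eq => //; rewrite expnS; apply/andP; split; lia.
Qed.

Lemma union_not_onto : ~ onto_interpolating union_seq.
Proof.
move=> onto.
(* The data are 0 on the w's and 2^-k at z_k. *)
pose a n : R[i] := if odd n then 0 else real_complex R (2 ^+ n./2)^-1.
have a2 n : cabs (a n) ^+ 2 <= 1 / 2 ^+ n.
  rewrite /a; case: ifP => on; first by rewrite cabs0 expr0n /= divr_ge0// exprn_ge0.
  rewrite cabsC ger0_norm ?invr_ge0 ?exprn_ge0// exprVn -exprM muln2.
  by rewrite -[n in leRHS]odd_double_half on mul1r.
have al2 : little_l2 a.
  apply: le_lt_trans (ltry 2); apply: nneseries_le => [i|N]; first exact: sqr_ge0.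
  apply: le_trans (_ : \sum_(i < N) 1 / 2 ^+ i <= _); first by apply: ler_sum.
  by apply: le_trans (half_sum N ler01) _; rewrite mulr1.
have [f fD hf] := onto a al2.
have d0 b i : 0 < kernel_sqnorm (node R b i).
  have /andP[h _] := node_sqnorm R (erefl (node_cluster b i)).
  by apply: lt_le_trans h; rewrite divr_gt0// level_gt0.
have val n : f (union_seq n) = a n * real_complex R (Num.sqrt (kernel_sqnorm (union_seq n))).
  rewrite -hf /weighted_restriction divfK// fmorph_eq0 gt_eqF// sqrtr_gt0; exact: d0.
have fw i : f (w_seq i) = 0.
  have := val i.*2.+1; rewrite /a /= odd_double /= mul0r.
  by rewrite /union_seq /= odd_double uphalf_double.
have fz k : cabs (f (z_seq k)) ^+ 2 = (4 ^+ k)^-1 * kernel_sqnorm (z_seq k).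
  have := val k.*2; rewrite /a odd_double doubleK /union_seq odd_double doubleK => ->.
  rewrite cabsM !cabsC !ger0_norm ?sqrtr_ge0 ?invr_ge0 ?exprn_ge0//.
  rewrite exprMn sqr_sqrtr ?(ltW (d0 false k))// exprVn -exprM mulnC exprM.
  by congr ((_ ^+ _)^-1 * _); ring.
pose C := 2 * norm_const R * fine (dirichlet_sqnorm f).
(* [block_bound] with M = 16^k gives 4^-k d(z_k) <= C A / 16^k, while d(z_k) >= A / 2. *)
have key k : 4 ^+ k <= 2 * C.
  have M0 : (0 < 16 ^ k)%N by rewrite expn_gt0.
  have bc := @block_cluster k.
  have es : label_cluster (16 ^ k - 1) = k by apply: bc; rewrite leqnn /= -[ltnLHS]addn0 ltn_add2l.
  have hblock i : (16 ^ k - 1 <= i < 16 ^ k - 1 + 16 ^ k)%N -> center i = center (16 ^ k - 1) /\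
      level R (label_cluster i) = level R (label_cluster (16 ^ k - 1)).
    by move=> /bc ei; rewrite /center ei es.
  have h := block_bound M0 (node_in_disc true) (fun i => node_in_disc false (label_cluster i))
     (fun i => level_gt0 R (label_cluster i)) w_gram_limit (fun i j => proj2 (w_approx i j)) fD fw hblock.
  rewrite /center es fz -/C natrX in h.
  have /andP[h1 _] := node_sqnorm R (erefl (node_cluster false k)).
  rewrite /= -/(z_seq k) in h1.
  have l0 := level_gt0 R k.
  have p0 : (0 : R) < 4 ^+ k by rewrite exprn_gt0.
  have e16 : 16 ^+ k = 4 ^+ k * 4 ^+ k :> R by rewrite -exprMn; congr (_ ^+ _); ring.
  rewrite e16 ler_pdivlMr ?mulr_gt0// in h.
  have h2 : 4 ^+ k * kernel_sqnorm (z_seq k) <= C * level R k.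
    apply: le_trans h; rewrite le_eqVlt; apply/orP; left; apply/eqP; field.
    by rewrite gt_eqF.
  rewrite -(ler_pM2r l0).
  have := ler_wpM2l (ltW p0) h1; lra.
pose k := Num.truncn (2 * C).
have : 2 * C < 4 ^+ k.+1.
  apply: lt_le_trans (truncnS_gt _) _; rewrite -natrX ler_nat.
  by apply: ltnW; exact: ltn_expl.
by rewrite ltNge key.
Qed.

End Families.

Theorem theorem5 (R : realType) :
  exists z w : nat -> R[i],
    in_disc z /\ in_disc w /\
    finite_associated_measure z /\ finite_associated_measure w /\
    universally_interpolating z /\ onto_interpolating w /\
    exists u : nat -> R[i],
      enumerates_union u z w /\ weakly_separated u /\ ~ onto_interpolating u.
Proof.
exists (z_seq R), (w_seq R); split; first exact: node_in_disc.
split; first exact: node_in_disc.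
split; first exact: node_finite_measure.
split; first exact: node_finite_measure.
split; first exact: z_interpolating.
split; first exact: w_interpolating.
exists (union_seq R); split; first exact: union_enumerates.
split; [exact: union_separated | exact: union_not_onto].
Qed.
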